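(* Let $R$ be an integral domain containing $\mathbb{Q}$. Let $(\mathcal{H},\nabla)/R[[t_1,\dots,t_d]]$ be a finite rank F-bundle and let $v\in\mathcal{H}/(t_1,\dots,t_d,u)\mathcal{H}$. 1. If $v$ satisfies (IC) and (GC), and $\operatorname{coker}\mu_v$ is a free $R$-module, then there exists a maximal unfolding of $(\mathcal{H},\nabla)$ with a cyclic vector induced from $v$. 2. If $v$ satisfies (GC'), then any two maximal unfoldings of $(\mathcal{H},\nabla)$ with cyclic vectors induced from $v$ are isomorphic (as unfoldings) under a unique isomorphism. Furthermore, any framing for $(\mathcal{H},\nabla)$ induces a unique framing on a maximal unfolding (that is, there is a unique framing of the unfolding whose pullback along the unfolding corresponds to the given framing).
   Context: An F-bundle $(\mathcal{H},\nabla)$ over $R[[t_I]]$ ($t_I=\{t_i\}_{i\in I}$) is a free $R[[t_I,u]]$-module $\mathcal{H}$ together with an $R$-linear flat connection $\nabla_{\partial_{t_i}}:\mathcal{H}\to u^{-1}\mathcal{H}$, $\nabla_{\partial_u}:\mathcal{H}\to u^{-2}\mathcal{H}$. A morphism $(f,\phi):(\mathcal{H},\nabla)/R[[t_I]]\to(\mathcal{H}',\nabla')/R[[t_J]]$ is a continuous $R$-algebra map $f:R[[t_J]]\to R[[t_I]]$ and an $R[[t_I,u]]$-linear map $\phi:\mathcal{H}\to f^*\mathcal{H}'=\mathcal{H}'\otimes_{R[[t_J,u]]}R[[t_I,u]]$ with $\phi\circ\nabla=f^*\nabla'\circ\phi$. A framing is an isomorphism $\mathcal{H}\simeq H\otimes_RR[[t_I,u]]$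 ($H$ a free $R$-module) in which the connection matrices contain only negative powers of $u$: $\nabla_{\partial_{t_i}}=\partial_{t_i}+u^{-1}A_i(t)$ and $\nabla_{\partial_u}=\partial_u+u^{-2}U_{-2}(t)+u^{-1}U_{-1}(t)$. An unfolding of $(\mathcal{H},\nabla)/R[[t_I]]$ is a morphism of F-bundles $(i,\phi):(\mathcal{H},\nabla)/R[[t_I]]\to(\mathcal{H}',\nabla')/R[[t_J]]$ with $I\subset J$, $i:R[[t_J]]\to R[[t_I]]$ the quotient by the closure of the ideal $(t_j,\ j\in J\setminus I)$, and $\phi:\mathcal{H}\to i^*\mathcal{H}'$ an isomorphism. A morphism between two unfoldings is a morphism of F-bundles $(f,\psi)$ between their targets, with $\psi$ an isomorphism, commuting with the unfolding maps. Let $H=\mathcal{H}/(t_I,u)\mathcal{H}$, $\mathrm{K}=\nabla_{u^2\partial_u}|_{u=t=0}\in\operatorname{End}_R(H)$, $\mu:\bigoplus_iR\,\partial_{t_i}\to\operatorname{End}_R(H)$, $\partial_{t_i}\mapsto\nabla_{u\partial_{t_i}}|_{u=t=0}$, and $\mu_v(\xi)=\mu(\xi)(v)$ for $v\in H$. (IC): $\mu_v$ is injective. (GC): the orbit of $v$ under the subalgebra $R[\operatorname{im}\mu,\mathrm{K}]\subset\operatorname{End}_R(H)$ is $H$. (GC'): (GC) holds after base change to $\operatorname{Frac}(R)$. The F-bundle is maximal if there is $v\in H$ with $\mu_v$ an isomorphism; such $v$ is called a cyclic vector. A maximal unfolding is an unfolding whose target is maximal; its cyclic vector is induced from $v$ if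 it is the image of $v$ under the identification of the fibers at $t=u=0$ given by the unfolding. *)

(* Defs.v *)
From HB Require Import structures.
From mathcomp Require Import all_boot all_order all_algebra.
From mathcomp Require Import boolp.
From mathcomp Require Export mpoly.

Set Implicit Arguments.
Unset Strict Implicit.
Unset Printing Implicit Defensive.

Import GRing.Theory.
Local Open Scope ring_scope.

(* [mseries R n] is the ring R[[X_0, ..., X_(n-1)]]; a series is given by its
   family of coefficients. *)
Record mseries (R : comNzRingType) (n : nat) :=
  MSeries { mscoef :> 'X_{1..n} -> R }.

Section SeriesRing.
Variables (R : comNzRingType) (n : nat).
Local Notation series := (mseries R n).
Implicit Types (a b c : series) (m : 'X_{1..n}) (k : nat).

Lemma mseriesP a b : a =1 b -> a = b.
Proof. by case: a b => [f] [g] /= fg; congr MSeries; apply/funext. Qed.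

HB.instance Definition _ := gen_eqMixin series.
HB.instance Definition _ := gen_choiceMixin series.

Definition ms_zero : series := MSeries (fun=> 0).
Definition ms_opp a : series := MSeries (fun m => - a m).
Definition ms_add a b : series := MSeries (fun m => a m + b m).
Definition ms_one : series := MSeries (fun m => (m == 0%MM)%:R).
Definition ms_mul a b : series := MSeries (fun m =>
  \sum_(k : 'X_{1..n < (mdeg m).+1, (mdeg m).+1} | m == (k.1 + k.2)%MM)
     a k.1 * b k.2).
Definition ms_scale (r : R) a : series := MSeries (fun m => r * a m).

Fact ms_addA : associative ms_add.
Proof. by move=> a b c; apply: mseriesP => m /=; rewrite addrA. Qed.
Fact ms_addC : commutative ms_add.
Proof. by move=> a b; apply: mseriesP => m /=; rewrite addrC. Qed.
Fact ms_add0 : left_id ms_zero ms_add.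
Proof. by move=> a; apply: mseriesP => m /=; rewrite add0r. Qed.
Fact ms_addN : left_inverse ms_zero ms_opp ms_add.
Proof. by move=> a; apply: mseriesP => m /=; rewrite addNr. Qed.

HB.instance Definition _ :=
  GRing.isZmodule.Build series ms_addA ms_addC ms_add0 ms_addN.

Definition ms_trunc k a : {mpoly R[n]} :=
  \sum_(m : 'X_{1..n < k}) a m *: 'X_[m].

Lemma mcoeff_trunc k a m : (ms_trunc k a)@_m = if (mdeg m < k)%N then a m else 0.
Proof.
rewrite /ms_trunc raddf_sum /=; case: ifPn => [lt_mk|].
  rewrite (bigD1 (BMultinom lt_mk)) //= mcoeffZ mcoeffX eqxx mulr1.
  rewrite big1 ?addr0 // => i ne_im; rewrite mcoeffZ mcoeffX.
  by rewrite -val_eqE /= in ne_im; rewrite (negPf ne_im) mulr0.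
move=> nlt_mk; rewrite big1 // => i _; rewrite mcoeffZ mcoeffX.
case: eqP => [eq_im|]; last by rewrite mulr0.
by case/negP: nlt_mk; rewrite -eq_im bmdeg.
Qed.

Lemma ms_mulE (p q : {mpoly R[n]}) a b m :
    (forall m', (mdeg m' <= mdeg m)%N -> p@_m' = a m') ->
    (forall m', (mdeg m' <= mdeg m)%N -> q@_m' = b m') ->
  ms_mul a b m = (p * q)@_m.
Proof.
move=> pa qb; rewrite mcoeffM /=; apply: eq_bigr => -[k l] /= _.
by rewrite pa ?qb // -ltnS bmdeg.
Qed.

Lemma ms_mulTE k a b m : (mdeg m < k)%N ->
  ms_mul a b m = (ms_trunc k a * ms_trunc k b)@_m.
Proof.
by move=> lt_mk; apply: ms_mulE => m' le_m'm;
  rewrite mcoeff_trunc (leq_ltn_trans le_m'm).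
Qed.

Fact ms_mulA : associative ms_mul.
Proof.
move=> a b c; apply: mseriesP => m; set k := (mdeg m).+1.
have truncE x m' : (mdeg m' <= mdeg m)%N -> (ms_trunc k x)@_m' = x m'.
  by move=> le_m'm; rewrite mcoeff_trunc ltnS le_m'm.
have mulE x y m' : (mdeg m' <= mdeg m)%N ->
    (ms_trunc k x * ms_trunc k y)@_m' = ms_mul x y m'.
  by move=> le_m'm; rewrite (@ms_mulTE k).
rewrite (ms_mulE (truncE a) (mulE b c)) (ms_mulE (mulE a b) (truncE c)).
by rewrite mulrA.
Qed.

Fact ms_mulC : commutative ms_mul.
Proof.
by move=> a b; apply: mseriesP => m; rewrite !(ms_mulTE _ _ (ltnSn _)) mulrC.
Qed.

Fact ms_mul1 : left_id ms_one ms_mul.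
Proof.
move=> a; apply: mseriesP => m.
rewrite (@ms_mulE 1 (ms_trunc (mdeg m).+1 a)).
- by rewrite mul1r mcoeff_trunc ltnSn.
- by move=> m' _; rewrite mcoeff1.
by move=> m' le_m'm; rewrite mcoeff_trunc ltnS le_m'm.
Qed.

Fact ms_mulDl : left_distributive ms_mul ms_add.
Proof.
move=> a b c; apply: mseriesP => m /=; rewrite -big_split /=.
by apply: eq_bigr => k _; rewrite mulrDl.
Qed.

Fact ms_oner_neq0 : ms_one != 0.
Proof.
apply/eqP => /(congr1 (fun a : series => a 0%MM)) /= /eqP.
by rewrite eqxx oner_eq0.
Qed.

HB.instance Definition _ := GRing.Zmodule_isComNzRing.Build series
  ms_mulA ms_mulC ms_mul1 ms_mulDl ms_oner_neq0.

Fact ms_scaleA r s a : ms_scale r (ms_scale s a) = ms_scale (r * s) a.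
Proof. by apply: mseriesP => m /=; rewrite mulrA. Qed.
Fact ms_scale1 : left_id 1 ms_scale.
Proof. by move=> a; apply: mseriesP => m /=; rewrite mul1r. Qed.
Fact ms_scaleDr : right_distributive ms_scale +%R.
Proof. by move=> r a b; apply: mseriesP => m /=; rewrite mulrDr. Qed.
Fact ms_scaleDl a : {morph ms_scale^~ a : r s / r + s}.
Proof. by move=> r s; apply: mseriesP => m /=; rewrite mulrDl. Qed.

HB.instance Definition _ := GRing.Zmodule_isLmodule.Build R series
  ms_scaleA ms_scale1 ms_scaleDr ms_scaleDl.

Fact ms_scaleAl (r : R) a b : r *: (a * b) = (r *: a) * b.
Proof.
apply: mseriesP => m /=; rewrite mulr_sumr.
by apply: eq_bigr => k _; rewrite mulrA.
Qed.

HB.instance Definition _ :=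
  GRing.Lmodule_isLalgebra.Build R series ms_scaleAl.
HB.instance Definition _ := GRing.Lalgebra_isComAlgebra.Build R series.

Definition ms_var (i : 'I_n) : series := MSeries (fun m => (m == U_(i)%MM)%:R).

Definition ms_der (i : 'I_n) a : series :=
  MSeries (fun m => a (m + U_(i))%MM *+ (m i).+1).

Definition ms_const a : R := a 0%MM.

(* [ms_ord_ge k a] : a lies in the k-th power of the ideal of the variables. *)
Definition ms_ord_ge k a := forall m, (mdeg m < k)%N -> a m = 0.

End SeriesRing.

(* Continuous R-algebra maps for the topology defined by the powers of the
   ideal of the variables; by linearity, continuity is tested at 0. *)
Definition cont_alg_hom (R : comNzRingType) (e d : nat)
    (f : mseries R e -> mseries R d) : Prop :=
  [/\ linear f, monoid_morphism f
    & forall k, exists l, forall a, ms_ord_ge l a -> ms_ord_ge k (f a)].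

(* R[[t_0, ..., t_(d-1), u]] is [mseries R d.+1], with u the variable of
   index [ord0] and t_i the one of index [tidx i]. *)
Section UVariable.
Variable R : comNzRingType.
Implicit Types d e : nat.

Definition tidx d (i : 'I_d) : 'I_d.+1 := lift ord0 i.

Definition uvar d : mseries R d.+1 := ms_var R ord0.

Definition mnm_t d (m : 'X_{1..d.+1}) : 'X_{1..d} :=
  [multinom m (tidx i) | i < d].

Definition mnm_ut d (k : nat) (m : 'X_{1..d}) : 'X_{1..d.+1} :=
  [multinom if unlift ord0 i is Some j then m j else k | i < d.+1].

Definition ucoef d (k : nat) (a : mseries R d.+1) : mseries R d :=
  MSeries (fun m => a (mnm_ut k m)).

(* The inclusion of R[[t]] into R[[t,u]]. *)
Definition tincl d (a : mseries R d) : mseries R d.+1 :=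
  MSeries (fun m => if m ord0 == 0%N then a (mnm_t m) else 0).

(* The extension of f : R[[t_J]] -> R[[t_I]] to R[[t_J,u]] -> R[[t_I,u]],
   sum_k a_k u^k |-> sum_k f(a_k) u^k. *)
Definition uext e d (f : mseries R e -> mseries R d) (a : mseries R e.+1) :
    mseries R d.+1 :=
  MSeries (fun m => f (ucoef (m ord0) a) (mnm_t m)).

(* For an injection iota, the quotient R[[t_J]] -> R[[t_I]] by the ideal
   (t_j, j notin iota(I)), in which t_(iota i) becomes t_i: only the monomials
   supported on iota(I) survive. *)
Definition restr d e (iota : 'I_d -> 'I_e) (a : mseries R e) : mseries R d :=
  MSeries (fun m => a [multinom (\sum_(i | iota i == j) m i)%N | j < e]).

End UVariable.

Definition mx_iso (A : nzRingType) (p q : nat) (P : 'M[A]_(p, q)) : Prop :=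
  exists2 Q : 'M[A]_(q, p), P *m Q = 1%:M & Q *m P = 1%:M.

Section Connections.
Variable R : comNzRingType.

(* A connection on the free module R[[t,u]]^n with poles as in an F-bundle:
     nabla_{d/dt_i} = d/dt_i + u^-1 (conn_t i),
     nabla_{d/du}   = d/du   + u^-2 conn_u. *)
Record connection (d n : nat) := Connection {
  conn_t : 'I_d -> 'M[mseries R d.+1]_n;
  conn_u : 'M[mseries R d.+1]_n
}.

(* u nabla_{d/dt_i} and u^2 nabla_{d/du}, which preserve R[[t,u]]^n. *)
Definition unabla_t d n (c : connection d n) (i : 'I_d)
    (s : 'cV[mseries R d.+1]_n) : 'cV[mseries R d.+1]_n :=
  uvar R d *: map_mx (ms_der (tidx i)) s + conn_t c i *m s.

Definition u2nabla_u d n (c : connection d n)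
    (s : 'cV[mseries R d.+1]_n) : 'cV[mseries R d.+1]_n :=
  uvar R d ^+ 2 *: map_mx (ms_der ord0) s + conn_u c *m s.

(* [nabla_{d/dt_i}, nabla_{d/dt_j}] = 0 and [nabla_{d/du}, nabla_{d/dt_i}] = 0,
   multiplied by u^2 and u^3; the last term comes from
   u^2 nabla_{d/du} (u s) = u^2 s + u (u^2 nabla_{d/du} s). *)
Definition flat d n (c : connection d n) : Prop :=
  (forall i j s, unabla_t c i (unabla_t c j s) =
                 unabla_t c j (unabla_t c i s)) /\
  (forall i s, u2nabla_u c (unabla_t c i s) =
               unabla_t c i (u2nabla_u c s) + uvar R d *: unabla_t c i s).

(* P o nabla = nabla' o P *)
Definition horizontal d n n' (c : connection d n) (c' : connection d n')
    (P : 'M[mseries R d.+1]_(n', n)) : Prop :=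
  (forall i s, P *m unabla_t c i s = unabla_t c' i (P *m s)) /\
  (forall s, P *m u2nabla_u c s = u2nabla_u c' (P *m s)).

(* f^* nabla', by the chain rule:
     (f^* nabla')_{d/dt_i} (1 (x) s)
       = sum_j d(f(t_j))/dt_i (x) nabla'_{d/dt_j} s. *)
Definition pullback e d n (f : mseries R e -> mseries R d)
    (c : connection e n) : connection d n :=
  Connection
    (fun i => \sum_(j < e) tincl (ms_der i (f (ms_var R j)))
                             *: map_mx (uext f) (conn_t c j))
    (map_mx (uext f) (conn_u c)).

(* Finite rank F-bundles over R[[t_0, ..., t_(d-1)]], the underlying free
   module being given with a basis. *)
Record Fbundle (d : nat) := FBundle {
  fb_rank : nat;
  fb_conn :> connection d fb_rank;
  fb_flat : flat fb_conn
}.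

(* In the chosen bases, f^* H' is R[[t_I,u]]^(fb_rank F'), and f^* acts on
   matrices of maps by [map_mx (uext f)]. *)
Definition Fmorphism d e (F : Fbundle d) (F' : Fbundle e)
    (f : mseries R e -> mseries R d)
    (P : 'M[mseries R d.+1]_(fb_rank F', fb_rank F)) : Prop :=
  cont_alg_hom f /\ horizontal F (pullback f F') P.

(* A framing of F, with trivial factor H = R^r. *)
Definition framing d (F : Fbundle d) (r : nat)
    (P : 'M[mseries R d.+1]_(r, fb_rank F)) : Prop :=
  mx_iso P /\
  exists (A : 'I_d -> 'M[mseries R d]_r) (U2 U1 : 'M[mseries R d]_r),
    horizontal F
      (Connection (fun i => map_mx (@tincl R d) (A i))
         (map_mx (@tincl R d) U2 + uvar R d *: map_mx (@tincl R d) U1))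
      P.

Record unfolding d (F : Fbundle d) := Unfolding {
  unf_dim : nat;
  unf_incl : 'I_d -> 'I_unf_dim;
  unf_incl_inj : injective unf_incl;
  unf_tgt : Fbundle unf_dim;
  unf_map : 'M[mseries R d.+1]_(fb_rank unf_tgt, fb_rank F);
  unf_mor : Fmorphism (restr unf_incl) unf_map;
  unf_map_iso : mx_iso unf_map
}.

Definition unf_restr d (F : Fbundle d) (X : unfolding F) :
    mseries R (unf_dim X) -> mseries R d :=
  restr (@unf_incl _ _ X).
Arguments unf_restr {d F} X a.

Definition unf_morphism d (F : Fbundle d) (X Y : unfolding F)
    (f : mseries R (unf_dim Y) -> mseries R (unf_dim X))
    (P : 'M[mseries R (unf_dim X).+1]_(fb_rank (unf_tgt Y),
                                        fb_rank (unf_tgt X))) : Prop :=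
  [/\ Fmorphism f P,
      mx_iso P,
      (forall a, unf_restr X (f a) = unf_restr Y a)
    & map_mx (uext (unf_restr X)) P *m unf_map X = unf_map Y].

Arguments unf_morphism {d F} X Y f P.

(* Morphisms of unfoldings with a two-sided inverse (g, Q); the composite of
   (f, P) : X -> Y and (g, Q) : Y -> X is (f o g, f^*(Q) P). *)
Definition unf_isomorphism d (F : Fbundle d) (X Y : unfolding F)
    (f : mseries R (unf_dim Y) -> mseries R (unf_dim X))
    (P : 'M[mseries R (unf_dim X).+1]_(fb_rank (unf_tgt Y),
                                        fb_rank (unf_tgt X))) : Prop :=
  unf_morphism X Y f P /\
  exists g Q, [/\ unf_morphism Y X g Q,
    cancel g f /\ cancel f g,
    map_mx (uext f) Q *m P = 1%:M
    & map_mx (uext g) P *m Q = 1%:M].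

End Connections.

Arguments unf_restr {R d F} X a.
Arguments unf_morphism {R d F} X Y f P.
Arguments unf_isomorphism {R d F} X Y f P.
Arguments Fmorphism {R d e} F F' f P.
Arguments framing {R d} F {r} P.

Section FiberAtOrigin.

(* The map (+)_i A d/dt_i -> End_A(A^n) sending d/dt_i to M i. *)
Definition mu_map (A : comNzRingType) (d n : nat) (M : 'I_d -> 'M[A]_n)
    (xi : 'cV[A]_d) : 'M[A]_n :=
  \sum_(i < d) xi i 0 *: M i.

Inductive gen_subalg (A : comNzRingType) (n : nat) (G : 'M[A]_n -> Prop) :
    'M[A]_n -> Prop :=
| gen_subalg_gen M of G M : gen_subalg G M
| gen_subalg_scalar a : gen_subalg G a%:M
| gen_subalg_add M N of gen_subalg G M & gen_subalg G N : gen_subalg G (M + N)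
| gen_subalg_mul M N of gen_subalg G M & gen_subalg G N :
    gen_subalg G (M *m N).

(* The orbit of v under A[im mu, K] is A^n. *)
Definition generates (A : comNzRingType) (d n : nat) (M : 'I_d -> 'M[A]_n)
    (K : 'M[A]_n) (v : 'cV[A]_n) : Prop :=
  forall w : 'cV[A]_n, exists2 T : 'M[A]_n,
    gen_subalg (fun N => (exists xi, N = mu_map M xi) \/ N = K) T
    & T *m v = w.

(* coker g has a (necessarily finite) basis, the classes of the columns
   of C. *)
Definition free_coker (A : comNzRingType) (d n : nat)
    (g : 'cV[A]_d -> 'cV[A]_n) : Prop :=
  exists k (C : 'M[A]_(n, k)),
    forall w, exists! a : 'cV[A]_k, exists xi, w = C *m a + g xi.

Variables (R : idomainType) (d : nat).

(* The fiber of F at t = u = 0 is R^(fb_rank F), the reduction of a matrix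
   over R[[t,u]] being [map_mx (@ms_const R _)]. *)
Definition fiber_t (F : Fbundle R d) (i : 'I_d) : 'M[R]_(fb_rank F) :=
  map_mx (@ms_const R _) (conn_t F i).

Definition fiber_K (F : Fbundle R d) : 'M[R]_(fb_rank F) :=
  map_mx (@ms_const R _) (conn_u F).

Definition mu_v (F : Fbundle R d) (v : 'cV[R]_(fb_rank F)) (xi : 'cV[R]_d) :
    'cV[R]_(fb_rank F) :=
  mu_map (fiber_t F) xi *m v.
Arguments mu_v : clear implicits.

Definition IC (F : Fbundle R d) (v : 'cV[R]_(fb_rank F)) : Prop :=
  injective (mu_v F v).

Definition GC (F : Fbundle R d) (v : 'cV[R]_(fb_rank F)) : Prop :=
  generates (fiber_t F) (fiber_K F) v.

Definition GC' (F : Fbundle R d) (v : 'cV[R]_(fb_rank F)) : Prop :=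
  generates (fun i => map_mx (@tofrac R) (fiber_t F i))
    (map_mx (@tofrac R) (fiber_K F)) (map_mx (@tofrac R) v).

Definition cyclic_vector (F : Fbundle R d) (v : 'cV[R]_(fb_rank F)) : Prop :=
  bijective (mu_v F v).
Arguments cyclic_vector : clear implicits.

Definition maximal (F : Fbundle R d) : Prop := exists v, cyclic_vector F v.

End FiberAtOrigin.

Arguments mu_v {R d} F v xi.
Arguments IC {R d} F v.
Arguments GC {R d} F v.
Arguments GC' {R d} F v.
Arguments cyclic_vector {R d} F v.

Definition induced_vector (R : idomainType) (d : nat) (F : Fbundle R d)
    (X : unfolding F) (v : 'cV[R]_(fb_rank F)) :
    'cV[R]_(fb_rank (unf_tgt X)) :=
  map_mx (@ms_const R _) (unf_map X) *m v.
Arguments induced_vector {R d F} X v.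

(* Main.v *)
From HB Require Import structures.
Require Import Defs.
From mathcomp Require Import all_boot all_order all_algebra generic_quotient.
From mathcomp Require Import boolp ring.

Set Implicit Arguments.
Unset Strict Implicit.
Unset Printing Implicit Defensive.

Import GRing.Theory.
Local Open Scope ring_scope.

(** A flat connection d_i + u^-1 A_i, d_u + u^-2 U, can be trivialized so that
    the matrices A_i in the directions of the parameters t do not depend on u,
    and such a trivialization is determined by its value at t = 0, which is
    arbitrary ([tframing_exists], [tframing_unique]). In it, write U_k for the
    coefficient of u^k in U. Flatness becomes the system

      [A_i, A_j] = 0,   d_i A_j = d_j A_i,   [A_i, U_0] = 0,
      d_i U_0 + A_i + [A_i, U_1] = 0,   d_i U_k + [A_i, U_(k+1)] = 0  (k > 0).

    The last equations show that U_k = 0 for k > 1 as soon as this holds at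
    t = 0 ([framing_propagates]); thus a framing is the same thing as a basis at
    t = 0 in which U_k = 0 for k > 1. An unfolding does not change the fiber at
    t = 0, so that framings extend uniquely ([unf_framing]).

    For the existence of a maximal unfolding, a parameter y is added for each
    vector C of a basis of a complement of the image of mu_v. The new matrix A_y
    has to commute with the A_i and with U_0, and it should send v to C. Since v
    generates the fiber under the algebra of the A_i and U_0, this determines
    A_y, as an element a of this algebra. The other unknowns then solve
    d_y A_i = d_i a and d_y U = - a - [a, (U - U_0) / u], a formal differential
    equation in y ([one_variable]). The equations of the system in the old
    directions are preserved, because their y-derivatives belong to the
    differential ideal that they generate ([tsystem_extend]). The matrix of mu_v
    is completed by the columns C and becomes invertible ([max_unfolding]).

    For uniqueness, the closed form A_i v dt_i has a primitive psi, with values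
    in the fiber, which is a system of coordinates when v is cyclic. A morphism
    of unfoldings is the identity in the trivializations, and it matches the
    potentials psi; this determines it ([unf_morphism_nf], [hom_psi_unique]).
    Conversely, the inverse function theorem ([hom_psi_exists]) provides a change
    of parameters matching the potentials, after which the two connections have
    the same values A_i v and agree along the subspace where the new parameters
    vanish. They are equal ([tsystem_unique]): if they agree to some order in
    the new parameters, the matrices in the new directions agree to the same
    order, since their difference commutes with the generators and kills v, and
    the system then gives one more order. Condition (GC') is enough for this, as
    it provides vectors w v, with w in the algebra, whose values at the origin
    are nonzero multiples of the basis vectors.

    All differential equations are solved along Euler vector fields, for which
    they are fixed point problems for contractions ([radial_ode]). *)

(** * Power series: weights, derivations, shifts *)

Section SeriesBasics.
Variables (R : comNzRingType) (N : nat).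
Local Notation series := (mseries R N).
Implicit Types (a b c : series) (m : 'X_{1..N}) (S : pred 'I_N).

Lemma ms_coefM a b m : (a * b) m =
  \sum_(k : 'X_{1..N < (mdeg m).+1, (mdeg m).+1} | m == (k.1 + k.2)%MM)
     a k.1 * b k.2.
Proof. by []. Qed.

Lemma ms_coefM0 a b m :
  (forall k l, m = (k + l)%MM -> a k * b l = 0) -> (a * b) m = 0.
Proof. by move=> ab0; rewrite ms_coefM big1 // => k /eqP/ab0. Qed.

Lemma eq_ms_coefM a b a' b' m :
  (forall k l, m = (k + l)%MM -> a k * b l = a' k * b' l) ->
  (a * b) m = (a' * b') m.
Proof. by move=> eqab; rewrite !ms_coefM; apply: eq_bigr => k /eqP/eqab. Qed.

Lemma ms_coef1 m : (1 : series) m = (m == 0%MM)%:R.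
Proof. by []. Qed.

Definition mpoly_series (p : {mpoly R[N]}) : series := MSeries (fun m => p@_m).

Fact mpoly_series_linear : linear mpoly_series.
Proof.
by move=> r p q; apply: mseriesP => m; rewrite [LHS]linearP.
Qed.
HB.instance Definition _ := GRing.isLinear.Build R {mpoly R[N]} series *:%R
  mpoly_series mpoly_series_linear.

Fact mpoly_series_monoid : monoid_morphism mpoly_series.
Proof.
split=> [|p q]; apply: mseriesP => m; first by rewrite /= mcoeff1.
by rewrite [RHS](@ms_mulE _ _ p q).
Qed.
HB.instance Definition _ := GRing.isMonoidMorphism.Build {mpoly R[N]} series
  mpoly_series mpoly_series_monoid.

Lemma ms_varE i : ms_var R i = mpoly_series 'X_i.
Proof. by apply: mseriesP => m; rewrite /= mcoeffX eq_sym. Qed.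

Lemma ms_varM_coef i a m : (ms_var R i * a) (m + U_(i))%MM = a m.
Proof.
set k := (mdeg (m + U_(i))).+1.
have := @ms_mulE R N 'X_i (ms_trunc k a) (ms_var R i) a (m + U_(i))%MM.
move=> ->; first 1 last.
- by move=> m' _; rewrite mcoeffX /= eq_sym.
- by move=> m' le_m'; rewrite mcoeff_trunc ltnS le_m'.
rewrite mulrC addmC mcoeffMX mcoeff_trunc ifT //.
by rewrite ltnS mdegD leq_addr.
Qed.

Lemma ms_varM_coef0 i a m : m i = 0%N -> (ms_var R i * a) m = 0.
Proof.
move=> mi0; apply: ms_coefM0 => k l def_m /=.
case: eqP => [def_k|_]; last by rewrite mul0r.
by move: mi0; rewrite def_m def_k mnmDE mnm1E eqxx.
Qed.

Lemma mnm_predK i m : m i != 0%N -> ((m - U_(i)) + U_(i))%MM = m.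
Proof.
move=> mi; apply: addmBA_id || apply/mnmP => j.
rewrite mnmDE mnmBE mnm1E; case: eqP => [<-|_]; last by rewrite subn0 addn0.
by rewrite subnK // lt0n.
Qed.

Lemma ms_varM_inj i a b : ms_var R i * a = ms_var R i * b -> a = b.
Proof.
move=> eq_ab; apply: mseriesP => m.
by rewrite -(ms_varM_coef i a) -(ms_varM_coef i b) eq_ab.
Qed.

Fact ms_der_linear i : linear (@ms_der R N i).
Proof.
by move=> r a b; apply: mseriesP => m /=; rewrite mulrnDl -mulrnAr.
Qed.
HB.instance Definition _ i := GRing.isLinear.Build R series series *:%R
  (@ms_der R N i) (ms_der_linear i).

Definition wt S m := (\sum_(i | S i) m i)%N.

Lemma wt0 S : wt S 0%MM = 0%N.
Proof. by rewrite /wt big1 // => i _; rewrite mnm0E. Qed.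

Lemma wtD S m k : wt S (m + k)%MM = (wt S m + wt S k)%N.
Proof. by rewrite /wt -big_split; apply: eq_bigr => i _; rewrite mnmDE. Qed.

Lemma wtU S i : wt S U_(i)%MM = S i.
Proof.
rewrite /wt; case Si: (S i).
  rewrite (bigD1 i) //= mnm1E eqxx big1 // => j /andP[_ ne_ji].
  by rewrite mnm1E eq_sym (negPf ne_ji).
rewrite big1 // => j Sj; rewrite mnm1E; case: eqP => // eq_ij.
by rewrite eq_ij Sj in Si.
Qed.

Lemma wt_pred1 i m : wt (pred1 i) m = m i.
Proof. exact: big_pred1_eq. Qed.

Lemma wt_predT m : wt predT m = mdeg m.
Proof. by rewrite mdegE. Qed.

Lemma wt_sub S S' m : {subset S <= S'} -> (wt S m <= wt S' m)%N.
Proof.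
move=> sSS'; rewrite /wt [leqRHS](bigID S) /= [X in (X + _)%N](_ : _ = wt S m).
  exact: leq_addr.
apply: eq_bigl => i; rewrite andbC; case Si: (S i) => //=.
exact: (sSS' i).
Qed.

(** Membership in the k-th power of the ideal generated by the variables in
    [S], the filtration for which equations in these variables are solved. *)
Definition ordw S k a := forall m, (wt S m < k)%N -> a m = 0.

Lemma ordw0 S a : ordw S 0 a. Proof. by []. Qed.
Lemma ordwZ0 S k : ordw S k 0. Proof. by []. Qed.

Lemma ordwW S k l a : (k <= l)%N -> ordw S l a -> ordw S k a.
Proof. by move=> le_kl al m lt_mk; apply: al; apply: leq_trans le_kl. Qed.

Lemma ordwD S k a b : ordw S k a -> ordw S k b -> ordw S k (a + b).
Proof. by move=> ak bk m lt_mk; rewrite /= ak ?bk ?addr0. Qed.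

Lemma ordwN S k a : ordw S k a -> ordw S k (- a).
Proof. by move=> ak m lt_mk; rewrite /= ak ?oppr0. Qed.

Lemma ordwM S k l a b : ordw S k a -> ordw S l b -> ordw S (k + l) (a * b).
Proof.
move=> ak bl m lt_m; apply: ms_coefM0 => p q def_m.
have [lt_p|le_p] := ltnP (wt S p) k; first by rewrite ak ?mul0r.
rewrite bl ?mulr0 // -(ltn_add2l k) (leq_ltn_trans _ lt_m) // def_m wtD.
by rewrite leq_add2r.
Qed.

Lemma ordwMl S k a b : ordw S k a -> ordw S k (a * b).
Proof. by move=> ak; have := ordwM ak (@ordw0 S b); rewrite addn0. Qed.

Lemma ordwMr S k a b : ordw S k b -> ordw S k (a * b).
Proof. by rewrite mulrC; apply: ordwMl. Qed.

Lemma ordwZ S k r a : ordw S k a -> ordw S k (r *: a).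
Proof. by move=> ak m lt_mk; rewrite /= ak ?mulr0. Qed.

Lemma ordw_sum S k (I : Type) (r : seq I) (P : pred I) (F : I -> series) :
  (forall i, P i -> ordw S k (F i)) -> ordw S k (\sum_(i <- r | P i) F i).
Proof.
by move=> Fk; elim/big_rec: _ => [|i x Pi xk]; [| apply: ordwD => //; apply: Fk].
Qed.

Lemma ordw_var S i : S i -> ordw S 1 (ms_var R i).
Proof.
move=> Si m; rewrite ltnS leqn0 => /eqP m0 /=; case: eqP => // def_m.
by rewrite def_m wtU Si in m0.
Qed.

Lemma ordw_der S k i a : ~~ S i -> ordw S k a -> ordw S k (ms_der i a).
Proof.
move=> nSi ak m lt_m /=; rewrite ak ?mul0rn // wtD wtU (negPf nSi).
by rewrite addn0.
Qed.

Lemma ordw_eq0 S a : (forall k, ordw S k a) -> a = 0.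
Proof. by move=> a0; apply: mseriesP => m; apply: (a0 (wt S m).+1). Qed.

(** The Euler derivation, the sum of x_i d/dx_i over the variables in [S],
    given by its eigenvalues on monomials. *)
Definition eul S a : series := MSeries (fun m => a m *+ wt S m).

Fact eul_linear S : linear (eul S).
Proof.
by move=> r a b; apply: mseriesP => m /=; rewrite mulrnDl -mulrnAr.
Qed.
HB.instance Definition _ S := GRing.isLinear.Build R series series *:%R
  (eul S) (eul_linear S).

Lemma eulM S a b : eul S (a * b) = eul S a * b + a * eul S b.
Proof.
apply: mseriesP => m.
transitivity ((a * b) m *+ wt S m) => //.
transitivity ((eul S a * b) m + (a * eul S b) m) => //.
rewrite !ms_coefM -big_split -sumrMnl /=; apply: eq_bigr => k /eqP def_m.
by rewrite (congr1 (wt S) def_m) wtD mulrnDr mulrnAl mulrnAr.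
Qed.

Lemma eul_pred1 i a : eul (pred1 i) a = ms_var R i * ms_der i a.
Proof.
apply: mseriesP => m; rewrite [LHS]/= wt_pred1.
have [mi0|mi] := eqVneq (m i) 0%N.
  by rewrite [RHS]ms_varM_coef0 // mi0.
rewrite -[m in RHS](mnm_predK mi) [RHS]ms_varM_coef /= mnm_predK //.
by rewrite mnmBE mnm1E eqxx subn1 prednK // lt0n.
Qed.

Lemma eulE S a : eul S a = \sum_(i | S i) ms_var R i * ms_der i a.
Proof.
under eq_bigr do rewrite -eul_pred1.
apply: mseriesP => m.
have sumE (r : seq 'I_N) : (\sum_(i <- r | S i) eul (pred1 i) a) m
    = \sum_(i <- r | S i) a m *+ m i.
  by elim/big_rec2: _ => //= i x y _ <-; rewrite wt_pred1.
by rewrite sumE /= /wt sumrMnr.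
Qed.

(** Multiplied by x_i, the derivative becomes an Euler derivation, for which
    the Leibniz rule is additivity of the weight. *)
Lemma ms_derM i a b : ms_der i (a * b) = ms_der i a * b + a * ms_der i b.
Proof.
apply: (@ms_varM_inj i).
by rewrite mulrDr -eul_pred1 eulM !eul_pred1; ring.
Qed.

Lemma ms_derC i j a : ms_der i (ms_der j a) = ms_der j (ms_der i a).
Proof.
apply: mseriesP => m /=; rewrite -!mulrnA.
have -> : (m + U_(j) + U_(i))%MM = (m + U_(i) + U_(j))%MM.
  by apply/mnmP => p; rewrite !mnmDE addnAC.
congr (_ *+ _); rewrite !mnmDE !mnm1E (eq_sym j i).
by case: eqP => [->|_]; rewrite ?addn0 // mulnC.
Qed.

Lemma ms_der_var (i j : 'I_N) : ms_der i (ms_var R j) = (i == j)%:R.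
Proof.
apply: mseriesP => m; rewrite /= -[RHS]/((_ : series) m).
have -> : ((i == j)%:R : series) m = ((i == j) && (m == 0%MM))%:R.
  by case: (i == j).
have [<-|ne_ij] /= := eqVneq i j.
  have -> : ((m + U_(i))%MM == U_(i)%MM) = (m == 0%MM).
    by rewrite -{2}[U_(i)%MM]add0m eqm_add2r.
  by case: eqP => [->|_]; rewrite ?mnm0E ?mul0rn.
case: eqP => [/(congr1 (fun m : 'X_{1..N} => m i))|_]; last by rewrite mul0rn.
by rewrite mnmDE !mnm1E eqxx addn1 eq_sym (negPf ne_ij).
Qed.

Lemma ms_der1 i : ms_der i (1 : series) = 0.
Proof.
apply: mseriesP => m /=; case: eqP => [/(congr1 (fun m : 'X_{1..N} => m i))|_].
  by rewrite mnmDE mnm1E mnm0E eqxx addn1.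
by rewrite mul0rn.
Qed.

(** The value at x_i = 0 for the variables x_i in [S], seen in the same ring so
    that the loci where some variables vanish need no change of ring. *)
Definition pr0 S a : series := MSeries (fun m => if wt S m == 0%N then a m else 0).

Lemma pr0_coef S a m : pr0 S a m = if wt S m == 0%N then a m else 0.
Proof. by []. Qed.

Fact pr0_linear S : linear (pr0 S).
Proof.
move=> r a b; apply: mseriesP => m /=; case: ifP => //.
by rewrite mulr0 addr0.
Qed.
HB.instance Definition _ S := GRing.isLinear.Build R series series *:%R
  (pr0 S) (pr0_linear S).

Fact pr0_monoid S : monoid_morphism (pr0 S).
Proof.
split=> [|a b]; apply: mseriesP => m; rewrite [LHS]pr0_coef.
  rewrite ms_coef1; case: eqP => // w0; by case: eqP => // m0; rewrite m0 wt0 in w0.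
case: ifPn => [/eqP w0|w0].
  apply: eq_ms_coefM => k l def_m /=; move: w0; rewrite def_m wtD.
  by move=> /eqP; rewrite addn_eq0 => /andP[-> ->].
symmetry; apply: ms_coefM0 => k l def_m /=; move: w0; rewrite def_m wtD.
by rewrite addn_eq0; case: eqP; case: eqP => //=; rewrite ?mulr0 ?mul0r.
Qed.
HB.instance Definition _ S := GRing.isMonoidMorphism.Build series series
  (pr0 S) (pr0_monoid S).

Lemma pr0_id S a : pr0 S (pr0 S a) = pr0 S a.
Proof. by apply: mseriesP => m /=; case: ifP => // ->. Qed.

Lemma pr0C S S' a : pr0 S (pr0 S' a) = pr0 S' (pr0 S a).
Proof. by apply: mseriesP => m /=; case: ifP; case: ifP. Qed.

Lemma ordw1P S a : ordw S 1 a <-> pr0 S a = 0.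
Proof.
split=> [a1|/(congr1 (@mscoef R N)) /= a0 m].
  by apply: mseriesP => m /=; case: ifP => // /eqP w0; rewrite a1 // w0.
rewrite ltnS leqn0 => w0.
by have /= := congr1 (fun f => f m) a0; rewrite w0.
Qed.

Lemma pr0_sub S a : ordw S 1 (a - pr0 S a).
Proof. by apply/ordw1P; rewrite raddfB /= pr0_id subrr. Qed.

Lemma pr0_var S (i : 'I_N) : pr0 S (ms_var R i) = if S i then 0 else ms_var R i.
Proof.
case: ifPn => Si; first by apply/ordw1P/ordw_var.
apply: mseriesP => m /=; case: (m =P _) => [->|_]; last by rewrite if_same.
by rewrite wtU (negPf Si).
Qed.

Lemma pr0_der S i a : ~~ S i -> pr0 S (ms_der i a) = ms_der i (pr0 S a).
Proof.
move=> nSi; apply: mseriesP => m /=; rewrite wtD wtU (negPf nSi) addn0.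
by case: ifP => //; rewrite mul0rn.
Qed.

Lemma ordw_pr0 S S' k a : ordw S k a -> ordw S k (pr0 S' a).
Proof. by move=> ak m lt_m /=; rewrite ak // if_same. Qed.

Lemma der_pr0 i a : ms_der i (pr0 (pred1 i) a) = 0.
Proof.
apply: mseriesP => m /=.
by rewrite wt_pred1 mnmDE mnm1E eqxx addn1 mul0rn.
Qed.

(** [shift i a] is the quotient of [a - a|_(x_i = 0)] by [x_i]. *)
Definition shift i a : series := MSeries (fun m => a (m + U_(i))%MM).

Fact shift_linear i : linear (shift i).
Proof. by move=> r a b; apply: mseriesP. Qed.
HB.instance Definition _ i := GRing.isLinear.Build R series series *:%R
  (shift i) (shift_linear i).

Lemma var_shift i a : ms_var R i * shift i a = a - pr0 (pred1 i) a.
Proof.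
apply: mseriesP => m; have [mi0|mi] := eqVneq (m i) 0%N.
  by rewrite ms_varM_coef0 //= wt_pred1 mi0 eqxx subrr.
rewrite -[m in LHS](mnm_predK mi) [LHS]ms_varM_coef /= mnm_predK //.
by rewrite wt_pred1 (negPf mi) subr0.
Qed.

Lemma shiftK i a : shift i (ms_var R i * a) = a.
Proof. by apply: mseriesP => m; apply: ms_varM_coef. Qed.

Lemma shift_pr0 i a : shift i (pr0 (pred1 i) a) = 0.
Proof.
by apply: mseriesP => m /=; rewrite wt_pred1 mnmDE mnm1E eqxx addn1.
Qed.

Lemma ordw_shift S k i a : ~~ S i -> ordw S k a -> ordw S k (shift i a).
Proof.
by move=> nSi ak m lt_m /=; rewrite ak // wtD wtU (negPf nSi) addn0.
Qed.

Lemma shift_der i j a : j != i -> shift i (ms_der j a) = ms_der j (shift i a).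
Proof.
move=> ne_ji; apply: mseriesP => m /=; rewrite -!addmA (addmC U_(i)%MM).
by rewrite mnmDE mnm1E eq_sym (negPf ne_ji) addn0.
Qed.

Lemma shift_eul S i a : ~~ S i -> shift i (eul S a) = eul S (shift i a).
Proof.
by move=> nSi; apply: mseriesP => m /=; rewrite wtD wtU (negPf nSi) addn0.
Qed.

Lemma pr0_shift S i a : ~~ S i -> pr0 S (shift i a) = shift i (pr0 S a).
Proof.
by move=> nSi; apply: mseriesP => m /=; rewrite wtD wtU (negPf nSi) addn0.
Qed.

Lemma shiftMl i a b : pr0 (pred1 i) a = a -> shift i (a * b) = a * shift i b.
Proof.
move=> a0; apply: (@ms_varM_inj i).
rewrite var_shift rmorphM /= a0 mulrCA var_shift; ring.
Qed.

Lemma ms_const_pr0 S a : ms_const (pr0 S a) = ms_const a.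
Proof. by rewrite /ms_const /= wt0 eqxx. Qed.

Lemma pr0_predT a : pr0 predT a = (ms_const a)%:A.
Proof.
apply: mseriesP => m /=; rewrite wt_predT mdeg_eq0.
by case: eqP => [->|]; rewrite /= ?mulr1 ?mulr0.
Qed.

Fact ms_const_zmod : zmod_morphism (@ms_const R N).
Proof. by []. Qed.
HB.instance Definition _ := GRing.isZmodMorphism.Build series R
  (@ms_const R N) ms_const_zmod.

Fact ms_const_monoid : monoid_morphism (@ms_const R N).
Proof.
split=> [|a b]; first by rewrite /ms_const ms_coef1 eqxx.
have constA r : ms_const (r%:A : series) = r.
  by rewrite /ms_const /= eqxx mulr1.
have := rmorphM (pr0 predT) a b.
rewrite /= !pr0_predT -scalerAl mul1r scalerA => eqAB.
by rewrite -[LHS]constA eqAB constA.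
Qed.
HB.instance Definition _ := GRing.isMonoidMorphism.Build series R
  (@ms_const R N) ms_const_monoid.

Lemma ms_constZ r a : ms_const (r *: a) = r * ms_const a.
Proof. by []. Qed.
End SeriesBasics.

(** * Matrices of power series *)

Section MatrixRing.
Variable A : comNzRingType.

Lemma entryD p q (X Y : 'M[A]_(p, q)) i j a b :
  X i j = a -> Y i j = b -> (X + Y) i j = a + b.
Proof. by rewrite mxE => -> ->. Qed.
Lemma entryN p q (X : 'M[A]_(p, q)) i j a : X i j = a -> (- X) i j = - a.
Proof. by rewrite mxE => ->. Qed.
Lemma entryZ p q c (X : 'M[A]_(p, q)) i j a : X i j = a -> (c *: X) i j = c * a.
Proof. by rewrite mxE => ->. Qed.
Lemma entry0 p q i j : (0 : 'M[A]_(p, q)) i j = 0.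
Proof. by rewrite mxE. Qed.
Lemma mulscalemx p q r c (X : 'M[A]_(p, q)) (Y : 'M[A]_(q, r)) :
  (c *: X) *m Y = c *: (X *m Y).
Proof. by rewrite scalemxAl. Qed.
Lemma mulmxscale p q r c (X : 'M[A]_(p, q)) (Y : 'M[A]_(q, r)) :
  X *m (c *: Y) = c *: (X *m Y).
Proof. by rewrite scalemxAr. Qed.

Definition cmx n (X Y : 'M[A]_n) : 'M[A]_n := X *m Y - Y *m X.
End MatrixRing.

Ltac gen_scalar c :=
  lazymatch c with
  | @GRing.mul _ ?a ?b => first [gen_scalar a | gen_scalar b]
  | @GRing.exp _ ?a _ => gen_scalar a
  | _ => tryif is_var c then fail else (generalize c; intro)
  end.

Ltac gen_atom t :=
  lazymatch t with
  | @GRing.add _ ?x ?y => first [gen_atom x | gen_atom y]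
  | @GRing.opp _ ?x => gen_atom x
  | @GRing.scale _ _ ?c ?x => first [gen_scalar c | gen_atom x]
  | @mulmx _ _ _ _ ?x ?y => first [gen_atom x | gen_atom y]
  | @cmx _ _ ?x ?y => first [gen_atom x | gen_atom y]
  | @scalar_mx _ _ _ => fail
  | @GRing.zero _ => fail
  | _ => tryif is_var t then fail else (generalize t; intro)
  end.

Ltac gen_product t :=
  lazymatch t with
  | @GRing.add _ ?x ?y => first [gen_product x | gen_product y]
  | @GRing.opp _ ?x => gen_product x
  | @GRing.scale _ _ _ ?x => gen_product x
  | @mulmx _ _ _ _ _ _ => move: t => ?
  | _ => fail
  end.

Ltac entries :=
  lazymatch goal with
  | |- @fun_of_matrix _ _ _ (@GRing.add _ _ _) _ _ = _ =>
      eapply entryD; entries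
  | |- @fun_of_matrix _ _ _ (@GRing.opp _ _) _ _ = _ => eapply entryN; entries
  | |- @fun_of_matrix _ _ _ (@GRing.scale _ _ _ _) _ _ = _ =>
      eapply entryZ; entries
  | |- @fun_of_matrix _ _ _ (@GRing.zero _) _ _ = _ => apply: entry0
  | _ => reflexivity
  end.

(** Decides the equations between matrices that follow from the axioms of
    algebras. Products are not commutative: they are expanded into sums of
    monomials, which are then treated as variables, so that the equation becomes
    linear and can be checked on entries. *)
Ltac mxring :=
  repeat match goal with
  | |- ?x = ?y => first [gen_atom x | gen_atom y]
  end;
  rewrite ?/cmx;
  rewrite ?(mulmxDl, mulmxDr, mulmxBl, mulmxBr, mulNmx, mulmxN, mulscalemx,
    mulmxscale, mul1mx, mulmx1, mul0mx, mulmx0, mulmxA);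
  repeat match goal with
  | |- ?x = ?y => first [gen_product x | gen_product y]
  end;
  apply/matrixP => ? ?; eapply etrans; [entries | symmetry; eapply etrans;
    [entries | symmetry; ring]].

Lemma cmxDr (A : comNzRingType) n (Z X Y : 'M[A]_n) :
  cmx Z (X + Y) = cmx Z X + cmx Z Y.
Proof. mxring. Qed.

Lemma cmxMr (A : comNzRingType) n (Z X Y : 'M[A]_n) :
  cmx Z (X *m Y) = cmx Z X *m Y + X *m cmx Z Y.
Proof. mxring. Qed.

Lemma mxsubE (A : comNzRingType) p q (X Y : 'M[A]_(p, q)) i j :
  (X - Y) i j = X i j - Y i j.
Proof. by rewrite !mxE. Qed.

Lemma cmxZr (A : comNzRingType) n a (Z X : 'M[A]_n) :
  cmx Z (a *: X) = a *: cmx Z X.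
Proof. mxring. Qed.

Lemma cmx_sumr (A : comNzRingType) n (I : finType) Z (F : I -> 'M[A]_n) :
  cmx Z (\sum_i F i) = \sum_i cmx Z (F i).
Proof. by rewrite /cmx mulmx_sumr mulmx_suml -sumrB. Qed.

Lemma cmxC (A : comNzRingType) n (X Y : 'M[A]_n) : cmx X Y = - cmx Y X.
Proof. mxring. Qed.

Section Derivation.
Variables (A : comNzRingType) (D : {additive A -> A}).
Hypothesis DM : forall a b, D (a * b) = D a * b + a * D b.

Lemma map_mx_derM p q r (X : 'M[A]_(p, q)) (Y : 'M[A]_(q, r)) :
  map_mx D (X *m Y) = map_mx D X *m Y + X *m map_mx D Y.
Proof.
apply/matrixP => i j; rewrite !mxE raddf_sum -big_split /=.
by apply: eq_bigr => k _; rewrite DM !mxE.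
Qed.

Lemma map_mx_derZ p q a (X : 'M[A]_(p, q)) :
  map_mx D (a *: X) = D a *: X + a *: map_mx D X.
Proof. by apply/matrixP => i j; rewrite !mxE DM. Qed.
End Derivation.

Section RingMap.
Variables (A B : comNzRingType) (f : {rmorphism A -> B}).

Lemma mx_iso_map p q (P : 'M[A]_(p, q)) : mx_iso P -> mx_iso (map_mx f P).
Proof.
by case=> Q PQ QP; exists (map_mx f Q); rewrite -map_mxM ?PQ ?QP map_mx1.
Qed.
End RingMap.

Lemma mx_isoM (A : comNzRingType) p q r (P : 'M[A]_(p, q)) (Q : 'M[A]_(q, r)) :
  mx_iso P -> mx_iso Q -> mx_iso (P *m Q).
Proof.
case=> P' PP' P'P [Q' QQ' Q'Q]; exists (Q' *m P').
  by rewrite -mulmxA (mulmxA Q) QQ' mul1mx.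
by rewrite -mulmxA (mulmxA P') P'P mul1mx.
Qed.

Section SeriesMatrix.
Variables (R : comNzRingType) (N : nat).
Local Notation series := (mseries R N).
Implicit Types (S : pred 'I_N).

Lemma dmxM p q r i (X : 'M[series]_(p, q)) (Y : 'M[series]_(q, r)) :
  map_mx (ms_der i) (X *m Y)
    = map_mx (ms_der i) X *m Y + X *m map_mx (ms_der i) Y.
Proof. exact: (map_mx_derM (@ms_derM R N i)). Qed.

Lemma dmxZ p q i a (X : 'M[series]_(p, q)) :
  map_mx (ms_der i) (a *: X) = ms_der i a *: X + a *: map_mx (ms_der i) X.
Proof. exact: (map_mx_derZ (@ms_derM R N i)). Qed.

Lemma dmx1 i n : map_mx (ms_der i) (1%:M : 'M[series]_n) = 0.
Proof.
apply/matrixP => j k; rewrite !mxE.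
by case: eqP; rewrite ?raddf0 ?ms_der1.
Qed.

Lemma dmxC i j p q (X : 'M[series]_(p, q)) :
  map_mx (ms_der i) (map_mx (ms_der j) X)
    = map_mx (ms_der j) (map_mx (ms_der i) X).
Proof. by apply/matrixP => k l; rewrite !mxE ms_derC. Qed.

Lemma emxE S p q (X : 'M[series]_(p, q)) :
  map_mx (eul S) X = \sum_(i | S i) ms_var R i *: map_mx (ms_der i) X.
Proof.
apply/matrixP => k l; rewrite !mxE summxE eulE.
by apply: eq_bigr => i _; rewrite !mxE.
Qed.

Lemma emx_pred1 i p q (X : 'M[series]_(p, q)) :
  map_mx (eul (pred1 i)) X = ms_var R i *: map_mx (ms_der i) X.
Proof. by rewrite emxE big_pred1_eq. Qed.

Lemma var_smx i p q (X : 'M[series]_(p, q)) :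
  ms_var R i *: map_mx (shift i) X = X - map_mx (pr0 (pred1 i)) X.
Proof. by apply/matrixP => k l; rewrite !mxE var_shift. Qed.

Lemma scale_var_inj i p q (X Y : 'M[series]_(p, q)) :
  ms_var R i *: X = ms_var R i *: Y -> X = Y.
Proof.
move/matrixP=> eqXY; apply/matrixP => k l; apply: (@ms_varM_inj _ _ i).
by have := eqXY k l; rewrite !mxE.
Qed.

Lemma smx_pr0 i p q (X : 'M[series]_(p, q)) :
  map_mx (shift i) (map_mx (pr0 (pred1 i)) X) = 0.
Proof. by apply/matrixP => k l; rewrite !mxE shift_pr0. Qed.

Lemma smxMl i p q r (X : 'M[series]_(p, q)) (Y : 'M[series]_(q, r)) :
  map_mx (pr0 (pred1 i)) X = X ->
  map_mx (shift i) (X *m Y) = X *m map_mx (shift i) Y.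
Proof.
move/matrixP=> X0; apply/matrixP => j k; rewrite !mxE raddf_sum.
by apply: eq_bigr => l _; rewrite !mxE /= shiftMl //; have := X0 j l; rewrite mxE.
Qed.

Lemma smxMr i p q r (X : 'M[series]_(p, q)) (Y : 'M[series]_(q, r)) :
  map_mx (pr0 (pred1 i)) Y = Y ->
  map_mx (shift i) (X *m Y) = map_mx (shift i) X *m Y.
Proof.
move/matrixP=> Y0; apply/matrixP => j k; rewrite !mxE raddf_sum.
apply: eq_bigr => l _; rewrite !mxE /= mulrC shiftMl 1?mulrC //.
by have := Y0 l k; rewrite mxE.
Qed.

Lemma smx_der i j p q (X : 'M[series]_(p, q)) : j != i ->
  map_mx (shift i) (map_mx (ms_der j) X) = map_mx (ms_der j) (map_mx (shift i) X).
Proof. by move=> ne_ji; apply/matrixP => k l; rewrite !mxE shift_der. Qed.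

Lemma smx_eul S i p q (X : 'M[series]_(p, q)) : ~~ S i ->
  map_mx (shift i) (map_mx (eul S) X) = map_mx (eul S) (map_mx (shift i) X).
Proof. by move=> nSi; apply/matrixP => k l; rewrite !mxE shift_eul. Qed.

Lemma p0mx_shift S i p q (X : 'M[series]_(p, q)) : ~~ S i ->
  map_mx (pr0 S) (map_mx (shift i) X) = map_mx (shift i) (map_mx (pr0 S) X).
Proof. by move=> nSi; apply/matrixP => k l; rewrite !mxE pr0_shift. Qed.

Lemma p0mx_der S i p q (X : 'M[series]_(p, q)) : ~~ S i ->
  map_mx (pr0 S) (map_mx (ms_der i) X) = map_mx (ms_der i) (map_mx (pr0 S) X).
Proof. by move=> nSi; apply/matrixP => k l; rewrite !mxE pr0_der. Qed.

Lemma p0mxC S S' p q (X : 'M[series]_(p, q)) :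
  map_mx (pr0 S) (map_mx (pr0 S') X) = map_mx (pr0 S') (map_mx (pr0 S) X).
Proof. by apply/matrixP => k l; rewrite !mxE pr0C. Qed.

Lemma p0mx_id S p q (X : 'M[series]_(p, q)) :
  map_mx (pr0 S) (map_mx (pr0 S) X) = map_mx (pr0 S) X.
Proof. by apply/matrixP => k l; rewrite !mxE pr0_id. Qed.

Lemma cst_p0mx S p q (X : 'M[series]_(p, q)) :
  map_mx (@ms_const R N) (map_mx (pr0 S) X) = map_mx (@ms_const R N) X.
Proof. by apply/matrixP => k l; rewrite !mxE ms_const_pr0. Qed.

Lemma p0mx_varZ S i p q (X : 'M[series]_(p, q)) : S i ->
  map_mx (pr0 S) (ms_var R i *: X) = 0.
Proof.
by move=> Si; apply/matrixP => k l; rewrite !mxE rmorphM /= pr0_var Si mul0r.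
Qed.

Lemma dmx_p0 i p q (X : 'M[series]_(p, q)) :
  map_mx (ms_der i) (map_mx (pr0 (pred1 i)) X) = 0.
Proof. by apply/matrixP => k l; rewrite !mxE der_pr0. Qed.

Section Additive.
Variables (p q : nat) (X Y : 'M[series]_(p, q)).
Lemma p0mxD S : map_mx (pr0 S) (X + Y) = map_mx (pr0 S) X + map_mx (pr0 S) Y.
Proof. by apply/matrixP => i j; rewrite !mxE raddfD. Qed.
Lemma p0mxN S : map_mx (pr0 S) (- X) = - map_mx (pr0 S) X.
Proof. by apply/matrixP => i j; rewrite !mxE raddfN. Qed.
Lemma p0mxB S : map_mx (pr0 S) (X - Y) = map_mx (pr0 S) X - map_mx (pr0 S) Y.
Proof. by apply/matrixP => i j; rewrite !mxE raddfB. Qed.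
Lemma smxD i : map_mx (shift i) (X + Y) = map_mx (shift i) X + map_mx (shift i) Y.
Proof. by apply/matrixP => k l; rewrite !mxE raddfD. Qed.
Lemma smxN i : map_mx (shift i) (- X) = - map_mx (shift i) X.
Proof. by apply/matrixP => k l; rewrite !mxE raddfN. Qed.
Lemma smxB i : map_mx (shift i) (X - Y) = map_mx (shift i) X - map_mx (shift i) Y.
Proof. by apply/matrixP => k l; rewrite !mxE raddfB. Qed.
Lemma dmxD i :
  map_mx (ms_der i) (X + Y) = map_mx (ms_der i) X + map_mx (ms_der i) Y.
Proof. by apply/matrixP => k l; rewrite !mxE raddfD. Qed.
Lemma dmxN i : map_mx (ms_der i) (- X) = - map_mx (ms_der i) X.
Proof. by apply/matrixP => k l; rewrite !mxE raddfN. Qed.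
Lemma dmxB i :
  map_mx (ms_der i) (X - Y) = map_mx (ms_der i) X - map_mx (ms_der i) Y.
Proof. by apply/matrixP => k l; rewrite !mxE raddfB. Qed.
End Additive.

Definition ordmx S k p q (X : 'M[series]_(p, q)) :=
  forall i j, ordw S k (X i j).

Lemma ordmx00 S p q (X : 'M[series]_(p, q)) : ordmx S 0 X.
Proof. by []. Qed.

Lemma ordmx0 S k p q : ordmx S k (0 : 'M[series]_(p, q)).
Proof. by move=> i j; rewrite mxE. Qed.

Lemma ordmxW S k l p q (X : 'M[series]_(p, q)) :
  (k <= l)%N -> ordmx S l X -> ordmx S k X.
Proof. by move=> le_kl Xl i j; apply: ordwW (Xl i j). Qed.

Lemma ordmxD S k p q (X Y : 'M[series]_(p, q)) :
  ordmx S k X -> ordmx S k Y -> ordmx S k (X + Y).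
Proof. by move=> Xk Yk i j; rewrite mxE; apply: ordwD. Qed.

Lemma ordmxN S k p q (X : 'M[series]_(p, q)) : ordmx S k X -> ordmx S k (- X).
Proof. by move=> Xk i j; rewrite mxE; apply: ordwN. Qed.

Lemma ordmxB S k p q (X Y : 'M[series]_(p, q)) :
  ordmx S k X -> ordmx S k Y -> ordmx S k (X - Y).
Proof. by move=> Xk Yk; apply: ordmxD => //; apply: ordmxN. Qed.

Lemma ordmx_sym S k p q (X Y : 'M[series]_(p, q)) :
  ordmx S k (X - Y) -> ordmx S k (Y - X).
Proof. by move/ordmxN; rewrite opprB. Qed.

Lemma ordmx_trans S k p q (X Y Z : 'M[series]_(p, q)) :
  ordmx S k (X - Y) -> ordmx S k (Y - Z) -> ordmx S k (X - Z).
Proof. by move=> XY YZ; rewrite -(subrKA Y); apply: ordmxD. Qed.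

Lemma ordmxM S k l p q r (X : 'M[series]_(p, q)) (Y : 'M[series]_(q, r)) :
  ordmx S k X -> ordmx S l Y -> ordmx S (k + l) (X *m Y).
Proof.
by move=> Xk Yl i j; rewrite mxE; apply: ordw_sum => h _; apply: ordwM.
Qed.

Lemma ordmxMl S k p q r (X : 'M[series]_(p, q)) (Y : 'M[series]_(q, r)) :
  ordmx S k X -> ordmx S k (X *m Y).
Proof. by move=> Xk; have := ordmxM Xk (@ordmx00 S _ _ Y); rewrite addn0. Qed.

Lemma ordmxMr S k p q r (X : 'M[series]_(p, q)) (Y : 'M[series]_(q, r)) :
  ordmx S k Y -> ordmx S k (X *m Y).
Proof. by move=> Yk; apply: (ordmxM (@ordmx00 S _ _ X) Yk). Qed.

Lemma ordmxM1l S k p q r (X : 'M[series]_(p, q)) (Y : 'M[series]_(q, r)) :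
  ordmx S 1 X -> ordmx S k Y -> ordmx S k.+1 (X *m Y).
Proof. by move=> X1 Yk; rewrite -add1n; apply: ordmxM. Qed.

Lemma ordmxM1r S k p q r (X : 'M[series]_(p, q)) (Y : 'M[series]_(q, r)) :
  ordmx S k X -> ordmx S 1 Y -> ordmx S k.+1 (X *m Y).
Proof. by move=> Xk Y1; rewrite -addn1; apply: ordmxM. Qed.

Lemma ordmxMB S k p q r (X X' : 'M[series]_(p, q)) (Y Y' : 'M[series]_(q, r)) :
  ordmx S k (X - X') -> ordmx S k (Y - Y') ->
  ordmx S k (X *m Y - X' *m Y').
Proof.
move=> XX' YY'; rewrite (_ : _ - _ = (X - X') *m Y + X' *m (Y - Y')).
  by apply: ordmxD; [apply: ordmxMl | apply: ordmxMr].
mxring.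
Qed.

Lemma ordmx_cmxl S k n (X Y : 'M[series]_n) : ordmx S k X -> ordmx S k (cmx X Y).
Proof. by move=> Xk; apply: ordmxB; [apply: ordmxMl | apply: ordmxMr]. Qed.

Lemma ordmx_cmxr S k n (X Y : 'M[series]_n) : ordmx S k Y -> ordmx S k (cmx X Y).
Proof. by move=> Xk; apply: ordmxB; [apply: ordmxMr | apply: ordmxMl]. Qed.

Lemma ordmx_cmx S k n (X Y X' Y' : 'M[series]_n) :
  ordmx S k (X - X') -> ordmx S k (Y - Y') -> ordmx S k (cmx X Y - cmx X' Y').
Proof.
move=> XX' YY'.
have -> : cmx X Y - cmx X' Y' = (X *m Y - X' *m Y') - (Y *m X - Y' *m X').
  by mxring.
by apply: ordmxB; apply: ordmxMB.
Qed.

Lemma ordmxZ S k a p q (X : 'M[series]_(p, q)) :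
  ordmx S k X -> ordmx S k (a *: X).
Proof. by move=> Xk i j; rewrite mxE; apply: ordwMr. Qed.

Lemma ordmxZl S k a p q (X : 'M[series]_(p, q)) :
  ordw S k a -> ordmx S k (a *: X).
Proof. by move=> ak i j; rewrite mxE; apply: ordwMl. Qed.

Lemma ordmxZB S k a a' p q (X X' : 'M[series]_(p, q)) :
  ordw S k (a - a') -> ordmx S k (X - X') -> ordmx S k (a *: X - a' *: X').
Proof.
move=> aa' XX'; have -> : a *: X - a' *: X' = (a - a') *: X + a' *: (X - X').
  by rewrite scalerBl scalerBr addrA subrK.
by apply: ordmxD; [apply: ordmxZl | apply: ordmxZ].
Qed.

Lemma ordmx_var S k i p q (X : 'M[series]_(p, q)) :
  S i -> ordmx S k X -> ordmx S k.+1 (ms_var R i *: X).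
Proof.
move=> Si Xk h j; rewrite mxE -add1n; apply: ordwM (Xk h j).
exact: ordw_var.
Qed.

Lemma ordmx_sum S k p q (I : Type) (r : seq I) (P : pred I)
    (F : I -> 'M[series]_(p, q)) :
  (forall i, P i -> ordmx S k (F i)) -> ordmx S k (\sum_(i <- r | P i) F i).
Proof.
move=> Fk; elim/big_rec: _ => [|i x Pi xk]; first exact: ordmx0.
by apply: ordmxD => //; apply: Fk.
Qed.

Lemma ordmx_der S k i p q (X : 'M[series]_(p, q)) :
  ~~ S i -> ordmx S k X -> ordmx S k (map_mx (ms_der i) X).
Proof. by move=> nSi Xk h j; rewrite mxE; apply: ordw_der. Qed.

Lemma ordmx_shift S k i p q (X : 'M[series]_(p, q)) :
  ~~ S i -> ordmx S k X -> ordmx S k (map_mx (shift i) X).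
Proof. by move=> nSi Xk h j; rewrite mxE; apply: ordw_shift. Qed.

Lemma ordmx_p0 S S' k p q (X : 'M[series]_(p, q)) :
  ordmx S k X -> ordmx S k (map_mx (pr0 S') X).
Proof. by move=> Xk h j; rewrite mxE; apply: ordw_pr0. Qed.

Lemma ordmx_eq0 S p q (X : 'M[series]_(p, q)) :
  (forall k, ordmx S k X) -> X = 0.
Proof.
move=> X0; apply/matrixP => i j; rewrite mxE.
by apply: (@ordw_eq0 _ _ S) => k; apply: X0.
Qed.

Lemma ordmx_eq S p q (X Y : 'M[series]_(p, q)) :
  (forall k, ordmx S k (X - Y)) -> X = Y.
Proof. by move=> XY; apply/eqP; rewrite -subr_eq0 (ordmx_eq0 XY). Qed.

Lemma ordmx1P S p q (X : 'M[series]_(p, q)) :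
  ordmx S 1 X <-> map_mx (pr0 S) X = 0.
Proof.
split=> [X1|/matrixP X0 i j].
  by apply/matrixP => i j; rewrite !mxE; apply/ordw1P.
by apply/ordw1P; have := X0 i j; rewrite !mxE.
Qed.

Lemma ordmx1_eqP S p q (X Y : 'M[series]_(p, q)) :
  ordmx S 1 (X - Y) <-> map_mx (pr0 S) X = map_mx (pr0 S) Y.
Proof.
split=> [/ordmx1P|eqXY]; last by apply/ordmx1P; rewrite map_mxB eqXY subrr.
by rewrite map_mxB => /eqP; rewrite subr_eq0 => /eqP.
Qed.

(** The iterates of a contraction converge: the coefficient at [m] no longer
    changes after [wt S m] steps. *)
Lemma ordmx_fixpoint S (T : Type) p q (X0 : T -> 'M[series]_(p, q)) Psi :
  let dom X := forall t, ordmx S 1 (X t - X0 t) in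
  (forall X, dom X -> dom (Psi X)) ->
  (forall k X Y, dom X -> dom Y -> (forall t, ordmx S k (X t - Y t)) ->
     forall t, ordmx S k.+1 (Psi X t - Psi Y t)) ->
  exists2 X, dom X & forall t, X t = Psi X t.
Proof.
move=> dom dom_Psi Psi_contr; pose Y k := iter k Psi X0.
have domY k : dom (Y k).
  elim: k => [|k IHk]; last exact: dom_Psi.
  by move=> t; rewrite /= subrr; apply: ordmx0.
have stepY k t : ordmx S k (Y k.+1 t - Y k t).
  elim: k t => [|k IHk] t; first exact: ordmx00.
  exact: (Psi_contr _ (Y k.+1) (Y k)).
have limY k l t : (k <= l)%N -> ordmx S k (Y l t - Y k t).
  elim: l => [|l IHl]; first by rewrite leqn0 => /eqP->.
  rewrite leq_eqVlt => /predU1P[->|]; first by rewrite subrr; apply: ordmx0.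
  by rewrite ltnS => le_kl; apply: ordmx_trans (IHl le_kl); apply: ordmxW (stepY l t).
pose X t : 'M[series]_(p, q) :=
  \matrix_(i, j) MSeries (fun m => Y (wt S m).+1 t i j m).
have XY k t : ordmx S k (X t - Y k t).
  move=> i j m lt_mk; rewrite !mxE /= -opprB.
  have := limY _ _ t lt_mk i j m (ltnSn _); rewrite !mxE /= => ->.
  by rewrite oppr0.
have domX : dom X.
  by move=> t; apply: ordmx_trans (XY 1%N t) (domY 1%N t).
exists X => // t; apply: (@ordmx_eq S) => k.
apply: (@ordmxW _ _ k.+1) => //.
apply: ordmx_trans (XY k.+1 t) _.
by apply: (Psi_contr _ (Y k) X) => // t'; apply/ordmx_sym/XY.
Qed.

Lemma ordmx_const p (B : 'M[series]_p) :
  map_mx (@ms_const R N) B = 1%:M -> ordmx predT 1 (1%:M - B).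
Proof.
move=> B1; apply/ordmx1P/matrixP => i j; rewrite !mxE pr0_predT.
have := congr1 (fun X : 'M_p => X i j) B1; rewrite !mxE raddfB => /= ->.
by rewrite rmorph_nat subrr scale0r.
Qed.

(** The inverse of 1 - X, with X vanishing at the origin, is the fixed point of
    Q |-> 1 + QX, which sums the geometric series. *)
Lemma mx_iso_const1 p (B : 'M[series]_p) :
  map_mx (@ms_const R N) B = 1%:M -> mx_iso B.
Proof.
move=> /ordmx_const B1.
have [| |Q _ /(_ tt) defQ] := @ordmx_fixpoint predT unit p p (fun=> 1%:M)
    (fun X t => 1%:M + X t *m (1%:M - B)).
- by move=> X _ t; rewrite addrAC subrr add0r; apply: ordmxMr.
- move=> k X Y _ _ XY t; rewrite opprD addrACA subrr add0r -mulmxBl -addn1.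
  exact: ordmxM.
have [| |Q' _ /(_ tt) defQ'] := @ordmx_fixpoint predT unit p p (fun=> 1%:M)
    (fun X t => 1%:M + (1%:M - B) *m X t).
- by move=> X _ t; rewrite addrAC subrr add0r; apply: ordmxMl.
- move=> k X Y _ _ XY t; rewrite opprD addrACA subrr add0r -mulmxBr -add1n.
  exact: ordmxM.
have QB : Q tt *m B = 1%:M.
  move/eqP: defQ; rewrite mulmxBr mulmx1 addrCA -subr_eq0 opprD addrA subrr.
  by rewrite add0r opprB subr_eq0 => /eqP.
have BQ' : B *m Q' tt = 1%:M.
  move/eqP: defQ'; rewrite mulmxBl mul1mx addrCA -subr_eq0 opprD addrA subrr.
  by rewrite add0r opprB subr_eq0 => /eqP.
exists (Q' tt) => //.
by rewrite -[X in X *m B]mul1mx -QB -(mulmxA _ B) BQ' mulmx1.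
Qed.

Definition cstmx p q (X : 'M[R]_(p, q)) : 'M[series]_(p, q) :=
  map_mx (in_alg series) X.

Lemma cst_cstmx p q (X : 'M[R]_(p, q)) : map_mx (@ms_const R N) (cstmx X) = X.
Proof. by apply/matrixP => i j; rewrite !mxE ms_constZ rmorph1 mulr1. Qed.

(** The inverse, chosen classically because units of the ring of series are not
    decidable; 0 is a default value for the other matrices. *)
Definition invm (A : comNzRingType) p (B : 'M[A]_p) : 'M[A]_p :=
  if pselect (mx_iso B) is left isoB then s2val (cid2 isoB) else 0.

Lemma mulmx_invm (A : comNzRingType) p (B : 'M[A]_p) :
  mx_iso B -> B *m invm B = 1%:M.
Proof. by rewrite /invm; case: pselect => // isoB _; case: cid2. Qed.

Lemma mul_invmx (A : comNzRingType) p (B : 'M[A]_p) :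
  mx_iso B -> invm B *m B = 1%:M.
Proof. by rewrite /invm; case: pselect => // isoB _; case: cid2. Qed.

Lemma ordmx_invm S k p (B B' : 'M[series]_p) : mx_iso B -> mx_iso B' ->
  ordmx S k (B - B') -> ordmx S k (invm B - invm B').
Proof.
move=> isoB isoB' BB'.
have -> : invm B - invm B' = invm B *m (B' - B) *m invm B'.
  rewrite mulmxBr mulmxBl -mulmxA (mulmx_invm isoB') mulmx1.
  by rewrite (mul_invmx isoB) mul1mx.
by apply/ordmxMl/ordmxMr/ordmx_sym.
Qed.
End SeriesMatrix.

(** * Integration of radial differential equations *)

Section Integration.
Variables (R : comNzRingType) (QR : {rmorphism rat -> R}) (N : nat).
Local Notation series := (mseries R N).
Implicit Types (S : pred 'I_N) (a b : series).

Definition natinv k : R := QR k%:R^-1.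

Lemma natinvK k : k != 0%N -> natinv k * k%:R = 1.
Proof.
move=> k0; rewrite /natinv -(rmorph_nat QR) -rmorphM mulVf ?rmorph1 //.
by rewrite Num.Theory.pnatr_eq0.
Qed.

Lemma mulrn_inj0 k (x : R) : k != 0%N -> x *+ k = 0 -> x = 0.
Proof.
move=> k0 xk; rewrite -[x]mul1r -(natinvK k0) -mulrA mulr_natl xk.
by rewrite mulr0.
Qed.

Lemma ordw_eulD S k c a :
  (0 < c)%N -> ordw S k (eul S a + a *+ c) -> ordw S k a.
Proof.
move=> c0 ak m /ak; have coefMn (x : series) n : (x *+ n) m = x m *+ n.
  by elim: n => //= n IHn; rewrite !mulrSr /= IHn.
rewrite /= coefMn -mulrnDr; apply: mulrn_inj0.
by rewrite -lt0n addn_gt0 c0 orbT.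
Qed.

Lemma ordw_eul_inv S k a : pr0 S a = 0 -> ordw S k (eul S a) -> ordw S k a.
Proof.
move=> /ordw1P a0 ak m lt_m; have [w0|w0] := posnP (wt S m).
  by apply: a0; rewrite w0.
by have := ak m lt_m; apply: mulrn_inj0; rewrite -lt0n.
Qed.

Definition ieul S a : series :=
  MSeries (fun m => if wt S m == 0%N then 0 else natinv (wt S m) * a m).

Lemma ieulK S a : pr0 S a = 0 -> eul S (ieul S a) = a.
Proof.
move=> /ordw1P a0; apply: mseriesP => m /=; case: eqP => [w0|/eqP w0].
  by rewrite mul0rn a0 // w0.
by rewrite -mulrnAl -mulr_natr natinvK ?mul1r.
Qed.

Lemma pr0_ieul S a : pr0 S (ieul S a) = 0.
Proof. by apply: mseriesP => m /=; case: eqP. Qed.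

Lemma ordw_ieul S k a b :
  ordw S k (a - b) -> ordw S k (ieul S a - ieul S b).
Proof.
move=> ab m lt_m /=; case: eqP => _; first by rewrite subr0.
by rewrite -mulrBr (ab m lt_m : a m - b m = 0) mulr0.
Qed.

Lemma ordmx_eul_inv S k p q (X : 'M[series]_(p, q)) :
  map_mx (pr0 S) X = 0 -> ordmx S k (map_mx (eul S) X) -> ordmx S k X.
Proof.
move=> /matrixP X0 Xk i j; apply: ordw_eul_inv.
  by have := X0 i j; rewrite !mxE.
by have := Xk i j; rewrite mxE.
Qed.

Lemma ordmx_der_inv i k p q (X : 'M[series]_(p, q)) :
  map_mx (pr0 (pred1 i)) X = 0 -> ordmx (pred1 i) k (map_mx (ms_der i) X) ->
  ordmx (pred1 i) k.+1 X.
Proof.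
move=> X0 Xk; apply: ordmx_eul_inv => //; rewrite emx_pred1.
by apply: ordmx_var => //=.
Qed.

Lemma eul_inj S p q (X Y : 'M[series]_(p, q)) :
  map_mx (pr0 S) X = map_mx (pr0 S) Y -> map_mx (eul S) X = map_mx (eul S) Y ->
  X = Y.
Proof.
move=> X0 EX; apply: (@ordmx_eq _ _ S) => k; apply: ordmx_eul_inv.
  by rewrite map_mxB X0 subrr.
by rewrite map_mxB EX subrr; apply: ordmx0.
Qed.

Lemma dmx_eq i p q (X Y : 'M[series]_(p, q)) :
  map_mx (pr0 (pred1 i)) X = map_mx (pr0 (pred1 i)) Y ->
  map_mx (ms_der i) X = map_mx (ms_der i) Y -> X = Y.
Proof. by move=> X0 DX; apply: (eul_inj X0); rewrite !emx_pred1 DX. Qed.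

(** The Euler field multiplies a coefficient by its weight, so that over the
    rationals it can be inverted on series vanishing at the origin: the equation
    becomes a fixed point problem for a contraction. *)
Lemma radial_ode S (T : Type) p q (X0 : T -> 'M[series]_(p, q)) Phi :
  let dom X := forall t, map_mx (pr0 S) (X t) = map_mx (pr0 S) (X0 t) in
  (forall X, dom X -> forall t, ordmx S 1 (Phi X t)) ->
  (forall k X Y, dom X -> dom Y -> (forall t, ordmx S k (X t - Y t)) ->
     forall t, ordmx S k.+1 (Phi X t - Phi Y t)) ->
  exists2 X, dom X & forall t, map_mx (eul S) (X t) = Phi X t.
Proof.
move=> dom Phi1 Phi_contr.
have domE X : (forall t, ordmx S 1 (X t - X0 t)) <-> dom X.
  by split=> domX t; apply/ordmx1_eqP/domX.
pose Psi X t := map_mx (pr0 S) (X0 t) + map_mx (ieul S) (Phi X t).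
have domPsi X t : map_mx (pr0 S) (Psi X t) = map_mx (pr0 S) (X0 t).
  rewrite map_mxD /= p0mx_id (_ : map_mx _ (map_mx (ieul S) _) = 0) ?addr0 //.
  by apply/matrixP => i j; rewrite !mxE pr0_ieul.
have [| |X /domE domX defX] := @ordmx_fixpoint _ _ S T p q X0 Psi.
- by move=> X _; apply/domE.
- move=> k X Y /domE domX /domE domY XY t; rewrite /Psi opprD addrACA subrr add0r.
  move=> i j; rewrite !mxE; apply: ordw_ieul.
  by have := Phi_contr k X Y domX domY XY t i j; rewrite !mxE.
exists X => // t; rewrite defX /Psi map_mxD /=.
have /ordmx1P/matrixP PhiX0 := Phi1 X domX t.
rewrite (_ : map_mx _ (map_mx (pr0 S) _) = 0) ?add0r.
  by apply/matrixP => i j; rewrite !mxE ieulK //; have := PhiX0 i j; rewrite !mxE.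
by apply/matrixP => i j; rewrite !mxE; apply: mseriesP => m /=;
  case: eqP => [->|]; rewrite ?mul0rn.
Qed.
End Integration.

Opaque ms_mul.

(** * Continuous algebra maps and substitution *)

Section ContinuousMaps.
Variables (R : comNzRingType).
Implicit Types d e : nat.

Definition contS e d (f : mseries R e -> mseries R d) :=
  forall k, exists l, forall a, ordw predT l a -> ordw predT k (f a).

Lemma ms_ord_geE d k (a : mseries R d) : ms_ord_ge k a <-> ordw predT k a.
Proof. by split=> ak m; have := ak m; rewrite wt_predT. Qed.

Lemma cont_homP e d (f : mseries R e -> mseries R d) :
  cont_alg_hom f <-> [/\ linear f, monoid_morphism f & contS f].
Proof.
split=> -[f_lin f_mon f_cont]; split=> // k; have [l fl] := f_cont k; exists l.
  by move=> a /ms_ord_geE/fl/ms_ord_geE.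
by move=> a /ms_ord_geE/fl/ms_ord_geE.
Qed.

Lemma trunc_ord d k (a : mseries R d) : ordw predT k (a - mpoly_series (ms_trunc k a)).
Proof.
by move=> m; rewrite wt_predT /= mcoeff_trunc => ->; rewrite subrr.
Qed.

(** Polynomials are dense, so that continuous maps can be compared on them. *)
Lemma cont_ext e d (f h : mseries R e -> mseries R d) :
  {morph f : a b / a - b} -> {morph h : a b / a - b} ->
  contS f -> contS h -> (forall p, f (mpoly_series p) = h (mpoly_series p)) -> f =1 h.
Proof.
move=> fB hB f_cont h_cont eq_fh a; apply/eqP; rewrite -subr_eq0; apply/eqP.
apply: (@ordw_eq0 _ _ predT) => k.
have [l fl] := f_cont k; have [l' hl'] := h_cont k.
set p := mpoly_series (ms_trunc (maxn l l') a).
have pa := @trunc_ord _ (maxn l l') a.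
rewrite (_ : _ - _ = f (a - p) - h (a - p)); last first.
  by rewrite fB hB eq_fh opprB subrKA.
apply: ordwD; first by apply/fl/(ordwW _ pa)/leq_maxl.
by apply/ordwN/hl'/(ordwW _ pa)/leq_maxr.
Qed.

Lemma mpoly_series_ind d (Q : mseries R d -> Prop) :
  (forall r a b, Q a -> Q b -> Q (r *: a + b)) -> Q 1 ->
  (forall a b, Q a -> Q b -> Q (a * b)) -> (forall i, Q (ms_var R i)) ->
  forall p, Q (mpoly_series p).
Proof.
move=> QL Q1 QM QX p.
have Q0 : Q 0 by rewrite -(addNr 1) -scaleN1r; apply: QL.
rewrite [p]mpolyE raddf_sum /=; elim/big_rec: _ => // m a _ Qa.
rewrite linearZ /=; apply: QL => //; rewrite mpolyXE_id rmorph_prod /=.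
apply: big_ind => // i _; rewrite rmorphXn /= -ms_varE.
by elim: (m i) => [|k IHk]; [rewrite expr0 | rewrite exprS; apply: QM].
Qed.

(** Both sides of f(ab) = f(a) f(b) are continuous and bilinear, hence
    determined by their values at monomials. *)
Lemma mon_hom e d (f : mseries R e -> mseries R d) :
  linear f -> contS f -> f 1 = 1 ->
  (forall m m', f (mpoly_series 'X_[m + m']) = f (mpoly_series 'X_[m]) * f (mpoly_series 'X_[m'])) ->
  cont_alg_hom f.
Proof.
move=> f_lin f_cont f1 fX; apply/cont_homP; split=> //; split=> //.
have fZ r a : f (r *: a) = r *: f a.
  have f0 : f 0 = 0.
    have := f_lin 1 0 0; rewrite !scale1r addr0 => /eqP.
    by rewrite -subr_eq0 opprD addNKr oppr_eq0 => /eqP.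
  by have := f_lin r a 0; rewrite !addr0 f0 addr0.
have fD a b : f (a + b) = f a + f b by have := f_lin 1 a b; rewrite !scale1r.
have fB a b : f (a - b) = f a - f b by rewrite fD -scaleN1r fZ scaleN1r.
have fS (I : Type) (r : seq I) F : f (\sum_(i <- r) F i) = \sum_(i <- r) f (F i).
  elim: r => [|i r IHr]; first by rewrite !big_nil -(subrr 0) fB subrr.
  by rewrite !big_cons fD IHr.
have contM a : contS (fun b => f (a * b)) /\ contS (fun b => f a * f b).
  by split=> k; have [l fl] := f_cont k; exists l => b bl;
    [apply/fl/ordwMr | apply/ordwMr/fl].
(* Density is used for the second factor, then for the first one. *)
move=> a b; move: b; apply: cont_ext; try by case: (contM a).
- by move=> b c; rewrite mulrBr fB.
- by move=> b c; rewrite fB mulrBr.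
move=> q; move: a; apply: cont_ext.
- by move=> b c; rewrite mulrBl fB.
- by move=> b c; rewrite fB mulrBl.
- by have [+ _] := contM (mpoly_series q) => h k; have [l hl] := h k; exists l => b /hl;
    rewrite mulrC.
- by have [_ +] := contM (mpoly_series q) => h k; have [l hl] := h k; exists l => b /hl;
    rewrite mulrC.
move=> p; rewrite {1}[p]mpolyE {1}[q]mpolyE [in RHS](mpolyE p) [in RHS](mpolyE q).
rewrite !raddf_sum !fS !big_distrlr /= !fS; apply: eq_bigr => m _.
rewrite fS; apply: eq_bigr => m' _; rewrite !linearZ /=.
by rewrite -scalerAl -scalerAr !fZ -rmorphM -mpolyXD fX -scalerAl -scalerAr.
Qed.

Section HomTheory.
Variables (e d : nat) (f : mseries R e -> mseries R d).
Hypothesis hf : cont_alg_hom f.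

Lemma hom_lin : linear f. Proof. by case: hf. Qed.
Lemma hom_mon : monoid_morphism f. Proof. by case: hf. Qed.
Lemma hom_zmod : zmod_morphism f.
Proof.
by move=> a b; rewrite addrC -scaleN1r hom_lin scaleN1r addrC.
Qed.

(** The bundled morphism, which gives access to the theory of ring
    morphisms. *)
Definition hom_bundle : {rmorphism mseries R e -> mseries R d} :=
  HB.pack f (GRing.isZmodMorphism.Build _ _ f hom_zmod)
    (GRing.isMonoidMorphism.Build _ _ f hom_mon).

Lemma homB a b : f (a - b) = f a - f b. Proof. exact: hom_zmod. Qed.
Lemma homD a b : f (a + b) = f a + f b. Proof. exact: (rmorphD hom_bundle). Qed.
Lemma homM a b : f (a * b) = f a * f b. Proof. exact: (rmorphM hom_bundle). Qed.
Lemma hom1 : f 1 = 1. Proof. exact: (rmorph1 hom_bundle). Qed.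
Lemma hom0 : f 0 = 0. Proof. exact: (rmorph0 hom_bundle). Qed.
Lemma homMn a n : f (a *+ n) = f a *+ n.
Proof. exact: (rmorphMn hom_bundle). Qed.
Lemma hom_sum (I : Type) (r : seq I) P F :
  f (\sum_(i <- r | P i) F i) = \sum_(i <- r | P i) f (F i).
Proof. exact: (rmorph_sum hom_bundle). Qed.
Lemma homZ r a : f (r *: a) = r *: f a.
Proof. by have := hom_lin r a 0; rewrite !addr0 hom0 addr0. Qed.
Lemma hom_cont : contS f. Proof. by case/cont_homP: hf. Qed.

Lemma hmxM p q r (X : 'M_(p, q)) (Y : 'M_(q, r)) :
  map_mx f (X *m Y) = map_mx f X *m map_mx f Y.
Proof. exact: (map_mxM hom_bundle). Qed.
Lemma hmxD p q (X Y : 'M_(p, q)) : map_mx f (X + Y) = map_mx f X + map_mx f Y.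
Proof. exact: (map_mxD hom_bundle). Qed.
Lemma hmxB p q (X Y : 'M_(p, q)) : map_mx f (X - Y) = map_mx f X - map_mx f Y.
Proof. exact: (map_mxB hom_bundle). Qed.
Lemma hmx0 p q : map_mx f 0 = 0 :> 'M_(p, q).
Proof. exact: (map_mx0 hom_bundle). Qed.
Lemma hmxZ p q a (X : 'M_(p, q)) : map_mx f (a *: X) = f a *: map_mx f X.
Proof. exact: (map_mxZ hom_bundle). Qed.
Lemma hmx1 n : map_mx f 1%:M = 1%:M :> 'M_n.
Proof. exact: (map_mx1 hom_bundle). Qed.
Lemma hmx_sum p q (I : Type) (r : seq I) P (F : I -> 'M_(p, q)) :
  map_mx f (\sum_(i <- r | P i) F i) = \sum_(i <- r | P i) map_mx f (F i).
Proof.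
apply/matrixP => i j; rewrite mxE !summxE hom_sum.
by apply: eq_bigr => k _; rewrite mxE.
Qed.
Lemma hmx_iso p q (P : 'M_(p, q)) : mx_iso P -> mx_iso (map_mx f P).
Proof. exact: (@mx_iso_map _ _ hom_bundle). Qed.
End HomTheory.

(** The variables generate a dense subalgebra. *)
Lemma cont_hom_ext e d (f h : mseries R e -> mseries R d) :
  cont_alg_hom f -> cont_alg_hom h ->
  (forall j, f (ms_var R j) = h (ms_var R j)) -> f =1 h.
Proof.
move=> hf hh eq_fh; apply: cont_ext; try exact: homB; try exact: hom_cont.
apply: (@mpoly_series_ind _ (fun a => f a = h a)) => [r a b||a b|//].
- by rewrite !homD // !homZ // => -> ->.
- by rewrite !hom1.
by rewrite !homM // => -> ->.
Qed.

Lemma cont_hom_id d : cont_alg_hom (@id (mseries R d)).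
Proof. by apply/cont_homP; split=> // k; exists k. Qed.

Lemma cont_hom_comp c e d (f : mseries R e -> mseries R d)
    (h : mseries R c -> mseries R e) :
  cont_alg_hom f -> cont_alg_hom h -> cont_alg_hom (f \o h).
Proof.
move=> hf hh; apply/cont_homP; split.
- by move=> r a b; rewrite /= homD ?homZ // homD ?homZ.
- by split=> [|a b] /=; rewrite ?hom1 // !homM.
move=> k; have [l fl] := hom_cont hf k; have [l' hl'] := hom_cont hh l.
by exists l' => a /hl'/fl.
Qed.

Section Subst.
Variables (e d : nat) (g : 'I_e -> mseries R d).
Hypothesis g1 : forall j, ordw predT 1 (g j).

Definition subst (a : mseries R e) : mseries R d :=
  MSeries (fun m => mmap (in_alg (mseries R d)) g (ms_trunc (mdeg m).+1 a) m).

Lemma mmap_ord k (p : {mpoly R[e]}) : (forall m, (mdeg m < k)%N -> p@_m = 0) ->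
  ordw predT k (mmap (in_alg (mseries R d)) g p).
Proof.
move=> pk; rewrite /mmap; apply: ordw_sum => m _.
have [lt_mk|le_km] := ltnP (mdeg m) k.
  by rewrite pk // raddf0 mul0r; apply: ordwZ0.
apply/ordwMr/(ordwW le_km); rewrite mdegE /mmap1.
elim/big_rec2: _ => [|j x y _ xy]; first exact: ordw0.
apply: ordwM => //; elim: (m j) => [|k' IHk]; first exact: ordw0.
by rewrite exprS -[k'.+1]add1n; apply: ordwM.
Qed.

(** The coefficient at [m] only involves the polynomial part of degree at most
    that of [m], because the substituted series vanish at the origin. *)
Lemma subst_mmap (a : mseries R e) (p : {mpoly R[e]}) (m : 'X_{1..d}) : (forall m', (mdeg m' <= mdeg m)%N -> p@_m' = a m') ->
  subst a m = mmap (in_alg (mseries R d)) g p m.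
Proof.
move=> pa; set p' := ms_trunc (mdeg m).+1 a.
have : ordw predT (mdeg m).+1 (mmap (in_alg (mseries R d)) g (p' - p)).
  apply: mmap_ord => m' lt_m'.
  by rewrite mcoeffB mcoeff_trunc lt_m' pa // subrr.
move/(_ m); rewrite wt_predT raddfB => /(_ (ltnSn _)) /= /eqP.
by rewrite subr_eq0 => /eqP.
Qed.

Lemma subst_mpoly_series (p : {mpoly R[e]}) : subst (mpoly_series p) = mmap (in_alg (mseries R d)) g p.
Proof. by apply: mseriesP => m; apply: subst_mmap. Qed.

Lemma subst_hom : cont_alg_hom subst.
Proof.
have coefT a m k : (mdeg k <= mdeg m)%N -> (ms_trunc (mdeg m).+1 a)@_k = a k.
  by move=> le_km; rewrite mcoeff_trunc ltnS le_km.
apply/cont_homP; split.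
- move=> r a b; apply: mseriesP => m.
  rewrite (@subst_mmap _ (r *: ms_trunc (mdeg m).+1 a + ms_trunc (mdeg m).+1 b)).
    have -> : mmap (in_alg (mseries R d)) g
        (r *: ms_trunc (mdeg m).+1 a + ms_trunc (mdeg m).+1 b)
      = r *: mmap (in_alg (mseries R d)) g (ms_trunc (mdeg m).+1 a)
        + mmap (in_alg (mseries R d)) g (ms_trunc (mdeg m).+1 b).
      by rewrite mmapD mmapZ /= -scalerAl mul1r.
    by [].
  by move=> k le_km; rewrite mcoeffD mcoeffZ !coefT.
- split; first by have := subst_mpoly_series 1; rewrite !rmorph1.
  move=> a b; apply: mseriesP => m.
  rewrite (@subst_mmap _ (ms_trunc (mdeg m).+1 a * ms_trunc (mdeg m).+1 b)).
    rewrite rmorphM; apply: eq_ms_coefM => k l def_m.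
    rewrite (@subst_mmap a (ms_trunc (mdeg m).+1 a) k).
      rewrite (@subst_mmap b (ms_trunc (mdeg m).+1 b) l) // => k' le_k'.
      by apply/coefT/(leq_trans le_k'); rewrite def_m mdegD leq_addl.
    by move=> k' le_k'; apply/coefT/(leq_trans le_k'); rewrite def_m mdegD leq_addr.
  move=> k le_km; symmetry; apply: ms_mulE => k' le_k'; apply: coefT;
    exact: leq_trans le_km.
move=> k; exists k => a ak m lt_mk.
rewrite (@subst_mmap _ 0); first by rewrite raddf0.
move=> m' le_m'; rewrite mcoeff0 ak // wt_predT (leq_ltn_trans le_m') //.
by rewrite -wt_predT.
Qed.

Lemma subst_var j : subst (ms_var R j) = g j.
Proof. by rewrite ms_varE subst_mpoly_series mmapX mmap1U. Qed.
End Subst.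

(** Both sides are continuous derivations along [f], so that it is enough to
    compare them at the variables. *)
Lemma hom_der e d (f : mseries R e -> mseries R d) i a : cont_alg_hom f ->
  ms_der i (f a) = \sum_j ms_der i (f (ms_var R j)) * f (ms_der j a).
Proof.
move=> hf; move: a; apply: cont_ext.
- by move=> a b; rewrite homB // raddfB.
- move=> a b; rewrite -sumrB; apply: eq_bigr => j _.
  by rewrite raddfB /= homB // mulrBr.
- move=> k; have [l fl] := hom_cont hf k.+1; exists l => a /fl ak m lt_m /=.
  by rewrite ak ?mul0rn // wtD wtU addn1 ltnS.
- move=> k; have [l fl] := hom_cont hf k; exists l.+1 => a al.
  apply: ordw_sum => j _; apply/ordwMr/fl => m lt_m /=.
  by rewrite al ?mul0rn // wtD wtU addn1 ltnS.
apply: (@mpoly_series_ind _ (fun a => ms_der i (f a) =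
  \sum_j ms_der i (f (ms_var R j)) * f (ms_der j a))) => [r a b Qa Qb||a b Qa Qb|j].
- rewrite homD ?homZ // raddfD /= linearZ /= Qa Qb scaler_sumr -big_split.
  by apply: eq_bigr => j _; rewrite raddfD /= linearZ /= homD ?homZ // mulrDr scalerAr.
- rewrite hom1 // ms_der1 big1 // => j _.
  by rewrite ms_der1 hom0 // mulr0.
- rewrite homM // ms_derM Qa Qb mulr_suml mulr_sumr -big_split.
  apply: eq_bigr => j _.
  rewrite ms_derM homD //.
  rewrite !(homM hf).
 rewrite mulrDr.
 rewrite !mulrA.
  by rewrite [f a * _]mulrC.
rewrite (bigD1 j) //= ms_der_var eqxx hom1 // mulr1 big1 ?addr0 // => k ne_kj.
by rewrite ms_der_var (negPf ne_kj) hom0 // mulr0.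
Qed.
End ContinuousMaps.

Section HomDomain.
Variables (R : idomainType).

(** By continuity a power of the image of a variable has no constant term, and
    in a domain neither has the image itself. *)
Lemma hom_var_ord e d (f : mseries R e -> mseries R d) j : cont_alg_hom f ->
  ordw predT 1 (f (ms_var R j)).
Proof.
move=> hf; apply/ordw1P; rewrite pr0_predT.
suff -> : ms_const (f (ms_var R j)) = 0 by rewrite scale0r.
have [l fl] := hom_cont hf 1.
have : ordw predT 1 (f (ms_var R j ^+ l)).
  apply: fl; elim: l => [|l IHl]; first exact: ordw0.
  by rewrite exprS -[l.+1]add1n; apply/ordwM/IHl/ordw_var.
have -> : f (ms_var R j ^+ l) = f (ms_var R j) ^+ l.
  exact: (rmorphXn (hom_bundle hf)).
move/ordw1P; rewrite pr0_predT.
move/(congr1 (@ms_const _ _)); rewrite ms_constZ rmorph1 mulr1 rmorphXn raddf0.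
by move/eqP; rewrite expf_eq0 => /andP[_ /eqP].
Qed.

Lemma hom_subst e d (f : mseries R e -> mseries R d) : cont_alg_hom f ->
  f =1 subst (fun j => f (ms_var R j)).
Proof.
move=> hf; have f1 j := hom_var_ord j hf.
apply: cont_hom_ext => // [|j]; first exact: subst_hom.
by rewrite subst_var.
Qed.

Lemma hom_ordw e d (f : mseries R e -> mseries R d) k a : cont_alg_hom f ->
  ordw predT k a -> ordw predT k (f a).
Proof.
move=> hf ak; rewrite hom_subst // => m lt_mk.
have f1 j := hom_var_ord j hf.
rewrite (@subst_mmap _ _ _ _ _ _ 0); first by rewrite raddf0.
  exact: f1.
move=> m' le_m'; rewrite mcoeff0 ak // wt_predT (leq_ltn_trans le_m') //.
by rewrite -wt_predT.
Qed.

Lemma hom_const e d (f : mseries R e -> mseries R d) a : cont_alg_hom f ->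
  ms_const (f a) = ms_const a.
Proof.
move=> hf; have : ordw predT 1 (a - (ms_const a)%:A).
  by rewrite -pr0_predT; apply: pr0_sub.
move/(hom_ordw hf)/ordw1P; rewrite homB // homZ // hom1 // pr0_predT.
move/(congr1 (@ms_const _ _)); rewrite ms_constZ rmorph1 mulr1 raddf0.
rewrite raddfB => /eqP; rewrite subr_eq0 => /eqP ->.
by rewrite [LHS]ms_constZ rmorph1 mulr1.
Qed.
End HomDomain.

(** * Base change in the parameters [t], with [u] fixed *)

Notation uidx := (pred1 ord0).
Notation tpred := (predC1 ord0).

Section Uexpansion.
Variables (R : comNzRingType).
Implicit Types d e : nat.

Lemma mnm_ut0 d k (m : 'X_{1..d}) : mnm_ut k m ord0 = k.
Proof. by rewrite mnmE unlift_none. Qed.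

Lemma mnm_ut_t d k (m : 'X_{1..d}) i : mnm_ut k m (tidx i) = m i.
Proof. by rewrite mnmE liftK. Qed.

Lemma mnm_utK d k (m : 'X_{1..d}) : mnm_t (mnm_ut k m) = m.
Proof. by apply/mnmP => i; rewrite mnmE mnm_ut_t. Qed.

Lemma mnm_tK d (m : 'X_{1..d.+1}) : mnm_ut (m ord0) (mnm_t m) = m.
Proof.
by apply/mnmP => i; rewrite mnmE; case: unliftP => [j ->|->] //; rewrite mnmE.
Qed.

Lemma mnm_t_inj d (m m' : 'X_{1..d.+1}) :
  (m == m') = (m ord0 == m' ord0) && (mnm_t m == mnm_t m').
Proof.
apply/eqP/andP => [->|[/eqP eq0 /eqP eqt]]; first by rewrite !eqxx.
by rewrite -(mnm_tK m) eq0 eqt mnm_tK.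
Qed.

Lemma wt_t d (m : 'X_{1..d.+1}) : wt tpred m = mdeg (mnm_t m).
Proof.
rewrite /wt mdegE big_mkcond big_ord_recl /= add0n.
by apply: eq_bigr => i _; rewrite mnmE.
Qed.

Lemma mdeg_ut d (m : 'X_{1..d.+1}) : mdeg m = (m ord0 + mdeg (mnm_t m))%N.
Proof. by rewrite !mdegE big_ord_recl; congr (_ + _)%N; apply: eq_bigr => i _; rewrite mnmE. Qed.

Lemma mnm_tU d (j : 'I_d) : mnm_t U_(tidx j)%MM = U_(j)%MM.
Proof. by apply/mnmP => i; rewrite !mnmE (inj_eq (@lift_inj _ _)). Qed.

Lemma mnm_tD d (m m' : 'X_{1..d.+1}) : mnm_t (m + m') = (mnm_t m + mnm_t m')%MM.
Proof. by apply/mnmP => i; rewrite !mnmE. Qed.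

Lemma ucoefP d (a b : mseries R d.+1) :
  (forall k, ucoef k a = ucoef k b) -> a = b.
Proof.
move=> eq_ab; apply: mseriesP => m.
have := congr1 (fun c : mseries R d => c (mnm_t m)) (eq_ab (m ord0)).
by rewrite /= mnm_tK.
Qed.

Lemma ucoef_uext e d (f : mseries R e -> mseries R d) k a :
  ucoef k (uext f a) = f (ucoef k a).
Proof. by apply: mseriesP => m /=; rewrite mnm_ut0 mnm_utK. Qed.

Lemma ucoef_tincl d k (a : mseries R d) :
  ucoef k (tincl a) = if k == 0%N then a else 0.
Proof.
by apply: mseriesP => m /=; rewrite mnm_ut0 mnm_utK; case: eqP.
Qed.

Lemma ucoef_shift d k (a : mseries R d.+1) :
  ucoef k (shift ord0 a) = ucoef k.+1 a.
Proof.
apply: mseriesP => m /=; congr (a _); apply/mnmP => i; rewrite !mnmE.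
by case: unliftP => [j ->|->]; rewrite ?addn0 ?addn1.
Qed.

Lemma ucoef_varM d k (a : mseries R d.+1) :
  ucoef k (uvar R d * a) = if k is k'.+1 then ucoef k' a else 0.
Proof.
case: k => [|k]; last by rewrite -ucoef_shift shiftK.
by apply: mseriesP => m /=; apply: ms_varM_coef0; rewrite mnm_ut0.
Qed.

Lemma ucoef_pr0 d k (a : mseries R d.+1) :
  ucoef k (pr0 uidx a) = if k == 0%N then ucoef 0 a else 0.
Proof.
by apply: mseriesP => m /=; rewrite wt_pred1 mnm_ut0; case: eqP => [->|].
Qed.

Lemma ucoef_der0 d k (a : mseries R d.+1) :
  ucoef k (ms_der ord0 a) = ucoef k.+1 a *+ k.+1.
Proof.
rewrite -ucoef_shift; apply: mseriesP => m /=; rewrite mnm_ut0.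
set b := ucoef k _; rewrite -[RHS]/((b *+ k.+1) m).
have -> n : (b *+ n) m = b m *+ n by elim: n => //= n IHn; rewrite !mulrSr /= IHn.
by [].
Qed.

Lemma tincl_ucoef0 d (a : mseries R d.+1) : tincl (ucoef 0 a) = pr0 uidx a.
Proof.
apply: mseriesP => m /=; rewrite wt_pred1; case: eqP => [m0|//].
by rewrite -m0 mnm_tK.
Qed.

Lemma tincl_mon d (m : 'X_{1..d}) :
  tincl (mpoly_series 'X_[m]) = mpoly_series 'X_[mnm_ut 0 m] :> mseries R d.+1.
Proof.
apply: mseriesP => p /=; rewrite !mcoeffX mnm_t_inj mnm_ut0 mnm_utK eq_sym.
by rewrite (eq_sym 0%N); case: eqP.
Qed.

Lemma tincl_hom d : cont_alg_hom (@tincl R d).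
Proof.
apply: mon_hom.
- move=> r a b; apply: mseriesP => m /=; case: eqP => // _.
  by rewrite mulr0 addr0.
- move=> k; exists k => a ak m lt_mk /=; case: eqP => // m0.
  by rewrite ak // wt_predT; move: lt_mk; rewrite wt_predT mdeg_ut m0 add0n.
- have := @tincl_mon d 0%MM; rewrite mpolyX0 rmorph1 => ->.
  rewrite (_ : mnm_ut 0 0%MM = 0%MM) ?mpolyX0 ?rmorph1 //.
  by apply/mnmP => i; rewrite !mnmE; case: unliftP => //= j _; rewrite mnmE.
move=> m m'; rewrite !tincl_mon -rmorphM -mpolyXD; congr (mpoly_series 'X_[_]).
by apply/mnmP => i; rewrite !mnmE; case: unliftP => //= j _; rewrite mnmE.
Qed.

Lemma tincl_var d (i : 'I_d) : tincl (ms_var R i) = ms_var R (tidx i).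
Proof.
apply: mseriesP => m /=; rewrite mnm_t_inj mnm1E.
have -> : (tidx i == ord0) = false by apply/negbTE; rewrite eq_sym neq_lift.
by rewrite mnm_tU; case: eqP.
Qed.

Lemma tincl_inj d : injective (@tincl R d).
Proof.
by move=> a b /(congr1 (ucoef 0)); rewrite !ucoef_tincl.
Qed.

Lemma tincl_der d i (a : mseries R d) :
  ms_der (tidx i) (tincl a) = tincl (ms_der i a).
Proof.
apply: mseriesP => m /=; rewrite mnmDE mnm1E.
have -> : (tidx i == ord0) = false by apply/negbTE; rewrite eq_sym neq_lift.
rewrite addn0; case: eqP => // _; last by rewrite mul0rn.
by rewrite mnm_tD mnm_tU mnmE.
Qed.

Lemma pr0_tincl d (a : mseries R d) : pr0 uidx (tincl a) = tincl a.
Proof. by rewrite -tincl_ucoef0 ucoef_tincl. Qed.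

Lemma uext_tincl e d (f : mseries R e -> mseries R d) a :
  cont_alg_hom f -> uext f (tincl a) = tincl (f a).
Proof.
move=> hf; apply: ucoefP => k; rewrite ucoef_uext !ucoef_tincl.
by case: eqP => // _; rewrite hom0.
Qed.

Lemma ucoef_mon d k (m : 'X_{1..d.+1}) :
  ucoef k (mpoly_series 'X_[m] : mseries R d.+1)
    = if k == m ord0 then mpoly_series 'X_[mnm_t m] else 0.
Proof.
apply: mseriesP => p /=; rewrite mcoeffX mnm_t_inj mnm_ut0 mnm_utK eq_sym.
by case: eqP => //= _; rewrite mcoeffX.
Qed.

Lemma ucoef_varX d j k (a : mseries R d) :
  ucoef j (uvar R d ^+ k * tincl a) = if j == k then a else 0.
Proof.
elim: k j => [|k IHk] j; first by rewrite mul1r ucoef_tincl.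
by rewrite exprS -mulrA ucoef_varM; case: j.
Qed.

(** On a monomial, the extension separates the power of u from the monomial in
    t, to which [f] applies. *)
Lemma uext_hom e d (f : mseries R e -> mseries R d) :
  cont_alg_hom f -> cont_alg_hom (uext f).
Proof.
move=> hf.
have monE m : uext f (mpoly_series 'X_[m])
    = uvar R d ^+ m ord0 * tincl (f (mpoly_series 'X_[mnm_t m])).
  apply: ucoefP => k; rewrite ucoef_uext ucoef_varX ucoef_mon.
  by case: eqP => //; rewrite hom0.
apply: mon_hom.
- move=> r a b; apply: ucoefP => k; rewrite ucoef_uext.
  have ucoef_lin c x y : ucoef k (r *: x + y) = r *: ucoef k x + ucoef k y
    :> mseries R c by [].
  by rewrite !ucoef_lin !ucoef_uext homD ?homZ.
- move=> k; have [l fl] := hom_cont hf k; exists (k + l)%N => a al m.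
  rewrite wt_predT => lt_mk /=.
  have m0 : (m ord0 <= k)%N.
    by rewrite (leq_trans _ (ltnW lt_mk)) // mdeg_ut leq_addr.
  apply: (fl (ucoef (m ord0) a)) => [p|].
    rewrite wt_predT => lt_p; apply: al.
    by rewrite wt_predT mdeg_ut mnm_ut0 mnm_utK -addnS leq_add.
  by rewrite wt_predT (leq_ltn_trans _ lt_mk) // mdeg_ut leq_addl.
- have := monE 0%MM; rewrite mpolyX0 rmorph1 => ->.
  have -> : mnm_t 0%MM = 0%MM :> 'X_{1..e} by apply/mnmP => i; rewrite !mnmE.
  by rewrite mnm0E mul1r mpolyX0 rmorph1 (hom1 hf) (hom1 (tincl_hom d)).
move=> m m'; rewrite !monE mnm_tD mpolyXD rmorphM /= homM //.
by rewrite (homM (tincl_hom d)) mnmDE exprD; ring.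
Qed.

Lemma uext_uvar e d (f : mseries R e -> mseries R d) :
  cont_alg_hom f -> uext f (uvar R e) = uvar R d.
Proof.
move=> hf; apply: ucoefP => k.
have uvarE c : uvar R c = uvar R c ^+ 1 * tincl 1.
  by rewrite (hom1 (tincl_hom c)) mulr1.
by rewrite ucoef_uext [uvar R e]uvarE [uvar R d]uvarE !ucoef_varX;
  case: eqP; rewrite ?hom1 ?hom0.
Qed.

Lemma uext_shift e d (f : mseries R e -> mseries R d) a :
  uext f (shift ord0 a) = shift ord0 (uext f a).
Proof. by apply: ucoefP => k; rewrite ucoef_uext !ucoef_shift ucoef_uext. Qed.

Lemma uext_pr0 e d (f : mseries R e -> mseries R d) a : cont_alg_hom f ->
  uext f (pr0 uidx a) = pr0 uidx (uext f a).
Proof.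
move=> hf; apply: ucoefP => k; rewrite ucoef_uext !ucoef_pr0 ucoef_uext.
by case: eqP; rewrite ?hom0.
Qed.

Lemma uext_der0 e d (f : mseries R e -> mseries R d) a : cont_alg_hom f ->
  uext f (ms_der ord0 a) = ms_der ord0 (uext f a).
Proof.
by move=> hf; apply: ucoefP => k; rewrite ucoef_uext !ucoef_der0 ucoef_uext homMn.
Qed.

Lemma uext_der e d (f : mseries R e -> mseries R d) i a : cont_alg_hom f ->
  ms_der (tidx i) (uext f a)
    = \sum_j tincl (ms_der i (f (ms_var R j))) * uext f (ms_der (tidx j) a).
Proof.
move=> hf; rewrite (hom_der _ _ (uext_hom hf)) big_ord_recl.
rewrite -/(uvar R e) (uext_uvar hf) ms_der_var.
have -> : (tidx i == ord0) = false by apply/negbTE; rewrite eq_sym neq_lift.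
rewrite mul0r add0r.
apply: eq_bigr => j _; congr (_ * _).
by rewrite -/(tidx j) -tincl_var uext_tincl // tincl_der.
Qed.

Lemma uext_comp c e d (f : mseries R e -> mseries R d)
    (h : mseries R c -> mseries R e) a : uext f (uext h a) = uext (f \o h) a.
Proof. by apply: ucoefP => k; rewrite !ucoef_uext. Qed.

Lemma eq_uext e d (f h : mseries R e -> mseries R d) :
  f =1 h -> uext f =1 uext h.
Proof. by move=> eq_fh a; apply: ucoefP => k; rewrite !ucoef_uext eq_fh. Qed.

Lemma uext_id d (a : mseries R d.+1) : uext id a = a.
Proof. by apply: ucoefP => k; rewrite ucoef_uext. Qed.

(** Evaluation at t = 0, the constant being seen in any ring of series. *)
Definition cst0 d e (a : mseries R d) : mseries R e := (ms_const a)%:A.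

Lemma cst0_hom d e : cont_alg_hom (@cst0 d e).
Proof.
apply/cont_homP; split.
- by move=> r a b; rewrite /cst0 scalerA -scalerDl.
- by split=> [|a b]; rewrite /cst0 ?rmorph1 ?scale1r // rmorphM -scalerAl mul1r scalerA.
move=> k; exists k => a ak m lt_m /=; case: eqP => [m0|]; last by rewrite mulr0.
by rewrite /ms_const ak ?mul0r // wt0; move: lt_m; rewrite m0 wt0.
Qed.

Lemma pr0_t d (a : mseries R d.+1) : pr0 tpred a = uext (@cst0 d d) a.
Proof.
apply: mseriesP => m /=; rewrite wt_t mdeg_eq0.
case: eqP => [m0|_]; last by rewrite mulr0.
by rewrite mulr1 /ms_const /= -m0 mnm_tK.
Qed.

Lemma const_ucoef0 d (a : mseries R d.+1) : ms_const (ucoef 0 a) = ms_const a.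
Proof.
rewrite /ms_const /=; congr (a _).
by apply/mnmP => i; rewrite !mnmE; case: unliftP => //= j _; rewrite mnmE.
Qed.

Lemma const_tincl d (a : mseries R d) : ms_const (tincl a) = ms_const a.
Proof. by rewrite -const_ucoef0 ucoef_tincl. Qed.

Section Restriction.
Variables (d e : nat) (iota : 'I_d -> 'I_e).
Hypothesis iota_inj : injective iota.

Definition mnm_push (m : 'X_{1..d}) : 'X_{1..e} :=
  [multinom (\sum_(i | iota i == j) m i)%N | j < e].

Lemma mnm_push_iota m i : mnm_push m (iota i) = m i.
Proof.
rewrite mnmE (bigD1 i) //= big1 ?addn0 // => j /andP[/eqP/iota_inj ->].
by rewrite eqxx.
Qed.

Lemma mnm_push_out m j : j \notin codom iota -> mnm_push m j = 0%N.
Proof.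
move=> jN; rewrite mnmE big1 // => i /eqP def_j.
by rewrite -def_j codom_f in jN.
Qed.

Lemma mdeg_push m : mdeg (mnm_push m) = mdeg m.
Proof.
rewrite !mdegE; under eq_bigr do rewrite mnmE.
rewrite (exchange_big_dep xpredT) //=; apply: eq_bigr => i _.
by rewrite (eq_bigl (pred1 (iota i))) ?big_pred1_eq // => j; rewrite /= eq_sym.
Qed.

Lemma restr_coef (a : mseries R e) m : restr iota a m = a (mnm_push m).
Proof. by []. Qed.

Lemma restr_mon (m : 'X_{1..e}) : restr iota (mpoly_series 'X_[m] : mseries R e)
  = if [forall j, (j \notin codom iota) ==> (m j == 0%N)]
    then mpoly_series 'X_[[multinom m (iota i) | i < d]] else 0.
Proof.
apply: mseriesP => p; rewrite restr_coef /= mcoeffX.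
case: forallP => [m_supp|m_supp] /=.
  rewrite mcoeffX; congr (nat_of_bool _)%:R; apply/eqP/eqP => [->|<-].
    by apply/mnmP => i; rewrite mnmE mnm_push_iota.
  apply/mnmP => j; case jI: (j \in codom iota).
    by case/codomP: jI => i ->; rewrite mnm_push_iota mnmE.
  by rewrite mnm_push_out ?jI //; have := m_supp j; rewrite jI => /eqP.
case: eqP => // def_m; case: m_supp => j; apply/implyP => jN.
by rewrite def_m mnm_push_out.
Qed.

Lemma restr_hom : cont_alg_hom (@restr R d e iota).
Proof.
apply: mon_hom => //.
- move=> k; exists k => a ak m lt_m; rewrite restr_coef ak //.
  by rewrite wt_predT mdeg_push -wt_predT.
- apply: mseriesP => m; rewrite restr_coef !ms_coef1 -!mdeg_eq0.
  by rewrite mdeg_push.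
move=> m m'; rewrite !restr_mon.
case: forallP => [mm'|mm'].
  have m0 : [forall j, (j \notin codom iota) ==> (m j == 0%N)].
    apply/forallP => j; apply/implyP => jN; have := mm' j; rewrite jN mnmDE /=.
    by rewrite addn_eq0 => /andP[].
  have m0' : [forall j, (j \notin codom iota) ==> (m' j == 0%N)].
    apply/forallP => j; apply/implyP => jN; have := mm' j; rewrite jN mnmDE /=.
    by rewrite addn_eq0 => /andP[].
  rewrite m0 m0' -rmorphM -mpolyXD; congr (mpoly_series 'X_[_]).
  by apply/mnmP => i; rewrite !mnmE.
case: ifP => [/forallP m0|]; last by rewrite mul0r.
case: ifP => [/forallP m0'|]; last by rewrite mulr0.
case: mm' => j; apply/implyP => jN; rewrite mnmDE addn_eq0.
by have := m0 j; have := m0' j; rewrite jN /= => -> ->.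
Qed.

Lemma restr_var i : restr iota (ms_var R (iota i)) = ms_var R i.
Proof.
apply: mseriesP => m; rewrite restr_coef /=; congr (nat_of_bool _)%:R.
apply/eqP/eqP => [def_m|->].
  apply/mnmP => j; have /mnmP/(_ (iota j)) := def_m.
  by rewrite mnm_push_iota !mnm1E (inj_eq iota_inj).
apply/mnmP => j; case jI: (j \in codom iota).
  by case/codomP: jI => k ->; rewrite mnm_push_iota !mnm1E (inj_eq iota_inj).
rewrite mnm_push_out ?jI // mnm1E; case: eqP => // def_j.
by rewrite -def_j codom_f in jI.
Qed.

Lemma restr_var_out j : j \notin codom iota -> restr iota (ms_var R j) = 0.
Proof.
move=> jN; apply: mseriesP => m; rewrite restr_coef /=.
case: eqP => // /mnmP/(_ j).
by rewrite mnm_push_out // mnm1E eqxx.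
Qed.

Lemma sum_restr_var (V : lmodType (mseries R d.+1)) (F : 'I_e -> V) i :
  \sum_j tincl (ms_der i (restr iota (ms_var R j))) *: F j = F (iota i).
Proof.
rewrite (bigD1 (iota i)) //= restr_var ms_der_var eqxx (hom1 (tincl_hom d)).
rewrite scale1r big1 ?addr0 // => j ne_j; case jI: (j \in codom iota).
  case/codomP: jI ne_j => k ->; rewrite (inj_eq iota_inj) => ne_ki.
  rewrite restr_var ms_der_var eq_sym (negPf ne_ki).
  by rewrite (hom0 (tincl_hom d)) scale0r.
by rewrite restr_var_out ?jI // raddf0 (hom0 (tincl_hom d)) scale0r.
Qed.

(** The parameters that the restriction sets to 0. *)
Definition ypred : pred 'I_e.+1 :=
  fun j => if unlift ord0 j is Some j' then j' \notin codom iota else false.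

Lemma ypred0 : ypred ord0 = false.
Proof. by rewrite /ypred unlift_none. Qed.

Lemma ypred_t j : ypred (tidx j) = (j \notin codom iota).
Proof. by rewrite /ypred liftK. Qed.

Lemma pr0_ypred (a b : mseries R e.+1) :
  uext (restr iota) a = uext (restr iota) b -> pr0 ypred a = pr0 ypred b.
Proof.
move=> eq_ab; apply: mseriesP => m /=; case: eqP => // w0.
pose m' : 'X_{1..d.+1} := mnm_ut (m ord0) [multinom m (tidx (iota i)) | i < d].
have := congr1 (fun c : mseries R d.+1 => c m') eq_ab.
rewrite /= mnm_ut0 mnm_utK -!/(mnm_push _).
suff -> : mnm_ut (m ord0) (mnm_push [multinom m (tidx (iota i)) | i < d]) = m by [].
apply/mnmP => j; case: (unliftP ord0 j) => [j' ->|->]; last by rewrite mnm_ut0.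
rewrite mnm_ut_t; case jI: (j' \in codom iota).
  by case/codomP: jI => i ->; rewrite mnm_push_iota mnmE.
rewrite mnm_push_out ?jI //; apply/esym/eqP; rewrite -leqn0 -w0 /wt.
by rewrite (bigD1 (tidx j')) ?ypred_t ?jI //= leq_addr.
Qed.

Lemma uext_restr_pr0 S (a : mseries R e.+1) : {subset S <= ypred} ->
  uext (restr iota) (pr0 S a) = uext (restr iota) a.
Proof.
move=> sS; apply: mseriesP => m /=; rewrite -!/(mnm_push _).
rewrite (_ : wt S _ = 0%N) //; apply/eqP; rewrite -leqn0.
apply: leq_trans (wt_sub _ sS) _; rewrite leqn0 /wt big1 // => j.
case: (unliftP ord0 j) => [j' ->|->]; last by rewrite ypred0.
by rewrite ypred_t mnm_ut_t => jN; rewrite mnm_push_out.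
Qed.
End Restriction.
End Uexpansion.

(** * Potentials and formal changes of parameters *)

Section Nondegenerate.
Variables (R : idomainType) (N : nat).
Local Notation series := (mseries R N).

(** A matrix that kills, to some order, vectors whose values at the origin
    span a lattice of full rank, vanishes to this order: the first nonzero
    coefficient would already be killed by the values at the origin. *)
Lemma ordmx_nondegenerate (S : pred 'I_N) k n (D : 'M[series]_n)
    (w : 'I_n -> 'cV[series]_n) (r : 'I_n -> R) :
  (forall l, r l != 0) ->
  (forall l, map_mx (@ms_const R N) (w l) = r l *: delta_mx l 0) ->
  (forall l, ordmx S k (D *m w l)) -> ordmx S k D.
Proof.
move=> r0 wr Dw i j m; have [M] := ubnP (mdeg m); elim: M m j => // M IHM m j.
rewrite ltnS => le_mM lt_mk.
have coefD a b c (x : series) : x = \sum_(l < n) a l * b l ->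
    (forall l, (a l * b l) m = c l) -> x m = \sum_(l < n) c l.
  move=> -> abc; rewrite -(eq_bigr _ (fun l _ => abc l)).
  by elim/big_rec2: _ => // l y1 y2 _ <-.
have : (D *m w j) i 0 m = 0 by apply: Dw.
rewrite (coefD (D i) (fun l => w j l 0) (fun l => w j l 0 0%MM * D i l m)).
- have wjE l : w j l 0 0%MM = r j *+ (l == j).
    have := congr1 (fun X : 'cV[R]_n => X l 0) (wr j); rewrite /= !mxE eqxx andbT.
    by rewrite mulr_natr.
  rewrite (bigD1 j) //= wjE eqxx big1 ?addr0 => [/eqP|l ne_lj].
    by rewrite mulf_eq0 (negPf (r0 j)) => /eqP.
  by rewrite wjE (negPf ne_lj) mul0r.
- by rewrite mxE.
move=> l; set b := w j l 0.
transitivity ((D i l * (b 0%MM)%:A) m); last by rewrite -scalerAr mulr1.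
apply: eq_ms_coefM => p q def_m.
have [q0|q_neq0] := eqVneq q 0%MM; first by rewrite q0 /= eqxx mulr1.
rewrite IHM ?mul0r //.
  by rewrite (leq_trans _ le_mM) // def_m mdegD -addn1 leq_add2l lt0n mdeg_eq0.
by apply: leq_ltn_trans lt_mk; rewrite def_m wtD leq_addr.
Qed.
End Nondegenerate.

Section Poincare.
Variables (R : idomainType) (QR : {rmorphism rat -> R}) (N : nat).
Local Notation series := (mseries R N).

Lemma der_eul i (a : series) :
  ms_der i (eul predT a) = eul predT (ms_der i a) + ms_der i a.
Proof.
apply: mseriesP => m /=; rewrite wtD wtU addn1 -!mulrnA -mulrnDr.
by rewrite mulSn mulnC addnC.
Qed.

(** The primitive of a closed form, by integration along rays. *)
Lemma potential_exists (b : 'I_N -> series) :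
  (forall i j, ms_der i (b j) = ms_der j (b i)) ->
  exists2 psi, ms_const psi = 0 & forall i, ms_der i psi = b i.
Proof.
move=> b_closed; pose a := \sum_i ms_var R i * b i.
have a0 : pr0 predT a = 0.
  by apply/ordw1P/ordw_sum => i _; apply/ordwMl/ordw_var.
exists (ieul QR predT a).
  by rewrite -(ms_const_pr0 predT) pr0_ieul raddf0.
move=> j; apply/eqP; rewrite -subr_eq0; apply/eqP/(@ordw_eq0 _ _ predT) => k.
apply: (@ordw_eulD _ QR _ _ _ 1) => //; set psi := ieul _ _ _.
have -> : eul predT (ms_der j psi - b j) + (ms_der j psi - b j) *+ 1 = 0.
  rewrite mulr1n raddfB /= addrACA -opprD -der_eul ieulK // /a raddf_sum /=.
  have -> : eul predT (b j) + b j
      = \sum_i (ms_var R i * ms_der i (b j) + (j == i)%:R * b i).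
    rewrite eulE big_split /=; congr (_ + _).
    rewrite (bigD1 j) //= eqxx mul1r big1 ?addr0 // => i ne_ij.
    by rewrite eq_sym (negPf ne_ij) mul0r.
  rewrite -sumrB big1 // => i _.
  by rewrite ms_derM ms_der_var /= (b_closed i j) [X in X - _]addrC subrr.
exact: ordwZ0.
Qed.

Lemma potential_unique (a b : series) : ms_const a = ms_const b ->
  (forall i, ms_der i a = ms_der i b) -> a = b.
Proof.
move=> ab0 ab; apply/eqP; rewrite -subr_eq0; apply/eqP/(@ordw_eq0 _ _ predT) => k.
apply: (ordw_eul_inv QR).
  by rewrite pr0_predT raddfB /= ab0 subrr scale0r.
rewrite raddfB /= !eulE -sumrB; apply: ordw_sum => i _.
by rewrite ab subrr; apply: ordwZ0.
Qed.
End Poincare.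

Section InverseFunction.
Variables (R : idomainType) (QR : {rmorphism rat -> R}).

Section Perturbation.
Variables (d e k : nat) (f h : mseries R e -> mseries R d).
Hypotheses (hf : cont_alg_hom f) (hh : cont_alg_hom h).
Hypothesis fh : forall j, ordw predT k (f (ms_var R j) - h (ms_var R j)).

Lemma hom_perturb a : ordw predT k (f a - h a).
Proof.
have poly p : ordw predT k (f (mpoly_series p) - h (mpoly_series p)).
  move: p; apply: (@mpoly_series_ind _ _ (fun a => ordw predT k (f a - h a))) => [r b c Qb Qc||b c Qb Qc|]; last exact: fh.
  - rewrite (homD hf) (homZ hf) (homD hh) (homZ hh) opprD addrACA -scalerBr.
    by apply: ordwD => //; apply: ordwZ.
  - by rewrite (hom1 hf) (hom1 hh) subrr; apply: ordwZ0.
  rewrite (homM hf) (homM hh).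
  have -> : f b * f c - h b * h c = (f b - h b) * f c + h b * (f c - h c).
    by rewrite mulrBl mulrBr addrA subrK.
  by apply: ordwD; [apply: ordwMl | apply: ordwMr].
set p := mpoly_series (ms_trunc k a); have pa : ordw predT k (a - p) by apply: trunc_ord.
have -> : f a - h a = (f (a - p) - h (a - p)) + (f p - h p).
  by rewrite (homB hf) (homB hh) addrAC subrKA opprB subrKA.
apply: ordwD; last exact: poly.
by apply: ordwD; last apply: ordwN; exact: hom_ordw.
Qed.

(** A series without linear part is evaluated with one more order of
    precision than its arguments. *)
Lemma hom_perturb2 a : ordw predT 2 a -> ordw predT k.+1 (f a - h a).
Proof.
(* By Euler's formula for [b], [a] is a combination of the variables with
   coefficients that vanish at the origin. *)
move=> a2; pose b := ieul QR predT a.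
have a0 : pr0 predT a = 0 by apply/ordw1P/(ordwW _ a2).
have -> : a = \sum_i ms_var R i * ms_der i b by rewrite -eulE ieulK.
have b2 i : ordw predT 1 (ms_der i b).
  move=> m; rewrite ltnS leqn0 => /eqP m0 /=.
  by rewrite a2 ?mulr0 ?if_same ?mul0rn // wtD wtU m0.
rewrite (hom_sum hf) (hom_sum hh) -sumrB; apply: ordw_sum => i _.
rewrite (homM hf) (homM hh).
set x := f (ms_var R i); set y := h (ms_var R i).
have -> : x * f (ms_der i b) - y * h (ms_der i b)
    = (x - y) * f (ms_der i b) + y * (f (ms_der i b) - h (ms_der i b)).
  by rewrite mulrBl mulrBr addrA subrK.
apply: ordwD.
  by rewrite -addn1; apply: ordwM; [exact: fh | exact: hom_ordw].
by rewrite -add1n; apply: ordwM; [exact: hom_var_ord | exact: hom_perturb].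
Qed.
End Perturbation.

Variables (e n : nat) (psi : 'I_n -> mseries R e).
Hypothesis psi0 : forall l, ms_const (psi l) = 0.

Definition jac : 'M[R]_(n, e) := \matrix_(l, j) ms_const (ms_der j (psi l)).
Hypothesis jac_iso : mx_iso jac.

Let linpart l : mseries R e := \sum_j jac l j *: ms_var R j.

Let rest_ord l : ordw predT 2 (psi l - linpart l).
Proof.
apply: (ordw_eul_inv QR).
  rewrite pr0_predT raddfB /= psi0 sub0r.
  have : ms_const (linpart l) = 0.
    rewrite raddf_sum big1 // => j _.
    rewrite [LHS]ms_constZ -(ms_const_pr0 (pred1 j)) pr0_var /= eqxx.
    by rewrite raddf0 mulr0.
  by move=> ->; rewrite oppr0 scale0r.
rewrite eulE; apply: ordw_sum => i _; rewrite -(addn1 1).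
apply: ordwM; first exact: ordw_var.
have lin : ms_der i (linpart l) = (jac l i)%:A.
  rewrite raddf_sum (bigD1 i) //= linearZ /= ms_der_var eqxx big1 ?addr0 // => j ne_ji.
  by rewrite linearZ /= ms_der_var eq_sym (negPf ne_ji) scaler0.
rewrite (raddfB (@ms_der R e i)) /= lin; apply/ordw1P; rewrite pr0_predT.
suff -> : ms_const (ms_der i (psi l) - (jac l i)%:A) = 0 by rewrite scale0r.
transitivity (ms_const (ms_der i (psi l)) - ms_const ((jac l i)%:A : mseries R e)).
  by [].
by rewrite ms_constZ rmorph1 mulr1 mxE subrr.
Qed.

(** The linear part of [psi] is invertible, and the remainder is known with one
    more order of precision than the map. *)
Lemma hom_psi_unique d (f h : mseries R e -> mseries R d) :
  cont_alg_hom f -> cont_alg_hom h -> (forall l, f (psi l) = h (psi l)) -> f =1 h.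
Proof.
move=> hf hh fh; apply: cont_hom_ext => // j; have [J' _ JJ'] := jac_iso.
apply/eqP; rewrite -subr_eq0; apply/eqP/(@ordw_eq0 _ _ predT) => k.
elim: k j => [|k IHk] j; first exact: ordw0.
have -> : f (ms_var R j) - h (ms_var R j)
    = \sum_l J' j l *: (f (linpart l) - h (linpart l)).
  have E (q : mseries R e -> mseries R d) : cont_alg_hom q ->
      q (ms_var R j) = \sum_l J' j l *: q (linpart l).
    move=> hq; under eq_bigr do rewrite (hom_sum hq) scaler_sumr.
    rewrite exchange_big /=.
    transitivity (\sum_i (J' *m jac) j i *: q (ms_var R i)); last first.
      apply: eq_bigr => i _; rewrite mxE scaler_suml; apply: eq_bigr => l _.
      by rewrite (homZ hq) scalerA.
    rewrite JJ' (bigD1 j) //= mxE eqxx scale1r big1 ?addr0 // => i ne_ij.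
    by rewrite mxE eq_sym (negPf ne_ij) scale0r.
  by rewrite (E f) // (E h) // -sumrB; apply: eq_bigr => l _; rewrite scalerBr.
apply: ordw_sum => l _; apply: ordwZ.
have -> : f (linpart l) - h (linpart l)
    = - (f (psi l - linpart l) - h (psi l - linpart l)).
  by rewrite (homB hf) (homB hh) (fh l) !opprB [RHS]addrC subrKA.
by apply/ordwN/hom_perturb2.
Qed.

(** The inverse function theorem: inverting the linear part of [psi] turns the
    equations into a fixed point problem for a contraction. *)
Lemma hom_psi_exists d (phi : 'I_n -> mseries R d) :
  (forall l, ms_const (phi l) = 0) ->
  exists2 f, cont_alg_hom f & forall l, f (psi l) = phi l.
Proof.
move=> phi0; have [J' JJ' _] := jac_iso.
have ord1 p (g : 'I_p -> mseries R d) (l : 'I_p) : ms_const (g l) = 0 -> ordw predT 1 (g l).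
  by move=> g0; apply/ordw1P; rewrite pr0_predT g0 scale0r.
pose sub (g : unit -> 'cV[mseries R d]_e) := subst (fun j => g tt j 0).
have [Psi PsiE] : exists Psi : (unit -> 'cV[mseries R d]_e) -> unit -> 'cV[mseries R d]_e,
    forall g t i j, Psi g t i j = \sum_l J' i l *: (phi l - sub g (psi l - linpart l)).
  exists (fun g t => \col_j \sum_l J' j l *: (phi l - sub g (psi l - linpart l))).
  by move=> g t i j; rewrite mxE.
pose dom (g : unit -> 'cV[mseries R d]_e) := forall t, ordmx predT 1 (g t - 0).
have dom1 g : dom g -> forall j, ordw predT 1 (g tt j 0).
  by move=> domg j; have := domg tt j 0; rewrite subr0.
have hsub g : dom g -> cont_alg_hom (sub g) by move/dom1; apply: subst_hom.
have subX g j : dom g -> sub g (ms_var R j) = g tt j 0.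
  by move/dom1 => g1; rewrite /sub subst_var.
have [| |g domg defg] := @ordmx_fixpoint R d predT unit e 1 (fun=> 0) Psi.
- move=> g domg t i j; rewrite subr0 PsiE; apply: ordw_sum => l _; apply: ordwZ.
  apply: ordwD; first exact: ord1.
  by apply/ordwN/(ordwW _ (hom_ordw (hsub _ domg) (rest_ord l))).
- move=> k g g' domg domg' gg' t i j; rewrite mxsubE !PsiE -sumrB.
  apply: ordw_sum => l _; rewrite -scalerBr; apply: ordwZ.
  rewrite opprB addrC subrKA.
  apply: hom_perturb2; [exact: hsub | exact: hsub | move=> p | exact: rest_ord].
  rewrite (subX _ _ domg) (subX _ _ domg') -mxsubE.
  by have := gg' tt p 0; rewrite !mxsubE => /ordwN; rewrite opprB.
exists (sub g); first exact: hsub.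
move=> l; have hg := hsub _ domg.
have linE : sub g (linpart l) = phi l - sub g (psi l - linpart l).
  rewrite (hom_sum hg); under eq_bigr do rewrite (homZ hg) (subX _ _ domg) defg PsiE scaler_sumr.
  rewrite exchange_big /=.
  transitivity (\sum_m (jac *m J') l m *: (phi m - sub g (psi m - linpart m))).
    apply: eq_bigr => m _; rewrite mxE scaler_suml; apply: eq_bigr => i _.
    by rewrite scalerA.
  rewrite JJ' (bigD1 l) //= mxE eqxx scale1r big1 ?addr0 // => i ne_il.
  by rewrite mxE eq_sym (negPf ne_il) scale0r.
by rewrite -[psi l](subrK (linpart l)) (homD hg) linE addrC subrK.
Qed.
End InverseFunction.

Opaque ms_zero ms_opp ms_add ms_one ms_scale ms_var ms_der ms_const.
Opaque shift pr0 eul ordw tincl uext ucoef restr.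

(** * Connection matrices *)

Notation dt i := (map_mx (ms_der (tidx i))).
Notation du := (map_mx (ms_der ord0)).
Notation su := (map_mx (shift ord0)).
Notation p0u := (map_mx (pr0 uidx)).
Notation p0t := (map_mx (pr0 tpred)).
Notation cst := (map_mx (@ms_const _ _)).
Notation tvar i := (ms_var _ (tidx i)).

Section Connections.
Variables (R : comNzRingType).
Implicit Types d e n r : nat.

Lemma addr_congr (V : zmodType) (a b a' b' : V) :
  a = a' -> b = b' -> a + b = a' + b'.
Proof. by move=> -> ->. Qed.

Lemma tidx_neq0 d (i : 'I_d) : tidx i != ord0.
Proof. by rewrite eq_sym neq_lift. Qed.

Lemma mulmx_cV_inj (A : comNzRingType) n r (X Y : 'M[A]_(r, n)) :
  (forall s : 'cV_n, X *m s = Y *m s) -> X = Y.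
Proof.
move=> eqXY; apply/matrixP => i j; have := eqXY (delta_mx j 0).
by rewrite -!colE => /colP/(_ i); rewrite !mxE.
Qed.

Lemma dt_uZ d n r i (X : 'M[mseries R d.+1]_(n, r)) :
  dt i (uvar R d *: X) = uvar R d *: dt i X.
Proof. by rewrite dmxZ ms_der_var (negPf (tidx_neq0 i)) scale0r add0r. Qed.

Lemma dt_u2Z d n r i (X : 'M[mseries R d.+1]_(n, r)) :
  dt i (uvar R d ^+ 2 *: X) = uvar R d ^+ 2 *: dt i X.
Proof. by rewrite expr2 -!scalerA !dt_uZ. Qed.

Lemma du_uZ d n r (X : 'M[mseries R d.+1]_(n, r)) :
  du (uvar R d *: X) = X + uvar R d *: du X.
Proof. by rewrite dmxZ ms_der_var eqxx scale1r. Qed.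

Lemma emx_t d n r (X : 'M[mseries R d.+1]_(n, r)) :
  map_mx (eul tpred) X = \sum_(i < d) tvar i *: dt i X.
Proof. by rewrite emxE big_mkcond big_ord_recl /= add0r. Qed.

Definition horizontal_mx d n r (c : connection R d n) (c' : connection R d r) P :=
  (forall i, P *m conn_t c i = uvar R d *: dt i P + conn_t c' i *m P) /\
  P *m conn_u c = uvar R d ^+ 2 *: du P + conn_u c' *m P.

Lemma horizontalE d n r (c : connection R d n) (c' : connection R d r) P :
  horizontal c c' P <-> horizontal_mx c c' P.
Proof.
have stepT i s : P *m unabla_t c i s - unabla_t c' i (P *m s)
    = (P *m conn_t c i - (uvar R d *: dt i P + conn_t c' i *m P)) *m s.
  by rewrite /unabla_t dmxM; mxring.
have stepU s : P *m u2nabla_u c s - u2nabla_u c' (P *m s)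
    = (P *m conn_u c - (uvar R d ^+ 2 *: du P + conn_u c' *m P)) *m s.
  by rewrite /u2nabla_u dmxM; mxring.
split=> -[hT hU]; split.
- move=> i; apply/eqP; rewrite -subr_eq0; apply/eqP/mulmx_cV_inj => s.
  by rewrite -stepT hT subrr mul0mx.
- apply/eqP; rewrite -subr_eq0; apply/eqP/mulmx_cV_inj => s.
  by rewrite -stepU hU subrr mul0mx.
- by move=> i s; apply/eqP; rewrite -subr_eq0 stepT hT subrr mul0mx.
by move=> s; apply/eqP; rewrite -subr_eq0 stepU hU subrr mul0mx.
Qed.

Definition flat_mx d n (c : connection R d n) :=
  (forall i j, uvar R d *: dt i (conn_t c j) + conn_t c i *m conn_t c j
             = uvar R d *: dt j (conn_t c i) + conn_t c j *m conn_t c i) /\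
  (forall i, uvar R d ^+ 2 *: du (conn_t c i) + conn_u c *m conn_t c i
    = uvar R d *: dt i (conn_u c) + conn_t c i *m conn_u c
        + uvar R d *: conn_t c i).

(** The differential operators commute exactly when the zeroth order parts of
    their commutators vanish. *)
Lemma flatE d n (c : connection R d n) : flat c <-> flat_mx c.
Proof.
have stepT i j s : unabla_t c i (unabla_t c j s) - unabla_t c j (unabla_t c i s)
    = ((uvar R d *: dt i (conn_t c j) + conn_t c i *m conn_t c j)
       - (uvar R d *: dt j (conn_t c i) + conn_t c j *m conn_t c i)) *m s.
  rewrite /unabla_t !map_mxD /= !dt_uZ !dmxM (dmxC (tidx i) (tidx j)); mxring.
have stepU i s : u2nabla_u c (unabla_t c i s)
    - (unabla_t c i (u2nabla_u c s) + uvar R d *: unabla_t c i s)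
    = ((uvar R d ^+ 2 *: du (conn_t c i) + conn_u c *m conn_t c i)
    - (uvar R d *: dt i (conn_u c) + conn_t c i *m conn_u c
        + uvar R d *: conn_t c i)) *m s.
  rewrite /unabla_t /u2nabla_u !map_mxD /= du_uZ dt_u2Z.
  rewrite !dmxM (dmxC ord0 (tidx i)); mxring.
split=> -[hT hU]; split.
- move=> i j; apply/eqP; rewrite -subr_eq0; apply/eqP/mulmx_cV_inj => s.
  by rewrite -stepT hT subrr mul0mx.
- move=> i; apply/eqP; rewrite -subr_eq0; apply/eqP/mulmx_cV_inj => s.
  by rewrite -stepU hU subrr mul0mx.
- by move=> i j s; apply/eqP; rewrite -subr_eq0 stepT hT subrr mul0mx.
by move=> i s; apply/eqP; rewrite -subr_eq0 stepU hU subrr mul0mx.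
Qed.

Lemma horizontal_comp d n1 n2 n3 (c1 : connection R d n1)
    (c2 : connection R d n2) (c3 : connection R d n3) P Q :
  horizontal c1 c2 P -> horizontal c2 c3 Q -> horizontal c1 c3 (Q *m P).
Proof.
move=> [PT PU] [QT QU]; split=> [i s|s]; first by rewrite -!mulmxA PT QT.
by rewrite -!mulmxA PU QU.
Qed.

Lemma horizontal_inv d n r (c : connection R d n) (c' : connection R d r) P Q :
  P *m Q = 1%:M -> Q *m P = 1%:M -> horizontal c c' P -> horizontal c' c Q.
Proof.
move=> PQ QP [PT PU]; split=> [i s|s].
  by rewrite -[s in LHS]mul1mx -PQ -mulmxA -PT mulmxA QP mul1mx.
by rewrite -[s in LHS]mul1mx -PQ -mulmxA -PU mulmxA QP mul1mx.
Qed.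

Lemma flat_horizontal d n r (c : connection R d n) (c' : connection R d r) P :
  mx_iso P -> horizontal c c' P -> flat c -> flat c'.
Proof.
move=> [Q PQ QP] [PT PU] [cT cU].
have sE (s : 'cV_r) : s = P *m (Q *m s) by rewrite mulmxA PQ mul1mx.
split=> [i j s|i s]; rewrite (sE s); set s' := Q *m s.
  by rewrite -(PT j s') -(PT i s') -(PT i _) -(PT j _) cT.
by rewrite -(PT i s') -(PU _) cU mulmxDr (PT i (u2nabla_u c s')) (PU s') mulmxscale.
Qed.

Definition gauge d n r (c : connection R d n) (P : 'M_(r, n)) (Q : 'M_(n, r)) :=
  Connection (fun i => (P *m conn_t c i - uvar R d *: dt i P) *m Q)
    ((P *m conn_u c - uvar R d ^+ 2 *: du P) *m Q).

Lemma horizontal_gauge d n r (c : connection R d n) (P : 'M_(r, n)) Q :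
  Q *m P = 1%:M -> horizontal c (gauge c P Q) P.
Proof.
move=> QP; apply/horizontalE; split=> [i|] /=.
  by rewrite -mulmxA QP mulmx1 addrC subrK.
by rewrite -mulmxA QP mulmx1 addrC subrK.
Qed.

Section Pullback.
Variables (d e : nat) (f : mseries R e -> mseries R d).
Hypothesis hf : cont_alg_hom f.
Let hu := uext_hom hf.

Lemma dt_uext n r i (X : 'M_(n, r)) : dt i (map_mx (uext f) X)
  = \sum_j tincl (ms_der i (f (ms_var R j))) *: map_mx (uext f) (dt j X).
Proof.
apply/matrixP => k l; rewrite !mxE summxE uext_der //.
by apply: eq_bigr => j _; rewrite !mxE.
Qed.

Lemma du_uext n r (X : 'M_(n, r)) : du (map_mx (uext f) X) = map_mx (uext f) (du X).
Proof. by apply/matrixP => k l; rewrite !mxE uext_der0. Qed.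

Lemma su_uext n r (X : 'M_(n, r)) : su (map_mx (uext f) X) = map_mx (uext f) (su X).
Proof. by apply/matrixP => k l; rewrite !mxE uext_shift. Qed.

Lemma p0u_uext n r (X : 'M_(n, r)) : p0u (map_mx (uext f) X) = map_mx (uext f) (p0u X).
Proof. by apply/matrixP => k l; rewrite !mxE uext_pr0. Qed.

Lemma hmx_uZ n r (X : 'M_(n, r)) :
  map_mx (uext f) (uvar R e *: X) = uvar R d *: map_mx (uext f) X.
Proof. by rewrite (hmxZ hu) uext_uvar. Qed.

Lemma hmx_u2Z n r (X : 'M_(n, r)) :
  map_mx (uext f) (uvar R e ^+ 2 *: X) = uvar R d ^+ 2 *: map_mx (uext f) X.
Proof. by rewrite !expr2 -!scalerA !hmx_uZ. Qed.

Lemma horizontal_pullback n r (c : connection R e n) (c' : connection R e r) P :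
  horizontal c c' P ->
  horizontal (pullback f c) (pullback f c') (map_mx (uext f) P).
Proof.
move=> /horizontalE[PT PU]; apply/horizontalE; split=> [i|] /=; last first.
  by rewrite -(hmxM hu) PU (hmxD hu) hmx_u2Z -du_uext (hmxM hu).
rewrite mulmx_sumr mulmx_suml dt_uext scaler_sumr -big_split.
apply: eq_bigr => j _ /=; rewrite -scalemxAr -(hmxM hu) PT (hmxD hu).
by rewrite hmx_uZ (hmxM hu) scalerDr -scalemxAl !scalerA mulrC.
Qed.

(** In the direction of two parameters, the curvature of the pullback is the
    pullback of the curvature, up to second derivatives of [f], which are
    symmetric. *)
Lemma flat_pullback n (c : connection R e n) : flat c -> flat (pullback f c).
Proof.
move=> /flatE[cT cU]; apply/flatE; split=> [i j|i] /=; last first.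
  have -> : du (\sum_(j < e) tincl (ms_der i (f (ms_var R j)))
      *: map_mx (uext f) (conn_t c j))
    = \sum_(j < e) tincl (ms_der i (f (ms_var R j)))
      *: map_mx (uext f) (du (conn_t c j)).
    rewrite raddf_sum; apply: eq_bigr => j _ /=; rewrite dmxZ du_uext.
    by rewrite -pr0_tincl der_pr0 scale0r add0r.
  rewrite dt_uext (scaler_sumr (uvar R d ^+ 2)) (scaler_sumr (uvar R d)).
  rewrite mulmx_sumr.
rewrite mulmx_suml.
rewrite scaler_sumr.
rewrite -!big_split.
  apply: eq_bigr => j _ /=; have := congr1 (map_mx (uext f)) (cU j).
  rewrite !(hmxD hu) hmx_u2Z !hmx_uZ !(hmxM hu) => cUj.
  set x := tincl _; set X1 := map_mx _ (du _) in cUj *.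
  set X2 := map_mx _ (conn_u _) in cUj *; set X3 := map_mx _ (conn_t _ _) in cUj *.
  set X4 := map_mx _ (dt _ _) in cUj *.
  transitivity (x *: (uvar R d ^+ 2 *: X1 + X2 *m X3)); first by mxring.
  rewrite cUj.
 mxring.
pose g k l := tincl (ms_der k (f (ms_var R l))) : mseries R d.+1.
pose A l := map_mx (uext f) (conn_t c l); pose DA k l := map_mx (uext f) (dt k (conn_t c l)).
have gC k k' l : ms_der (tidx k) (g k' l) = ms_der (tidx k') (g k l).
  by rewrite !tincl_der ms_derC.
have cTf k l : uvar R d *: DA k l + A k *m A l = uvar R d *: DA l k + A l *m A k.
  have := congr1 (map_mx (uext f)) (cT k l).
  by rewrite !(hmxD hu) (hmx_uZ (dt k _)) (hmx_uZ (dt l _)) !(hmxM hu).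
have expand k k' : uvar R d *: dt k (\sum_(l < e) g k' l *: A l)
    + (\sum_(l < e) g k l *: A l) *m (\sum_(l < e) g k' l *: A l)
  = \sum_(l < e) (uvar R d * ms_der (tidx k) (g k' l)) *: A l
    + \sum_(l < e) \sum_(m < e) (g k m * g k' l) *: (uvar R d *: DA m l + A m *m A l).
  rewrite raddf_sum mulmx_sumr scaler_sumr -!big_split; apply: eq_bigr => l _ /=.
  rewrite mulmx_suml dmxZ /A dt_uext scalerDr scalerA -addrA; congr (_ + _).
  rewrite !scaler_sumr -big_split; apply: eq_bigr => m _ /=.
  rewrite -/(A _) -/(g k m) mulscalemx mulmxscale !scalerA scalerDr scalerA.
  by congr (_ *: _ + _ *: _); ring.
rewrite (expand i j) (expand j i) [X in _ + X = _]exchange_big.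
apply: (@addr_congr _ _ _ _ _).
  by apply: eq_bigr => l _; rewrite gC.
by apply: eq_bigr => l _; apply: eq_bigr => m _; rewrite cTf mulrC.
Qed.
End Pullback.

Lemma eq_connection d n (c c' : connection R d n) :
  (forall i, conn_t c i = conn_t c' i) -> conn_u c = conn_u c' -> c = c'.
Proof.
case: c c' => [A U] [A' U'] /= eqA ->; congr Connection.
exact/funext.
Qed.

Lemma pullback_comp b d e n (f : mseries R e -> mseries R d)
    (h : mseries R b -> mseries R e) (c : connection R b n) :
  cont_alg_hom f -> cont_alg_hom h ->
  pullback f (pullback h c) = pullback (f \o h) c.
Proof.
move=> hf hh; have hu := uext_hom hf; apply: eq_connection => [i|] /=; last first.
  by apply/matrixP => k l; rewrite !mxE uext_comp.
under eq_bigr do rewrite (hmx_sum hu) scaler_sumr.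
rewrite exchange_big; apply: eq_bigr => j _ /=.
rewrite (hom_der _ _ hf) (hom_sum (tincl_hom R d)) scaler_suml.
apply: eq_bigr => k _; rewrite (hmxZ hu) uext_tincl // scalerA.
rewrite (homM (tincl_hom R d)); congr (_ *: _).
by apply/matrixP => p q; rewrite !mxE uext_comp.
Qed.

Lemma eq_pullback d e n (f h : mseries R e -> mseries R d) (c : connection R e n) :
  f =1 h -> pullback f c = pullback h c.
Proof. by move=> /funext->. Qed.

(** The condition of a framing in the directions of the parameters alone; no
    condition bears on the direction of u. *)
Definition tframed d n (c : connection R d n) :=
  forall i, p0u (conn_t c i) = conn_t c i.

Lemma tframed_pullback d e n (f : mseries R e -> mseries R d) (c : connection R e n) :
  cont_alg_hom f -> tframed c -> tframed (pullback f c).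
Proof.
move=> hf tc i /=; rewrite raddf_sum; apply: eq_bigr => j _ /=.
by rewrite map_mxZ /= pr0_tincl p0u_uext // tc.
Qed.

End Connections.

Section Structure.
Variables (R : comNzRingType).
Implicit Types d e n r : nat.

(** The coefficients of the powers of u in the flatness equations of a
    connection, for the directions in [K], when the matrices in these directions
    do not depend on u. The other parameters are only carried along, which
    allows to add parameters one at a time in a fixed ring. *)
Record tsystem d n (K : pred 'I_d) (A : 'I_d -> 'M[mseries R d.+1]_n) U :=
  TSystem {
    ts_free : forall i, K i -> p0u (A i) = A i;
    ts_comm : forall i j, K i -> K j -> cmx (A i) (A j) = 0;
    ts_comm0 : forall i, K i -> cmx (A i) (p0u U) = 0;
    ts_closed : forall i j, K i -> K j -> dt i (A j) = dt j (A i);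
    ts_u : forall i, K i -> dt i U + A i + cmx (A i) (su U) = 0
  }.

Lemma u_decomp d n r (X : 'M[mseries R d.+1]_(n, r)) :
  X = p0u X + uvar R d *: su X.
Proof. by rewrite var_smx addrC subrK. Qed.

Lemma p0u_uZ d n r (X : 'M[mseries R d.+1]_(n, r)) : p0u (uvar R d *: X) = 0.
Proof. exact: p0mx_varZ. Qed.

Lemma p0u_dt d n r i (X : 'M[mseries R d.+1]_(n, r)) : p0u (dt i X) = dt i (p0u X).
Proof. by rewrite p0mx_der //= tidx_neq0. Qed.

Lemma su_dt d n r i (X : 'M[mseries R d.+1]_(n, r)) : su (dt i X) = dt i (su X).
Proof. by rewrite smx_der // tidx_neq0. Qed.

Lemma p0u_cmx d n (X Y : 'M[mseries R d.+1]_n) : p0u (cmx X Y) = cmx (p0u X) (p0u Y).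
Proof. by rewrite /cmx map_mxB !map_mxM. Qed.

Lemma p0S_cmx d (S : pred 'I_d.+1) n (X Y : 'M[mseries R d.+1]_n) :
  map_mx (pr0 S) (cmx X Y) = cmx (map_mx (pr0 S) X) (map_mx (pr0 S) Y).
Proof. by rewrite /cmx map_mxB !map_mxM. Qed.

Lemma su_cmx d n (X Y : 'M[mseries R d.+1]_n) : p0u X = X ->
  su (cmx X Y) = cmx X (su Y).
Proof. by move=> X0; rewrite /cmx map_mxB /= (smxMl _ X0) (smxMr _ X0). Qed.

Lemma su_cmxr d n (X Y : 'M[mseries R d.+1]_n) : p0u Y = Y ->
  su (cmx X Y) = cmx (su X) Y.
Proof. by move=> Y0; rewrite /cmx map_mxB /= (smxMl _ Y0) (smxMr _ Y0). Qed.

Lemma dt_cmx d n i (X Y : 'M[mseries R d.+1]_n) :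
  dt i (cmx X Y) = cmx (dt i X) Y + cmx X (dt i Y).
Proof. by rewrite /cmx map_mxB /= !dmxM; mxring. Qed.

Lemma u_split d n r (X Y : 'M[mseries R d.+1]_(n, r)) :
  p0u X = X -> X + uvar R d *: Y = 0 -> X = 0 /\ Y = 0.
Proof.
move=> X0 XY; have := congr1 p0u XY.
rewrite map_mxD /= p0u_uZ addr0 X0 map_mx0 => X00; split=> //.
apply: (@scale_var_inj _ _ ord0); rewrite scaler0.
by move: XY; rewrite X00 add0r.
Qed.

Lemma flat_tsystem d n (c : connection R d n) : tframed c ->
  flat c <-> tsystem xpredT (conn_t c) (conn_u c).
Proof.
case: c => A U tc; rewrite /tframed /= in tc *.
have eqT i j : (uvar R d *: dt i (A j) + A i *m A j)
    - (uvar R d *: dt j (A i) + A j *m A i)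
    = cmx (A i) (A j) + uvar R d *: (dt i (A j) - dt j (A i)) by mxring.
have eqU i : (uvar R d ^+ 2 *: du (A i) + U *m A i)
    - (uvar R d *: dt i U + A i *m U + uvar R d *: A i)
    = - (cmx (A i) (p0u U) + uvar R d *: (dt i U + A i + cmx (A i) (su U))).
  have dA : du (A i) = 0 by rewrite -(tc i) dmx_p0.
  have UA : U *m A i = (p0u U + uvar R d *: su U) *m A i by rewrite -u_decomp.
  have AU : A i *m U = A i *m (p0u U + uvar R d *: su U) by rewrite -u_decomp.
  rewrite dA scaler0 add0r UA AU; mxring.
split.
  move=> /flatE[/= cT cU]; have splitT i j : cmx (A i) (A j) = 0 /\
      dt i (A j) - dt j (A i) = 0.
    apply: u_split; first by rewrite p0u_cmx tc tc.
    by rewrite -eqT; apply/eqP; rewrite subr_eq0; apply/eqP/cT.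
  have splitU i : cmx (A i) (p0u U) = 0 /\ dt i U + A i + cmx (A i) (su U) = 0.
    apply: u_split; first by rewrite p0u_cmx tc p0mx_id.
    apply: oppr_inj; rewrite -eqU oppr0.
    by apply/eqP; rewrite subr_eq0; apply/eqP/cU.
  split=> [i _|i j _ _|i _|i j _ _|i _].
  - exact: tc.
  - by case: (splitT i j).
  - by case: (splitU i).
  - by apply/eqP; rewrite -subr_eq0; apply/eqP; case: (splitT i j).
  by case: (splitU i).
case=> _ AA AU DA DU; apply/flatE; split=> /= [i j|i]; apply/eqP; rewrite -subr_eq0.
  by rewrite (eqT i j) (AA i j) // (DA i j) // subrr scaler0 addr0.
by rewrite (eqU i) (AU i) // (DU i) // scaler0 addr0 oppr0.
Qed.

Lemma p0t_cst d n r (X : 'M[mseries R d.+1]_(n, r)) : cst (p0t X) = cst X.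
Proof. exact: cst_p0mx. Qed.

Lemma p0u_invm d n (X : 'M[mseries R d.+1]_n) : mx_iso X -> p0u X = X ->
  p0u (invm X) = invm X.
Proof.
move=> isoX X0; have := congr1 p0u (mul_invmx isoX); rewrite map_mxM map_mx1 /= X0.
move=> invX; rewrite -[LHS]mulmx1 -(mulmx_invm isoX) mulmxA invX.
by rewrite mul1mx.
Qed.
End Structure.

(** * Trivializations constant in u along the parameters *)

Section TFraming.
Variables (R : idomainType) (QR : {rmorphism rat -> R}).

Lemma ord_radial d n r (F : 'I_d -> 'M[mseries R d.+1]_(n, r)) :
  ordmx tpred 1 (\sum_(i < d) tvar i *: F i).
Proof.
by apply: ordmx_sum => i _; apply: ordmx_var; [exact: tidx_neq0 | exact: ordmx00].
Qed.

Let sum_deltaZ (A : nzRingType) (V : lmodType A) (I : finType) (F : I -> V) j :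
  \sum_i (j == i)%:R *: F i = F j.
Proof.
rewrite (bigD1 j) //= eqxx scale1r big1 ?addr0 // => i ne_ij.
by rewrite eq_sym (negPf ne_ij) scale0r.
Qed.

Let radial_contraction (A : comNzRingType) (I : finType) n (u : A) (t : I -> A)
    (F G H : I -> 'M[A]_n) X :
  (forall i, u *: G i + F i *m X = u *: H i + X *m F i) ->
  u *: (\sum_i t i *: G i + X - (X + \sum_i t i *: H i))
    = cmx X (\sum_i t i *: F i).
Proof.
move=> FGH; rewrite opprD addrA addrK -sumrB scaler_sumr /cmx mulmx_sumr.
rewrite mulmx_suml -sumrB; apply: eq_bigr => i _.
transitivity (t i *: (u *: G i + F i *m X - u *: H i - F i *m X)); first by mxring.
by rewrite FGH; mxring.
Qed.

Let tframing_contraction (A : comNzRingType) n (x y a p q b i j : 'M[A]_n) :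
  x *m a - p *m b *m i *m x - (y *m a - q *m b *m j *m y)
  = (x - y) *m a - (p - q) *m (b *m (i *m x)) - q *m (b *m (i *m x - j *m y)).
Proof. mxring. Qed.

(** The trivialization is built along rays t -> st: there the condition is an
    ordinary differential equation, which prescribes that the contraction [a] of
    the connection with the Euler field becomes free of u (its u-free part is
    then P_0 a_0 P_0^-1, where the index 0 means u = 0). In the resulting gauge,
    flatness contracted with the Euler field reads
    (E + 1) B_j = [sh B_j, b], where B_j collects the positive powers of u in
    the j-th matrix and b, the new contraction, vanishes at t = 0. This forces
    B_j to vanish to all orders. *)
Lemma tframing1 d n (c : connection R d n) : flat c ->
  exists P c', [/\ mx_iso P, p0t P = 1%:M, tframed c' & horizontal c c' P].
Proof.
move=> cF; pose a := \sum_(i < d) tvar i *: conn_t c i.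
have a1 : ordmx tpred 1 a by apply: ord_radial.
pose b (X : 'M[mseries R d.+1]_n) := p0u X *m p0u a *m invm (p0u X).
have iso0 X : p0t X = p0t (1%:M : 'M[mseries R d.+1]_n) -> mx_iso (p0u X).
  move=> X1; apply: mx_iso_const1; rewrite cst_p0mx -p0t_cst X1 p0t_cst.
  exact: map_mx1.
have [| |X domX defX] := @radial_ode R QR _ tpred unit n n (fun=> 1%:M)
  (fun X t => su (X t *m a - b (X t) *m X t)).
- move=> X domX t; apply: ordmx_shift => //; apply: ordmxB; first exact: ordmxMr.
  by apply/ordmxMl/ordmxMl/ordmxMr/ordmx_p0.
- move=> k X Y domX domY XY t; rewrite -map_mxB; apply: ordmx_shift => //.
  set x := X t; set y := Y t; rewrite /b.
  have XYt := XY t; have isoX := iso0 _ (domX t); have isoY := iso0 _ (domY t).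
  rewrite tframing_contraction; apply: ordmxB; first apply: ordmxB.
  + exact: ordmxM1r.
  + apply: ordmxM1r; last by apply/ordmxMl/ordmx_p0.
    by rewrite -map_mxB; apply: ordmx_p0.
  apply/ordmxMr/ordmxM1l; first exact: ordmx_p0.
  apply: ordmxMB; last exact: XYt.
  apply: (ordmx_invm isoX isoY).
  by rewrite -map_mxB; apply: ordmx_p0.
pose P := X tt; have [B defB] : exists B, B = b P by exists (b P).
have P0 : p0t P = 1%:M by rewrite domX map_mx1.
have isoP0 : mx_iso (p0u P) by apply/iso0/domX.
have isoP : mx_iso P.
  by apply: mx_iso_const1; rewrite -p0t_cst P0 map_mx1.
have B0 : p0u B = B.
  by rewrite defB /b !map_mxM /= !p0mx_id p0u_invm // p0mx_id.
have B1 : ordmx tpred 1 B by rewrite defB; apply/ordmxMl/ordmxMr/ordmx_p0.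
have EP : uvar R d *: map_mx (eul tpred) P = P *m a - B *m P.
  have defP : map_mx (eul tpred) P = su (P *m a - B *m P).
    by rewrite defB; apply: defX.
  rewrite defP var_smx map_mxB !map_mxM /= B0.
  have -> : B *m p0u P = p0u P *m p0u a.
    by rewrite defB /b -mulmxA (mul_invmx isoP0) mulmx1.
  by rewrite subrr subr0.
have [Q PQ QP] := isoP; pose c' := gauge c P Q.
have hc' : horizontal c c' P by apply: horizontal_gauge.
exists P, c'; split=> //.
have /flatE[c'T _] := flat_horizontal isoP hc' cF.
have sumB : \sum_(i < d) tvar i *: conn_t c' i = B.
  rewrite -[RHS]mulmx1 -PQ mulmxA -[B *m P](subKr (P *m a)) -EP emx_t.
  rewrite /a mulmx_sumr scaler_sumr -sumrB mulmx_suml; apply: eq_bigr => i _ /=.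
  by rewrite scalemxAl scalerBr -scalemxAr !scalerA [uvar R d * _]mulrC.
move=> j; set Aj := conn_t c' j; pose Bj := su Aj.
have DjB : dt j B = Aj + \sum_(i < d) tvar i *: dt j (conn_t c' i).
  rewrite /Aj -sumB raddf_sum -(sum_deltaZ (conn_t c') j) -big_split.
  apply: eq_bigr => i _; rewrite [LHS]dmxZ ms_der_var.
  by rewrite (inj_eq (@lift_inj _ _)).
have radial : uvar R d *: (map_mx (eul tpred) Aj + Aj - dt j B) = cmx Aj B.
  rewrite DjB emx_t -sumB; apply: radial_contraction => i; exact: c'T.
have radial1 : map_mx (eul tpred) Aj + Aj - dt j B = cmx Bj B.
  apply: (@scale_var_inj _ _ ord0); rewrite -/(uvar R d) radial.
  have : cmx (p0u Aj) B = 0.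
    by rewrite -{1}B0 -p0u_cmx -radial p0u_uZ.
  rewrite {2}[Aj]u_decomp -/Bj => cmx0.
  rewrite (_ : cmx _ B = cmx (p0u Aj) B + uvar R d *: cmx Bj B); last by mxring.
  by rewrite cmx0 add0r.
have radial2 : map_mx (eul tpred) Bj + Bj = cmx (su Bj) B.
  have suB : su B = 0 by rewrite -B0 smx_pr0.
  have := congr1 su radial1.
  rewrite [su (_ - _)]map_mxB [su (_ + _)]map_mxD /=.
  rewrite (@smx_eul _ _ tpred ord0 _ _ Aj isT) (su_dt j B) suB map_mx0 subr0 => ->.
  exact: su_cmxr.
have Bj0 : Bj = 0.
  apply: (@ordmx_eq0 _ _ tpred) => k; elim: k => [|k IHk]; first exact: ordmx00.
  move=> p q; apply: (@ordw_eulD _ QR _ _ _ 1) => //.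
  have -> : eul tpred (Bj p q) + Bj p q *+ 1 = cmx (su Bj) B p q.
    by rewrite -radial2 !mxE.
  have sB : ordmx tpred k (su Bj) by apply: ordmx_shift.
  by apply: ordmxB; [apply: ordmxM1r | apply: ordmxM1l].
by rewrite [RHS]u_decomp -/Bj Bj0 scaler0 addr0.
Qed.

Lemma tframing_exists d n r (c : connection R d n) (P0 : 'M_(r, n)) :
  flat c -> mx_iso P0 -> p0t P0 = P0 ->
  exists P c', [/\ mx_iso P, p0t P = P0, flat c', tframed c' & horizontal c c' P].
Proof.
move=> cF isoP0 P00; have [Q0 PQ QP] := isoP0.
have h0 := horizontal_gauge c QP; have F0 := flat_horizontal isoP0 h0 cF.
have [P1 [c' [isoP1 P10 tc' h1]]] := tframing1 F0.
exists (P1 *m P0), c'; split.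
- exact: mx_isoM.
- by rewrite map_mxM /= P10 P00 mul1mx.
- exact: (flat_horizontal isoP1 h1 F0).
- exact: tc'.
exact: (horizontal_comp h0 h1).
Qed.

(** If G = 1 + H, the positive powers of u in the equation of horizontal maps
    express the derivatives of H by the shift of H; along the Euler field the
    coefficients vanish at t = 0, and H = 0 follows order by order. *)
Lemma tframing_unique d n (c c' : connection R d n) (G : 'M_n) :
  tframed c -> tframed c' -> horizontal c c' G -> p0t G = 1%:M -> G = 1%:M.
Proof.
move=> tc tc' /horizontalE[GT _] G1.
pose a := \sum_(i < d) tvar i *: conn_t c i.
pose a' := \sum_(i < d) tvar i *: conn_t c' i.
have DG i : dt i G = su G *m conn_t c i - conn_t c' i *m su G.
  have GTi := GT i; have := congr1 p0u GTi.
  rewrite map_mxD !map_mxM /= tc tc' p0u_uZ add0r => GT0.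
  have : uvar R d *: dt i G = uvar R d *: (su G *m conn_t c i - conn_t c' i *m su G).
    transitivity (G *m conn_t c i - conn_t c' i *m G); first by rewrite GTi addrK.
    transitivity ((p0u G + uvar R d *: su G) *m conn_t c i
      - conn_t c' i *m (p0u G + uvar R d *: su G)); first by rewrite -u_decomp.
    transitivity (p0u G *m conn_t c i - conn_t c' i *m p0u G
      + uvar R d *: (su G *m conn_t c i - conn_t c' i *m su G)); first by mxring.
    by rewrite GT0 subrr add0r.
  exact: scale_var_inj.
have EG : map_mx (eul tpred) (G - 1%:M) = su (G - 1%:M) *m a - a' *m su (G - 1%:M).
  have -> : su (G - 1%:M) = su G.
    have /= su1 : su (p0u (1%:M : 'M[mseries R d.+1]_n)) = 0 by rewrite smx_pr0.
    by rewrite map_mxB /=; move: su1; rewrite map_mx1 => ->; rewrite subr0.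
  have -> : map_mx (eul tpred) (G - 1%:M) = map_mx (eul tpred) G.
    rewrite map_mxB /= [X in _ - X](_ : _ = 0) ?subr0 // emx_t big1 // => i _.
    by rewrite dmx1 scaler0.
  rewrite emx_t /a /a' mulmx_sumr mulmx_suml -sumrB; apply: eq_bigr => i _.
  by rewrite DG scalerBr scalemxAr scalemxAl.
apply: (@ordmx_eq _ _ tpred) => k; elim: k => [|k IHk]; first exact: ordmx00.
apply: (ordmx_eul_inv QR); first by rewrite map_mxB /= G1 map_mx1 subrr.
have sG : ordmx tpred k (su (G - 1%:M)) by apply: ordmx_shift.
rewrite EG; apply: ordmxB.
  by apply: ordmxM1r => //; apply: ord_radial.
by apply: ordmxM1l => //; apply: ord_radial.
Qed.

(** Let V be what remains of the matrix in the direction of u beyond its terms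
    of degree 0 and 1 in u. Flatness gives D_i V = - [A_i, sh V], a homogeneous
    linear equation, so that V vanishes if it does at t = 0. *)
Lemma framing_propagates d n (c : connection R d n) : flat c -> tframed c ->
  p0t (su (su (conn_u c))) = 0 -> su (su (conn_u c)) = 0.
Proof.
move=> cF tc V0; have /(flat_tsystem tc)[_ _ _ _ DU] := cF.
set V := su (su _) in V0 *.
have DV i : dt i V = - cmx (conn_t c i) (su V).
  have suA : su (conn_t c i) = 0 by rewrite -(tc i) smx_pr0.
  have /eqP := congr1 su (congr1 su (DU i isT)); rewrite !map_mx0.
  rewrite [su (_ + cmx _ _)]map_mxD [su (_ + conn_t c i)]map_mxD /= suA addr0.
  rewrite (su_dt i (conn_u c)) (su_cmx _ (tc i)).
  rewrite [su (_ + cmx _ _)]map_mxD /= (su_dt i (su _)) (su_cmx _ (tc i)).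
  by rewrite addr_eq0 => /eqP.
pose a := \sum_(i < d) tvar i *: conn_t c i.
have EV : map_mx (eul tpred) V = - cmx a (su V).
  rewrite emx_t /cmx /a mulmx_sumr mulmx_suml -sumrB -sumrN; apply: eq_bigr => i _.
  by rewrite DV; mxring.
apply: (@ordmx_eq0 _ _ tpred) => k; elim: k => [|k IHk]; first exact: ordmx00.
apply: (ordmx_eul_inv QR) => //; rewrite EV; apply: ordmxN.
have sV : ordmx tpred k (su V) by apply: ordmx_shift.
apply: ordmxB.
  by apply: ordmxM1l => //; apply: ord_radial.
by apply: ordmxM1r => //; apply: ord_radial.
Qed.
End TFraming.

(** * Extension of trivializations and framings along an unfolding *)

Section Fiber0.
Variables (R : idomainType).
Implicit Types d e : nat.

(** The value at t = 0, over any number of parameters: the fibers at t = 0 of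
    the source and the target of an unfolding are compared in this way. *)
Notation zmx d e := (map_mx (uext (@cst0 R d e))).

Lemma hmx_comp c d e n r (f : mseries R e -> mseries R d)
    (h : mseries R c -> mseries R e) (X : 'M_(n, r)) :
  map_mx (uext f) (map_mx (uext h) X) = map_mx (uext (f \o h)) X.
Proof. by apply/matrixP => i j; rewrite !mxE uext_comp. Qed.

Lemma eq_hmx d e n r (f h : mseries R e -> mseries R d) (X : 'M_(n, r)) :
  f =1 h -> map_mx (uext f) X = map_mx (uext h) X.
Proof. by move=> /funext->. Qed.

Lemma p0tE d n r (X : 'M_(n, r)) : p0t X = zmx d d X.
Proof. by apply/matrixP => i j; rewrite !mxE pr0_t. Qed.

Lemma zmx_hom c d e n r (f : mseries R e -> mseries R d) (X : 'M_(n, r)) :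
  cont_alg_hom f -> zmx d c (map_mx (uext f) X) = zmx e c X.
Proof.
by move=> hf; rewrite hmx_comp; apply: eq_hmx => a; rewrite /= /cst0 hom_const.
Qed.

Lemma zmx_comp c d e n r (X : 'M_(n, r)) : zmx d e (zmx c d X) = zmx c e X.
Proof. exact/zmx_hom/cst0_hom. Qed.

Lemma zmx_iso d e n r (X : 'M_(n, r)) : mx_iso X -> mx_iso (zmx d e X).
Proof. exact/hmx_iso/uext_hom/cst0_hom. Qed.

Lemma zmxM d e n r q (X : 'M_(n, r)) (Y : 'M_(r, q)) :
  zmx d e (X *m Y) = zmx d e X *m zmx d e Y.
Proof. exact/hmxM/uext_hom/cst0_hom. Qed.

Lemma zmx1 d e n : zmx d e (1%:M : 'M_n) = 1%:M.
Proof. exact/hmx1/uext_hom/cst0_hom. Qed.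

Lemma horizontal1_eq d n (c c' : connection R d n) : horizontal c c' 1%:M -> c = c'.
Proof.
move=> /horizontalE[hT hU]; apply: eq_connection => [i|].
  by have := hT i; rewrite dmx1 scaler0 add0r mul1mx mulmx1.
by have := hU; rewrite dmx1 scaler0 add0r mul1mx mulmx1.
Qed.
End Fiber0.

Notation zmx d e := (map_mx (uext (@cst0 _ d e))).

Section Extension.
Variables (R : idomainType) (QR : {rmorphism rat -> R}).

Lemma unf_res_hom d (F : Fbundle R d) (X : unfolding F) :
  cont_alg_hom (unf_restr X).
Proof. by case: (unf_mor X). Qed.

Lemma unf_horizontal d (F : Fbundle R d) (X : unfolding F) :
  horizontal F (pullback (unf_restr X) (unf_tgt X)) (unf_map X).
Proof. by case: (unf_mor X). Qed.

(** A trivialization of [F] constant along the parameters extends to the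
    target of an unfolding: it is determined by its value at t = 0, which the
    unfolding identifies with a value for the target. *)
Lemma unf_tframing d (F : Fbundle R d) (X : unfolding F) r
    (P : 'M_(r, fb_rank F)) (cF : connection R d r) :
  mx_iso P -> tframed cF -> horizontal F cF P ->
  exists P' c', [/\ mx_iso P', flat c' /\ tframed c', horizontal (unf_tgt X) c' P',
    map_mx (uext (unf_restr X)) P' *m unf_map X = P
    & pullback (unf_restr X) c' = cF].
Proof.
move=> isoP tcF hP; have [phi' phiK phi'K] := unf_map_iso X.
have isophi' : mx_iso phi' by exists (unf_map X).
have [P1 PK P1K] := isoP; have hres := unf_res_hom X.
(* The unfolding transports [P] to the fiber of the target at t = 0. *)
set e := unf_dim X in hres *; pose Q0 := P *m phi'.
have isoQ0 : mx_iso Q0 by apply: mx_isoM.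
have P00 : p0t (zmx d e Q0) = zmx d e Q0 by rewrite p0tE zmx_comp.
have [P' [c' [isoP' P'0 fc' tc' hP']]] :=
  tframing_exists QR (fb_flat (unf_tgt X)) (zmx_iso e isoQ0) P00.
exists P', c'.
have htc : tframed (pullback (unf_restr X) c') by apply: tframed_pullback.
pose G := map_mx (uext (unf_restr X)) P' *m unf_map X *m P1.
have hG : horizontal cF (pullback (unf_restr X) c') G.
  apply: horizontal_comp (horizontal_inv PK P1K hP) _.
  apply: horizontal_comp (unf_horizontal X) _.
  exact: horizontal_pullback.
have resP' : zmx d d (map_mx (uext (unf_restr X)) P') = zmx d d Q0.
  have zQ : zmx e d (zmx d e Q0) = zmx d d Q0 by apply: zmx_comp.
  by rewrite (zmx_hom _ _ hres) -zQ -P'0 p0tE zmx_comp.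
have G1 : G = 1%:M.
  apply: (tframing_unique QR tcF htc hG).
  rewrite p0tE /G !zmxM resP' -!zmxM /Q0 -(mulmxA P) phi'K mulmx1 PK.
  exact: zmx1.
split.
- exact: isoP'.
- by split.
- exact: hP'.
- by rewrite -[LHS]mulmx1 -P1K mulmxA -/G G1 mul1mx.
by apply/esym/horizontal1_eq; rewrite -G1.
Qed.

Lemma su_tincl d n r (X : 'M[mseries R d]_(n, r)) : su (map_mx (@tincl R d) X) = 0.
Proof.
by apply/matrixP => i j; rewrite !mxE -pr0_tincl shift_pr0.
Qed.

Lemma p0u_tincl d n r (X : 'M[mseries R d]_(n, r)) :
  p0u (map_mx (@tincl R d) X) = map_mx (@tincl R d) X.
Proof. by apply/matrixP => i j; rewrite !mxE pr0_tincl. Qed.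

Lemma tincl_ucoef_mx d n r (X : 'M[mseries R d.+1]_(n, r)) :
  map_mx (@tincl R d) (map_mx (ucoef 0) X) = p0u X.
Proof. by apply/matrixP => i j; rewrite !mxE tincl_ucoef0. Qed.

Lemma su_uZ d n r (X : 'M[mseries R d.+1]_(n, r)) : su (uvar R d *: X) = X.
Proof. by apply/matrixP => i j; rewrite !mxE shiftK. Qed.

(** A framing is a trivialization constant in u along the parameters for which
    the matrix in the direction of u has degree at most 1 in u. *)
Lemma framingE d (F : Fbundle R d) r (P : 'M_(r, fb_rank F)) : framing F P <->
  mx_iso P /\ exists c', [/\ horizontal F c' P, tframed c' & su (su (conn_u c')) = 0].
Proof.
split=> -[isoP].
  move=> [A [U2 [U1 hP]]]; split=> //; eexists; split; first exact: hP.
    by move=> i; apply: p0u_tincl.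
  by rewrite /= map_mxD /= su_tincl add0r su_uZ su_tincl.
move=> [[A U] [hP tc su2]]; split=> //; rewrite /= in tc su2.
exists (fun i => map_mx (ucoef 0) (A i)), (map_mx (ucoef 0) U).
exists (map_mx (ucoef 0) (su U)); rewrite tincl_ucoef_mx.
suff -> : Connection (fun i => map_mx (@tincl R d) (map_mx (ucoef 0) (A i)))
    (p0u U + uvar R d *: map_mx (@tincl R d) (map_mx (ucoef 0) (su U)))
  = Connection A U by [].
apply: eq_connection => [i|] /=; first by rewrite tincl_ucoef_mx; apply: tc.
rewrite tincl_ucoef_mx [RHS]u_decomp; congr (_ + _ *: _).
by rewrite [RHS]u_decomp su2 scaler0 addr0.
Qed.

(** The extension of the trivialization is the only candidate. Along the
    unfolding, the terms of degree at least 2 in u vanish at t = 0, hence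
    everywhere. *)
Lemma unf_framing d (F : Fbundle R d) (X : unfolding F) r (P : 'M_(r, fb_rank F)) :
  framing F P ->
  exists! P' : 'M_(r, fb_rank (unf_tgt X)),
    framing (unf_tgt X) P' /\ map_mx (uext (unf_restr X)) P' *m unf_map X = P.
Proof.
move=> /framingE[isoP [cF [hP tcF su2]]]; have hres := unf_res_hom X.
have [P' [c' [isoP' [fc' tc'] hP' resP' resc']]] := unf_tframing X isoP tcF hP.
exists P'; split.
  split=> //; apply/framingE; split=> //; exists c'; split=> //.
  apply: (framing_propagates QR fc' tc').
  have resU : map_mx (uext (unf_restr X)) (conn_u c') = conn_u cF by rewrite -resc'.
  have res0 : map_mx (uext (unf_restr X)) (su (su (conn_u c'))) = 0.
    by rewrite -!su_uext resU.
  rewrite p0tE -(zmx_hom _ _ hres) res0.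
  by apply/matrixP => i j; rewrite !mxE hom0 //; apply/uext_hom/cst0_hom.
move=> P'' [/framingE[isoP'' [c'' [hP'' tc'' _]]] resP''].
have [phi' phiK phi'K] := unf_map_iso X.
have eq0 : p0t P' = p0t P''.
  rewrite !p0tE -!(zmx_hom _ _ hres); congr (zmx _ _ _).
  by rewrite -[LHS]mulmx1 -phiK mulmxA resP' -resP'' -mulmxA phiK mulmx1.
have [P1 P'K P1K] := isoP'; pose G := P'' *m P1.
have hG : horizontal c' c'' G.
  by apply: horizontal_comp hP''; apply: horizontal_inv hP'.
have G1 : G = 1%:M.
  apply: (tframing_unique QR tc' tc'' hG).
  by rewrite /G map_mxM /= -eq0 -map_mxM P'K map_mx1.
by rewrite -[RHS]mulmx1 -P1K mulmxA -/G G1 mul1mx.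
Qed.
End Extension.

(** * Words in the generators of the algebra at the origin *)

(** Noncommutative polynomial expressions in matrices [A i] and [U]; unlike
    the elements of the generated subalgebra, they can be evaluated at any
    deformation of these matrices. *)
Inductive mexpr (R : Type) (d : nat) :=
| MVar of 'I_d
| MU
| MScalar of R
| MAdd of mexpr R d & mexpr R d
| MMul of mexpr R d & mexpr R d.
Arguments MVar {R d} i.
Arguments MU {R d}.
Arguments MScalar {R d} r.
Arguments MAdd {R d} x y.
Arguments MMul {R d} x y.

Fixpoint mev (R : Type) (S : comNzRingType) (h : R -> S) d n
    (A : 'I_d -> 'M[S]_n) (U : 'M[S]_n) (x : mexpr R d) : 'M[S]_n :=
  match x with
  | MVar i => A i
  | MU => U
  | MScalar r => (h r)%:M
  | MAdd x y => mev h A U x + mev h A U y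
  | MMul x y => mev h A U x *m mev h A U y
  end.

Section Evaluation.

Lemma mev_map (R : Type) (S S' : comNzRingType) (h : R -> S)
    (f : {rmorphism S -> S'}) d n (A : 'I_d -> 'M[S]_n) U (x : mexpr R d) :
  map_mx f (mev h A U x)
    = mev (fun r => f (h r)) (fun i => map_mx f (A i)) (map_mx f U) x.
Proof.
elim: x => //= [r|x IHx y IHy|x IHx y IHy]; first exact: map_scalar_mx.
  by rewrite map_mxD IHx IHy.
by rewrite map_mxM IHx IHy.
Qed.

Lemma eq_mev (R : Type) (S : comNzRingType) (h h' : R -> S) d n
    (A A' : 'I_d -> 'M[S]_n) U (x : mexpr R d) :
  h =1 h' -> A =1 A' -> mev h A U x = mev h' A' U x.
Proof. by move=> /funext-> /funext->. Qed.

Variables (R : comNzRingType) (N : nat).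
Local Notation series := (mseries R N).

Lemma ordmx_mev (S : pred 'I_N) k (h : R -> series) d n
    (A A' : 'I_d -> 'M[series]_n) U U' (x : mexpr R d) :
  (forall i, ordmx S k (A i - A' i)) -> ordmx S k (U - U') ->
  ordmx S k (mev h A U x - mev h A' U' x).
Proof.
move=> AA' UU'; elim: x => [i||r|x IHx y IHy|x IHx y IHy] /=.
- exact: AA'.
- exact: UU'.
- by rewrite subrr; apply: ordmx0.
- by rewrite opprD addrACA; apply: ordmxD.
exact: ordmxMB.
Qed.

Lemma ordmx_cmx_mev (S : pred 'I_N) k (h : R -> series) d n Z
    (A : 'I_d -> 'M[series]_n) U (x : mexpr R d) :
  (forall i, ordmx S k (cmx Z (A i))) -> ordmx S k (cmx Z U) ->
  ordmx S k (cmx Z (mev h A U x)).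
Proof.
move=> ZA ZU; elim: x => [i||r|x IHx y IHy|x IHx y IHy] /=.
- exact: ZA.
- exact: ZU.
- by rewrite /cmx scalar_mxC subrr; apply: ordmx0.
- by rewrite cmxDr; apply: ordmxD.
by rewrite cmxMr; apply: ordmxD; [apply: ordmxMl | apply: ordmxMr].
Qed.
End Evaluation.

Section Generation.
Variable R : idomainType.

Lemma frac_clear (a : {fraction R}) :
  exists r s : R, r != 0 /\ tofrac r * a = tofrac s.
Proof.
exists (\d_(repr a)), (\n_(repr a)); split; first exact: denom_ratioP.
rewrite -[a in LHS]reprK; set x := repr a; have dx : \d_x != 0 by exact: denom_ratioP.
rewrite !piE; apply/eqmodP; rewrite /= FracField.equivfE /FracField.mulf.
by rewrite !numden_Ratio ?mul1r ?oner_neq0 // /x !reprK mulr1.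
Qed.

(** Denominators can be cleared one operation at a time. *)
Lemma gen_frac d n (M : 'I_d -> 'M[R]_n) K T :
  gen_subalg (fun N => (exists xi, N = mu_map (fun i => map_mx (@tofrac R) (M i)) xi)
     \/ N = map_mx (@tofrac R) K) T ->
  exists r (x : mexpr R d), r != 0 /\
    tofrac r *: T = map_mx (@tofrac R) (mev id M K x).
Proof.
have QM x y (X Y : 'M_n) r s :
    tofrac r *: X = map_mx (@tofrac R) (mev id M K x) ->
    tofrac s *: Y = map_mx (@tofrac R) (mev id M K y) ->
    tofrac (r * s) *: (X *m Y) = map_mx (@tofrac R) (mev id M K (MMul x y)).
  by rewrite /= map_mxM => <- <-; rewrite rmorphM -scalerA scalemxAr scalemxAl.
have QZ x (X : 'M_n) r s : tofrac r *: X = map_mx (@tofrac R) (mev id M K x) ->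
    tofrac (s * r) *: X = map_mx (@tofrac R) (mev id M K (MMul (MScalar s) x)).
  by rewrite /= map_mxM map_scalar_mx mul_scalar_mx => <-; rewrite rmorphM scalerA.
pose Q (X : 'M_n) := exists r (x : mexpr R d), r != 0 /\
    tofrac r *: X = map_mx (@tofrac R) (mev id M K x).
have QD X Y : Q X -> Q Y -> Q (X + Y).
  move=> [r [x [r0 rx]]] [s [y [s0 sy]]]; exists (r * s).
  exists (MAdd (MMul (MScalar s) x) (MMul (MScalar r) y)); split.
    by rewrite mulf_neq0.
  rewrite [mev _ _ _ _]/= map_mxD scalerDr -(QZ _ _ _ s rx) -(QZ _ _ _ r sy).
  by rewrite (mulrC s).
elim=> {T} [T|a|X Y _ + _|X Y _ + _]; last 2 first.
- exact: QD.
- move=> [r [x [r0 rx]]] [s [y [s0 sy]]]; exists (r * s), (MMul x y).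
  by split; [rewrite mulf_neq0 | apply: QM].
- case=> [[xi ->]|->]; last by exists 1, MU; rewrite oner_neq0 rmorph1 scale1r.
  rewrite /mu_map; apply: (big_ind Q) => // [|i _].
    exists 1, (MScalar 0); rewrite oner_neq0 scaler0; split=> //.
    by rewrite /= -scalemx1 scale0r map_mx0.
  have [r [s [r0 rs]]] := frac_clear (xi i 0).
  exists r, (MMul (MScalar s) (MVar i)); split=> //.
  by rewrite /= map_mxM map_scalar_mx mul_scalar_mx scalerA rs.
have [r [s [r0 rs]]] := frac_clear a; exists r, (MScalar s); split=> //.
by rewrite scale_scalar_mx rs /= map_scalar_mx.
Qed.

Lemma gen_expr d n (M : 'I_d -> 'M[R]_n) K T :
  gen_subalg (fun N => (exists xi, N = mu_map M xi) \/ N = K) T ->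
  exists x : mexpr R d, mev id M K x = T.
Proof.
elim=> {T} [T|a|X Y _ [x <-] _ [y <-]|X Y _ [x <-] _ [y <-]].
- case=> [[xi ->]|->]; last by exists MU.
  rewrite /mu_map; apply: (big_ind (fun T => exists x : mexpr R d, mev id M K x = T)).
  + by exists (MScalar 0); rewrite /= -scalemx1 scale0r.
  + by move=> _ _ [x <-] [y <-]; exists (MAdd x y).
  by move=> i _; exists (MMul (MScalar (xi i 0)) (MVar i)); rewrite /= mul_scalar_mx.
- by exists (MScalar a).
- by exists (MAdd x y).
by exists (MMul x y).
Qed.

Lemma GC_expr d (F : Fbundle R d) v : GC F v ->
  forall l : 'I_(fb_rank F), exists x : mexpr R d,
    mev id (fiber_t F) (fiber_K F) x *m v = delta_mx l 0.
Proof.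
by move=> gc l; have [T /gen_expr[x <-] <-] := gc (delta_mx l 0); exists x.
Qed.

Lemma GC'_expr d (F : Fbundle R d) v : GC' F v ->
  forall l : 'I_(fb_rank F), exists r (x : mexpr R d), r != 0 /\
    mev id (fiber_t F) (fiber_K F) x *m v = r *: delta_mx l 0.
Proof.
move=> gc l; have [T /gen_frac[r [x [r0 rT]]] Tv] := gc (delta_mx l 0).
exists r, x; split=> //; apply/matrixP => i j; apply/eqP; rewrite -tofrac_eq.
have : map_mx (@tofrac R) (mev id (fiber_t F) (fiber_K F) x *m v)
    = map_mx (@tofrac R) (r *: delta_mx l 0).
  by rewrite map_mxM -rT -scalemxAl Tv map_mxZ map_delta_mx.
by move/(congr1 (fun X : 'M_(_, _) => X i j)); rewrite [LHS]mxE [RHS]mxE => ->.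
Qed.
End Generation.

(** * Unfolding in one more parameter *)

Section Words.
Variables (R : comNzRingType) (d e n : nat) (iota : 'I_d -> 'I_e).
Variables (v : 'cV[R]_n) (xs : 'I_n -> mexpr R d).
Local Notation series := (mseries R e.+1).
Implicit Types (A : 'I_e -> 'M[series]_n) (U : 'M[series]_n) (C : 'cV[R]_n).

Definition words A U l :=
  mev (in_alg series) (fun i => p0u (A (iota i))) (p0u U) (xs l).

(** The columns are the images of [v] under the words; this is the identity
    matrix at the origin under the condition [wgen] below. *)
Definition wmat A U : 'M[series]_n :=
  \matrix_(i, l) (words A U l *m cstmx _ v) i 0.

(** The element of the algebra generated by the [A i] and by the value of [U]
    at u = 0 that sends the cyclic vector to [C]. *)
Definition higgs A U C : 'M[series]_n :=
  \sum_l (invm (wmat A U) *m cstmx _ C) l 0 *: words A U l.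

Definition wgen A U := forall l,
  mev id (fun i => cst (A (iota i))) (cst U) (xs l) *m v = delta_mx l 0.

Lemma cst_words A U l :
  cst (words A U l) = mev id (fun i => cst (A (iota i))) (cst U) (xs l).
Proof.
rewrite /words (mev_map _ (@ms_const R e.+1)) /= cst_p0mx.
by apply: eq_mev => [r|i]; rewrite ?cst_p0mx // ms_constZ rmorph1 mulr1.
Qed.

Lemma wmat_iso A U : wgen A U -> mx_iso (wmat A U).
Proof.
move=> gen; apply: mx_iso_const1; apply/matrixP => i l.
transitivity ((cst (words A U l) *m v) i 0); last first.
  by rewrite cst_words gen !mxE eqxx andbT.
rewrite -[v in RHS](cst_cstmx e.+1) -map_mxM.
by rewrite [LHS]mxE [wmat _ _ _ _]mxE [RHS]mxE.
Qed.

Lemma higgs_v A U C : wgen A U -> higgs A U C *m cstmx _ v = cstmx _ C.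
Proof.
move=> /wmat_iso iso; set c := invm (wmat A U) *m cstmx _ C.
have -> : cstmx _ C = wmat A U *m c by rewrite mulmxA mulmx_invm // mul1mx.
rewrite mulmx_suml; apply/matrixP => i k; rewrite ord1 summxE [RHS]mxE.
apply: eq_bigr => l _; rewrite mulscalemx [LHS]mxE [in RHS]mxE mulrC.
by [].
Qed.

Lemma p0u_cstmx p q (X : 'M[R]_(p, q)) : p0u (cstmx e.+1 X) = cstmx _ X.
Proof. by apply/matrixP => i j; rewrite !mxE linearZ /= rmorph1. Qed.

Lemma p0u_words A U l : p0u (words A U l) = words A U l.
Proof.
rewrite /words (mev_map _ (pr0 uidx)) /= p0mx_id.
apply: eq_mev => [r|i]; last by rewrite p0mx_id.
by rewrite linearZ /= rmorph1.
Qed.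

Lemma p0u_higgs A U C : wgen A U -> p0u (higgs A U C) = higgs A U C.
Proof.
move=> /wmat_iso iso; have wB : p0u (wmat A U) = wmat A U.
  apply/matrixP => i l; have E : p0u (words A U l *m cstmx _ v) = words A U l *m cstmx _ v.
    by rewrite map_mxM /= p0u_words p0u_cstmx.
  have := congr1 (fun X : 'cV[series]_n => X i 0) E.
  by rewrite [LHS]mxE => E'; rewrite [LHS]mxE [RHS]mxE [X in pr0 _ X]mxE.
have cB : p0u (invm (wmat A U) *m cstmx _ C) = invm (wmat A U) *m cstmx _ C.
  by rewrite map_mxM /= (p0u_invm iso wB) p0u_cstmx.
rewrite /higgs raddf_sum; apply: eq_bigr => l _.
rewrite [LHS]map_mxZ /= p0u_words; congr (_ *: _).
have := congr1 (fun X : 'cV[series]_n => X l 0) cB.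
by rewrite [LHS]mxE.
Qed.

Lemma ordmx_higgs S k A U A' U' C : wgen A U -> wgen A' U' ->
  (forall i, ordmx S k (A i - A' i)) -> ordmx S k (U - U') ->
  ordmx S k (higgs A U C - higgs A' U' C).
Proof.
move=> /wmat_iso iso /wmat_iso iso' AA' UU'.
have ww' l : ordmx S k (words A U l - words A' U' l).
  by apply: ordmx_mev => [i|]; rewrite -map_mxB; apply: ordmx_p0.
have BB' : ordmx S k (wmat A U - wmat A' U').
  move=> i l; rewrite mxsubE [wmat A U _ _]mxE [wmat A' U' _ _]mxE -mxsubE.
  by rewrite -mulmxBl; apply: ordmxMl.
have cc' : ordmx S k (invm (wmat A U) *m cstmx _ C - invm (wmat A' U') *m cstmx _ C).
  by rewrite -mulmxBl; apply: ordmxMl; apply: ordmx_invm.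
rewrite /higgs -sumrB; apply: ordmx_sum => l _; apply: ordmxZB => //.
by have := cc' l 0; rewrite mxsubE.
Qed.

Lemma ordmx_cmx_higgs S k Z A U C :
  (forall i, ordmx S k (cmx Z (p0u (A (iota i))))) -> ordmx S k (cmx Z (p0u U)) ->
  ordmx S k (cmx Z (higgs A U C)).
Proof.
move=> ZA ZU; rewrite /higgs cmx_sumr; apply: ordmx_sum => l _.
by rewrite cmxZr; apply/ordmxZ/ordmx_cmx_mev.
Qed.
End Words.

Section CommutatorIdentities.
Variables (A : comNzRingType) (n : nat).

Lemma commutators_comm0 (x w a p y m : 'M[A]_n) :
  cmx x w + cmx p (- a - cmx a m)
  = cmx x w + cmx a y - cmx a (y + p + cmx p m) + (cmx a p + cmx a p)
    + cmx (cmx a p) m.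
Proof. mxring. Qed.

Lemma commutators_u (a x s p ds ss : 'M[A]_n) :
  - x - (cmx x s + cmx a ds) + x + (cmx x s + cmx p (- cmx a ss))
  = - cmx a (ds + cmx p ss) + cmx (cmx a p) ss.
Proof. mxring. Qed.
End CommutatorIdentities.

Section OneVariable.
Variables (R : idomainType) (QR : {rmorphism rat -> R}) (d e n : nat).
Variables (iota : 'I_d -> 'I_e) (v : 'cV[R]_n) (xs : 'I_n -> mexpr R d).
Local Notation series := (mseries R e.+1).

Local Notation pj j := (map_mx (pr0 (pred1 (tidx j)))).

Lemma pj_dt i j p q (X : 'M[series]_(p, q)) : i != j -> pj j (dt i X) = dt i (pj j X).
Proof.
by move=> ne_ij; rewrite p0mx_der //= (inj_eq (@lift_inj _ _)).
Qed.

Lemma pj_su j p q (X : 'M[series]_(p, q)) : pj j (su X) = su (pj j X).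
Proof. by rewrite p0mx_shift //= eq_sym tidx_neq0. Qed.

Section Solution.
Variables (K : pred 'I_e) (j : 'I_e).
Variables (A : 'I_e -> 'M[series]_n) (U a : 'M[series]_n).
Hypothesis nKj : ~~ K j.
Hypothesis sys0 : tsystem K (fun i => pj j (A i)) (pj j U).
Hypothesis a_free : p0u a = a.
Hypothesis A_free : forall i, K i -> p0u (A i) = A i.
Hypothesis DA : forall i, K i -> dt j (A i) = dt i a.
Hypothesis DU : dt j U = - a - cmx a (su U).
Hypothesis a_comm : forall S k Z,
  (forall i, K i -> ordmx S k (cmx Z (A i))) -> ordmx S k (cmx Z (p0u U)) ->
  ordmx S k (cmx Z a).

Let ne_Kj i : K i -> i != j.
Proof. by move=> Ki; apply: contraNneq nKj => <-. Qed.

Let rel_comm i l k : Prop := ordmx (pred1 (tidx j)) k (cmx (A i) (A l)).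
Let rel_comm0 i k : Prop := ordmx (pred1 (tidx j)) k (cmx (A i) (p0u U)).
Let rel_closed i l k : Prop :=
  ordmx (pred1 (tidx j)) k (dt i (A l) - dt l (A i)).
Let relU i := dt i U + A i + cmx (A i) (su U).
Let rel_u i k : Prop := ordmx (pred1 (tidx j)) k (relU i).

Let comm_a k : (forall i l, K i -> K l -> rel_comm i l k) ->
  (forall i, K i -> rel_comm0 i k) ->
  (forall i, K i -> ordmx (pred1 (tidx j)) k (cmx a (A i))) /\
  ordmx (pred1 (tidx j)) k (cmx a (p0u U)).
Proof.
move=> AA AU; split=> [i Ki|]; rewrite cmxC; apply/ordmxN/a_comm.
- by move=> l Kl; apply: AA.
- exact: AU.
- by move=> i Ki; rewrite cmxC; apply/ordmxN/AU.
by rewrite /cmx subrr; apply: ordmx0.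
Qed.

Let ordj_dt i k p q (X : 'M[series]_(p, q)) : K i ->
  ordmx (pred1 (tidx j)) k X -> ordmx (pred1 (tidx j)) k (dt i X).
Proof.
by move=> Ki; apply: ordmx_der; rewrite /= (inj_eq (@lift_inj _ _)) ne_Kj.
Qed.

Let ordj_su k p q (X : 'M[series]_(p, q)) :
  ordmx (pred1 (tidx j)) k X -> ordmx (pred1 (tidx j)) k (su X).
Proof. exact: ordmx_shift. Qed.

Let su_a : su a = 0.
Proof. by rewrite -a_free smx_pr0. Qed.

Let DsuU : dt j (su U) = - cmx a (su (su U)).
Proof.
rewrite -su_dt DU [su (_ - _)]smxB [su (- a)]smxN su_a oppr0 add0r.
rewrite (su_cmx _ a_free); reflexivity.
Qed.

Let DU0 : dt j (p0u U) = - a - cmx a (p0u (su U)).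
Proof.
rewrite -p0u_dt DU [p0u (_ - _)]p0mxB [p0u (- a)]p0mxN p0u_cmx.
rewrite a_free; reflexivity.
Qed.

Let relU_su i : K i -> su (relU i) = dt i (su U) + cmx (A i) (su (su U)).
Proof.
move=> Ki; rewrite /relU [su (_ + cmx _ _)]smxD [su (_ + A i)]smxD.
rewrite su_dt (su_cmx _ (A_free Ki)); have -> : su (A i) = 0.
  by rewrite -(A_free Ki) smx_pr0.
rewrite addr0; reflexivity.
Qed.

Let relU_p0 i : K i -> p0u (relU i) = dt i (p0u U) + A i + cmx (A i) (p0u (su U)).
Proof.
move=> Ki; rewrite /relU [p0u (_ + cmx _ _)]p0mxD [p0u (_ + A i)]p0mxD.
rewrite p0u_dt p0u_cmx (A_free Ki); reflexivity.
Qed.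

Let step_comm k i l : K i -> K l ->
  ordmx (pred1 (tidx j)) k (cmx a (A i)) -> ordmx (pred1 (tidx j)) k (cmx a (A l)) ->
  rel_closed i l k -> rel_comm i l k.+1.
Proof.
move=> Ki Kl aAi aAl AA; apply: (ordmx_der_inv QR).
  by rewrite p0S_cmx; apply: (ts_comm sys0).
rewrite dt_cmx (DA Ki) (DA Kl).
have -> : cmx (dt i a) (A l) + cmx (A i) (dt l a)
    = dt i (cmx a (A l)) - dt l (cmx a (A i)) - cmx a (dt i (A l) - dt l (A i)).
  by rewrite !dt_cmx; mxring.
apply: ordmxB; last exact: ordmx_cmxr.
by apply: ordmxB; apply: ordj_dt.
Qed.

Let step_comm0 k i : K i -> ordmx (pred1 (tidx j)) k (cmx a (A i)) ->
  ordmx (pred1 (tidx j)) k (cmx a (p0u U)) -> rel_u i k -> rel_comm0 i k.+1.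
Proof.
move=> Ki aAi aU0 rU; apply: (ordmx_der_inv QR).
  by rewrite p0S_cmx p0mxC; apply: (ts_comm0 sys0).
rewrite dt_cmx (DA Ki) DU0.
have -> : cmx (dt i a) (p0u U) + cmx (A i) (- a - cmx a (p0u (su U)))
    = dt i (cmx a (p0u U)) - cmx a (p0u (relU i))
      + (cmx a (A i) + cmx a (A i)) + cmx (cmx a (A i)) (p0u (su U)).
  by rewrite (relU_p0 Ki) dt_cmx; apply: commutators_comm0.
apply: ordmxD; last exact: ordmx_cmxl.
apply: ordmxD; last exact: ordmxD.
by apply: ordmxB; [apply: ordj_dt | apply/ordmx_cmxr/ordmx_p0].
Qed.

Let closed i l : K i -> K l -> dt i (A l) = dt l (A i).
Proof.
move=> Ki Kl; apply: (dmx_eq QR (i := tidx j)).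
  by rewrite !pj_dt ?ne_Kj //; apply: (ts_closed sys0).
rewrite dmxC (DA Kl) [RHS]dmxC (DA Ki); exact: dmxC.
Qed.

Let step_u k i : K i -> ordmx (pred1 (tidx j)) k (cmx a (A i)) ->
  rel_u i k -> rel_u i k.+1.
Proof.
move=> Ki aAi rU; apply: (ordmx_der_inv QR).
  rewrite /relU [pj j (_ + cmx _ _)]p0mxD [pj j (_ + A i)]p0mxD.
  rewrite p0S_cmx pj_su pj_dt ?ne_Kj //; exact: (ts_u sys0).
rewrite /relU [dt j (_ + cmx _ _)]dmxD [dt j (_ + A i)]dmxD.
rewrite (dmxC (tidx j) (tidx i)) DU dt_cmx (DA Ki) DsuU.
have -> : dt i (- a - cmx a (su U)) = - dt i a - (cmx (dt i a) (su U) + cmx a (dt i (su U))).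
  rewrite dmxB dmxN dt_cmx; reflexivity.
have -> : - dt i a - (cmx (dt i a) (su U) + cmx a (dt i (su U))) + dt i a
   + (cmx (dt i a) (su U) + cmx (A i) (- cmx a (su (su U))))
   = - cmx a (su (relU i)) + cmx (cmx a (A i)) (su (su U)).
  by rewrite (relU_su Ki); apply: commutators_u.
apply: ordmxD; last exact: ordmx_cmxl.
by apply/ordmxN/ordmx_cmxr/ordj_su.
Qed.

Let relations k : [/\ forall i l, K i -> K l -> rel_comm i l k,
   forall i, K i -> rel_comm0 i k & forall i, K i -> rel_u i k].
Proof.
elim: k => [|k [IHc IH0 IHu]]; first by split=> *; apply: ordmx00.
have [aA aU] := comm_a IHc IH0; split=> [i l Ki Kl|i Ki|i Ki].
- apply: (step_comm Ki Kl (aA _ Ki) (aA _ Kl)).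
  by rewrite /rel_closed (closed Ki Kl) subrr; apply: ordmx0.
- exact: (step_comm0 Ki (aA _ Ki) aU (IHu _ Ki)).
exact: (step_u Ki (aA _ Ki) (IHu _ Ki)).
Qed.

(** Solving the equations in the direction of the new parameter preserves all
    the structure equations in the old directions, because their derivatives
    belong to the ideal that they generate. *)
Lemma tsystem_extend :
  tsystem (fun i => K i || (i == j)) (fun i => if i == j then a else A i) U.
Proof.
have AA i l : K i -> K l -> cmx (A i) (A l) = 0.
  move=> Ki Kl; apply: (@ordmx_eq0 _ _ (pred1 (tidx j))) => k.
  by have [+ _ _] := relations k; apply.
have AU i : K i -> cmx (A i) (p0u U) = 0.
  move=> Ki; apply: (@ordmx_eq0 _ _ (pred1 (tidx j))) => k.
  by have [_ + _] := relations k; apply.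
have rU i : K i -> relU i = 0.
  move=> Ki; apply: (@ordmx_eq0 _ _ (pred1 (tidx j))) => k.
  by have [_ _ +] := relations k; apply.
have aA i : K i -> cmx a (A i) = 0.
  move=> Ki; apply: (@ordmx_eq0 _ _ (pred1 (tidx j))) => k.
  have [h1 h2 _] := relations k; have [+ _] := comm_a h1 h2; exact.
have aU : cmx a (p0u U) = 0.
  apply: (@ordmx_eq0 _ _ (pred1 (tidx j))) => k.
  by have [h1 h2 _] := relations k; have [_ +] := comm_a h1 h2.
split.
- by move=> i; case: (i =P j) => [_ _|_]; [exact: a_free | rewrite orbF; apply: A_free].
- move=> i l; case: (i =P j) => [_|_]; case: (l =P j) => [_|_]; rewrite ?orbF.
  + by move=> _ _; rewrite /cmx subrr.
  + by move=> _ Kl; apply: aA.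
  + by move=> Ki _; rewrite cmxC (aA i Ki) oppr0.
  + exact: AA.
- by move=> i; case: (i =P j) => [_ _|_]; [exact: aU | rewrite orbF; apply: AU].
- move=> i l; case: (i =P j) => [->|_]; case: (l =P j) => [->|_]; rewrite ?orbF.
  + by [].
  + by move=> _ Kl; apply: DA.
  + by move=> Ki _; rewrite (DA Ki).
  + exact: closed.
move=> i; case: (i =P j) => [-> _|_]; last by rewrite orbF; apply: rU.
by rewrite DU; mxring.
Qed.
End Solution.

(** Let a be the element of the algebra generated by the [A i] and U_0 that
    sends the cyclic vector to [C]. The deformation is the solution of
    D_j A_i = D_i a and D_j U = - a - [a, sh U] with the given value at t_j = 0;
    it exists because the right-hand sides are determined, to each order in
    t_j, by the unknowns to the same order. *)
Lemma one_variable (K : pred 'I_e) (j : 'I_e) A U (C : 'cV[R]_n) :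
  tsystem K A U -> (forall i, K (iota i)) -> ~~ K j -> wgen iota v xs A U ->
  exists A' U', [/\ tsystem (fun i => K i || (i == j)) A' U',
    forall i, i != j -> pj j (A' i) = pj j (A i), pj j U' = pj j U
    & cst (A' j) *m v = C].
Proof.
move=> sys Kiota nKj gen.
have ne_Kj i : K i -> i != j by move=> Ki; apply: contraNneq nKj => <-.
pose X0 (t : option 'I_e) : 'M[series]_n := if t is Some i then A i else U.
pose hA (X : option 'I_e -> 'M[series]_n) i := X (Some i).
pose a X := higgs iota v xs (hA X) (X None) C.
(* The matrices outside [K] are kept constant in the new parameter. *)
pose Phi (X : option 'I_e -> 'M[series]_n) (t : option 'I_e) : 'M[series]_n :=
  if t is Some i then if K i then tvar j *: dt i (a X) else 0
  else tvar j *: (- a X - cmx (a X) (su (X None))).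
have domgen X : (forall t, pj j (X t) = pj j (X0 t)) -> wgen iota v xs (hA X) (X None).
  move=> domX l; rewrite -(gen l); congr (_ *m v).
  rewrite -(cst_p0mx (pred1 (tidx j)) (X None)) (domX None) cst_p0mx.
  apply: eq_mev => // i.
  by rewrite -(cst_p0mx (pred1 (tidx j)) (hA X _)) (domX (Some _)) cst_p0mx.
have Sj : pred1 (tidx j) (tidx j) by rewrite /= eqxx.
have [| |X domX defX] := @radial_ode R QR _ (pred1 (tidx j)) _ n n X0 Phi.
- move=> X domX [i|]; rewrite /Phi; last by apply: ordmx_var => //; apply: ordmx00.
  by case: (K i); [apply: ordmx_var => //; apply: ordmx00 | apply: ordmx0].
- move=> k X Y domX domY XY.
  have aXY : ordmx (pred1 (tidx j)) k (a X - a Y).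
    apply: ordmx_higgs; [exact: domgen | exact: domgen | move=> i; exact: XY | exact: XY].
  case=> [i|]; rewrite /Phi.
    case Ki: (K i); last by rewrite subrr; apply: ordmx0.
    rewrite -scalerBr; apply: ordmx_var => //; rewrite -map_mxB.
    by apply: ordmx_der => //; rewrite /= (inj_eq (@lift_inj _ _)) ne_Kj.
  rewrite -scalerBr; apply: ordmx_var => //.
  have -> : - a X - cmx (a X) (su (X None)) - (- a Y - cmx (a Y) (su (Y None)))
    = - (a X - a Y) - (cmx (a X) (su (X None)) - cmx (a Y) (su (Y None))) by mxring.
  apply: ordmxB; first exact: ordmxN.
  apply: ordmx_cmx => //; rewrite -map_mxB; by apply: ordmx_shift; last exact: XY.
have genX := domgen X domX.
have a_free : p0u (a X) = a X by apply: p0u_higgs.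
have DA i : K i -> dt j (X (Some i)) = dt i (a X).
  move=> Ki; apply: (@scale_var_inj _ _ (tidx j)).
  by rewrite -emx_pred1 defX /Phi Ki.
have DU : dt j (X None) = - a X - cmx (a X) (su (X None)).
  by apply: (@scale_var_inj _ _ (tidx j)); rewrite -emx_pred1 defX.
have A_free i : K i -> p0u (X (Some i)) = X (Some i).
  move=> Ki; apply: (dmx_eq QR (i := tidx j)).
    by rewrite p0mxC (domX (Some i)) p0mxC (ts_free sys Ki).
  by rewrite -p0u_dt (DA _ Ki) p0u_dt a_free.
have sys0 : tsystem K (fun i => pj j (X (Some i))) (pj j (X None)).
  have EX i : pj j (X (Some i)) = pj j (A i) by apply: (domX (Some i)).
  have EU : pj j (X None) = pj j U by apply: (domX None).
  split.
  - by move=> i Ki; rewrite EX p0mxC (ts_free sys Ki).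
  - by move=> i l Ki Kl; rewrite !EX -p0S_cmx (ts_comm sys Ki Kl) map_mx0.
  - by move=> i Ki; rewrite EX EU p0mxC -p0S_cmx (ts_comm0 sys Ki) map_mx0.
  - move=> i l Ki Kl; rewrite !EX -(pj_dt _ (ne_Kj _ Ki)) -(pj_dt _ (ne_Kj _ Kl)).
    by rewrite (ts_closed sys Ki Kl).
  move=> i Ki; rewrite EX EU -pj_su -p0S_cmx -(pj_dt _ (ne_Kj _ Ki)) -p0mxD.
  by rewrite -p0mxD (ts_u sys Ki) map_mx0.
exists (fun i => if i == j then a X else X (Some i)), (X None); split.
- apply: (tsystem_extend nKj sys0 a_free A_free DA DU) => S k Z ZA ZU.
  apply: ordmx_cmx_higgs; last exact: ZU.
  by move=> i; rewrite /hA (A_free _ (Kiota i)); apply: ZA (Kiota i).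
- by move=> i /negPf ne_ij; rewrite ne_ij; apply: (domX (Some i)).
- exact: (domX None).
rewrite eqxx -[v](cst_cstmx e.+1) -map_mxM (higgs_v _ genX).
exact: cst_cstmx.
Qed.
End OneVariable.

(** * Existence of a maximal unfolding *)

Section ManyVariables.
Variables (R : idomainType) (QR : {rmorphism rat -> R}) (d e n : nat).
Variables (iota : 'I_d -> 'I_e) (iota_inj : injective iota).
Variables (v : 'cV[R]_n) (xs : 'I_n -> mexpr R d) (C : 'I_e -> 'cV[R]_n).
Local Notation res := (map_mx (uext (restr iota))).

Lemma res_pj j p q (X Y : 'M[mseries R e.+1]_(p, q)) : j \notin codom iota ->
  map_mx (pr0 (pred1 (tidx j))) X = map_mx (pr0 (pred1 (tidx j))) Y -> res X = res Y.
Proof.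
move=> jN; have sub : {subset pred1 (tidx j) <= ypred iota}.
  by move=> k /eqP ->; rewrite -[_ \in _]/(ypred iota (tidx j)) ypred_t.
have resE Z : res (map_mx (pr0 (pred1 (tidx j))) Z) = res Z :> 'M_(p, q).
  by apply/matrixP => i k; rewrite !mxE uext_restr_pr0.
by move=> eqXY; rewrite -resE eqXY resE.
Qed.

Lemma cst_pj j p q (X Y : 'M[mseries R e.+1]_(p, q)) :
  map_mx (pr0 (pred1 (tidx j))) X = map_mx (pr0 (pred1 (tidx j))) Y ->
  cst X = cst Y.
Proof. by move=> eqXY; rewrite -(cst_p0mx (pred1 (tidx j)) X) eqXY cst_p0mx. Qed.

Lemma many_variables (s : seq 'I_e) (K : pred 'I_e) A U :
  uniq s -> (forall j, j \in s -> ~~ K j) ->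
  tsystem K A U -> (forall i, K (iota i)) -> wgen iota v xs A U ->
  exists A' U', [/\ tsystem (fun i => K i || (i \in s)) A' U',
    forall i, i \notin s -> res (A' i) = res (A i) /\ cst (A' i) = cst (A i),
    res U' = res U
    & forall i, i \in s -> cst (A' i) *m v = C i].
Proof.
elim: s K A U => [|j s IHs] K A U.
  move=> _ _ sys _ _; exists A, U; split=> //.
  by rewrite (_ : (fun i => _) = K) //; apply/funext => i; rewrite in_nil orbF.
rewrite cons_uniq => /andP[js us] sK sys Kiota gen.
have nKj : ~~ K j by apply: sK; rewrite mem_head.
have jN : j \notin codom iota.
  by apply/negP => /codomP[i def_j]; rewrite def_j Kiota in nKj.
have [A1 [U1 [sys1 eqA1 eqU1 A1j]]] := one_variable QR (C j) sys Kiota nKj gen.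
have gen1 : wgen iota v xs A1 U1.
  move=> l; rewrite -(gen l) (cst_pj eqU1); congr (_ *m v).
  apply: eq_mev => // i; apply/(@cst_pj j)/eqA1.
  by apply: contraNneq jN => <-; apply: codom_f.
have [|i|A2 [U2 [sys2 eqA2 eqU2 A2s]]] := IHs _ _ _ us _ sys1 _ gen1.
- move=> i si; rewrite negb_or sK ?in_cons ?si ?orbT //=.
  by apply: contraNneq js => <-.
- by rewrite Kiota.
exists A2, U2; split.
- rewrite (_ : (fun i => _) = (fun i => (K i || (i == j)) || (i \in s))) //.
  by apply/funext => i; rewrite in_cons orbA.
- move=> i; rewrite in_cons negb_or => /andP[ne_ij si].
  have [-> ->] := eqA2 _ si; split; first exact/(res_pj jN)/eqA1.
  exact/(@cst_pj j)/eqA1.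
- by rewrite eqU2; apply: (res_pj jN).
move=> i; rewrite in_cons => /predU1P[->|]; last exact: A2s.
by have [_ ->] := eqA2 _ js.
Qed.
End ManyVariables.

Section Fibers.
Variables (R : idomainType) (QR : {rmorphism rat -> R}).

Lemma cst_uZ d n r (X : 'M[mseries R d.+1]_(n, r)) k : cst (uvar R d ^+ k.+1 *: X) = 0.
Proof.
apply/matrixP => i j; rewrite !mxE rmorphM rmorphXn /=.
have -> : ms_const (uvar R d) = 0.
  by rewrite -(ms_const_pr0 uidx) pr0_var /= raddf0.
by rewrite expr0n mul0r.
Qed.

(** At the origin, where u = 0, horizontal maps intertwine the matrices. *)
Lemma cst_conj d n r (c : connection R d n) (c' : connection R d r) P :
  horizontal c c' P ->
  (forall i, cst P *m cst (conn_t c i) = cst (conn_t c' i) *m cst P) /\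
  cst P *m cst (conn_u c) = cst (conn_u c') *m cst P.
Proof.
move=> /horizontalE[hT hU]; split=> [i|].
  rewrite -!map_mxM hT map_mxD /=.
  by rewrite -[uvar R d]expr1 cst_uZ add0r.
by rewrite -!map_mxM hU map_mxD /= cst_uZ add0r.
Qed.

Lemma cst_uext d e n r (f : mseries R e -> mseries R d) (X : 'M_(n, r)) :
  cont_alg_hom f -> cst (map_mx (uext f) X) = cst X.
Proof.
by move=> hf; apply/matrixP => i j; rewrite !mxE hom_const //; apply: uext_hom.
Qed.
End Fibers.

Section Existence.
Variables (R : idomainType) (QR : {rmorphism rat -> R}).

Lemma mu_vE d (F : Fbundle R d) v xi :
  mu_v F v xi = \sum_(i < d) xi i 0 *: (fiber_t F i *m v).
Proof.
by rewrite /mu_v /mu_map mulmx_suml; apply: eq_bigr => i _; rewrite -scalemxAl.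
Qed.

Lemma inj_surj_bij (A B : Type) (f : A -> B) :
  injective f -> (forall y, exists x, f x = y) -> bijective f.
Proof.
move=> f_inj f_surj; pose g y := projT1 (cid (f_surj y)).
have fg y : f (g y) = y by rewrite /g; case: cid.
by exists g => [x|//]; apply: f_inj; rewrite fg.
Qed.

(** One parameter is added for each vector of a basis of a complement of the
    image of [mu_v], and the cyclic vector is sent to this basis vector by the
    matrix in the direction of the new parameter. *)
Lemma max_unfolding d (F : Fbundle R d) (v : 'cV[R]_(fb_rank F)) :
  IC F v -> GC F v -> free_coker (mu_v F v) ->
  exists X : unfolding F, maximal (unf_tgt X) /\
    cyclic_vector (unf_tgt X) (induced_vector X v).
Proof.
move=> ic gc [k [C cokerC]]; set n := fb_rank F in v C ic gc cokerC *.
have iso1 : mx_iso (1%:M : 'M[mseries R d.+1]_n) by exists 1%:M; rewrite mulmx1.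
have [|P [c [isoP P0 fc tc hP]]] := tframing_exists QR (fb_flat F) iso1.
  exact: map_mx1.
have P1 : cst P = 1%:M by rewrite -p0t_cst P0 map_mx1.
have [fibT fibU] := cst_conj hP; rewrite P1 in fibT fibU.
(* The fibers of F and of its trivialization are identified by [P], which is 1
   at the origin. *)
have cT i : fiber_t F i = cst (conn_t c i).
  by have := fibT i; rewrite mul1mx mulmx1.
have cU : fiber_K F = cst (conn_u c) by move: fibU; rewrite mul1mx mulmx1.
pose iota : 'I_d -> 'I_(d + k) := lshift k.
have iota_inj : injective iota := @lshift_inj d k.
have rsh_out i : rshift d i \notin codom iota.
  apply/negP => /codomP[i' /(congr1 (@nat_of_ord _)) /= eq_i].
  by have := ltn_ord i'; rewrite -eq_i ltnNge leq_addr.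
pose inc := subst (fun i => ms_var R (iota i)).
have hinc : cont_alg_hom inc by apply: subst_hom => i; apply: ordw_var.
have inc_var i : inc (ms_var R i) = ms_var R (iota i).
  by rewrite /inc subst_var // => j; apply: ordw_var.
have hres := restr_hom R iota_inj.
have res_inc p q (X : 'M_(p, q)) :
    map_mx (uext (restr iota)) (map_mx (uext inc) X) = X.
  rewrite hmx_comp; apply/matrixP => i j; rewrite mxE -[RHS]uext_id.
  apply: eq_uext => a; apply: (cont_hom_ext (cont_hom_comp hres hinc)) => [|l].
    exact: cont_hom_id.
  by rewrite /= inc_var restr_var.
have dt_inc i p q (X : 'M_(p, q)) :
    dt (iota i) (map_mx (uext inc) X) = map_mx (uext inc) (dt i X).
  rewrite dt_uext // (bigD1 i) //= inc_var ms_der_var eqxx (hom1 (tincl_hom _ _)).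
  rewrite scale1r big1 ?addr0 // => j ne_ji.
  rewrite inc_var ms_der_var (inj_eq iota_inj) eq_sym (negPf ne_ji).
  by rewrite (hom0 (tincl_hom _ _)) scale0r.
have cmx_inc X Y : cmx (map_mx (uext inc) X) (map_mx (uext inc) Y)
    = map_mx (uext inc) (cmx X Y) :> 'M_n.
  by rewrite /cmx (hmxB (uext_hom hinc)) !(hmxM (uext_hom hinc)).
(* In the new directions the initial matrices are placeholders, since the
   system only bears on the old ones. *)
pose A0 (i : 'I_(d + k)) : 'M[mseries R (d + k).+1]_n :=
  if split i is inl i' then map_mx (uext inc) (conn_t c i') else 0.
have A0E i : A0 (iota i) = map_mx (uext inc) (conn_t c i).
  by rewrite /A0 (unsplitK (inl i)).
pose U0 := map_mx (uext inc) (conn_u c).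
have [_ AA AU DA DU] := (flat_tsystem tc).1 fc.
have sys0 : tsystem (fun i => i \in codom iota) A0 U0.
  split.
  - by move=> _ /codomP[i ->]; rewrite A0E (p0u_uext hinc) (tc i); reflexivity.
  - move=> _ _ /codomP[i ->] /codomP[j ->].
    by rewrite !A0E cmx_inc (AA i j) // hmx0 //; apply: uext_hom.
  - move=> _ /codomP[i ->]; rewrite A0E /U0 p0u_uext // cmx_inc (AU i) // hmx0 //.
    exact: uext_hom.
  - move=> _ _ /codomP[i ->] /codomP[j ->]; rewrite !A0E.
    rewrite (dt_inc i) (dt_inc j) (DA i j isT isT); reflexivity.
  move=> _ /codomP[i ->]; rewrite A0E /U0 dt_inc su_uext cmx_inc.
  rewrite -!(hmxD (uext_hom hinc)) (DU i) // hmx0 //; exact: uext_hom.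
have [xs xsP] : exists xs : 'I_n -> mexpr R d,
    forall l, mev id (fiber_t F) (fiber_K F) (xs l) *m v = delta_mx l 0.
  have gcx := GC_expr gc; exists (fun l => projT1 (cid (gcx l))) => l.
  by case: cid.
have gen0 : wgen iota v xs A0 U0.
  move=> l; rewrite -(xsP l) /U0 cst_uext // -cU; congr (_ *m v).
  by apply: eq_mev => // i; rewrite A0E cst_uext // cT.
pose D (j : 'I_(d + k)) : 'cV[R]_n := if split j is inr j' then col j' C else 0.
have DE j : D (rshift d j) = col j C by rewrite /D (unsplitK (inr j)).
pose s := [seq rshift d j | j <- enum 'I_k].
have sP i : (i \in s) = (i \notin codom iota).
  apply/mapP/idP => [[j _ ->]|]; first exact: rsh_out.
  case: (split_ordP i) => j ->; first by rewrite codom_f.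
  by move=> _; exists j; rewrite ?mem_enum.
(* The new parameters are added one after the other. *)
have [||i|A [U [sys eqA eqU As]]] :=
  @many_variables R QR d (d + k) n iota v xs D s (fun i => i \in codom iota) A0 U0 _ _ sys0 _ gen0.
- by rewrite map_inj_uniq ?enum_uniq //; apply: rshift_inj.
- by move=> j; rewrite sP.
- exact: codom_f.
have {}sys : tsystem xpredT A U.
  rewrite (_ : xpredT = fun i => (i \in codom iota) || (i \in s)) //.
  by apply/funext => i; rewrite sP orbN.
pose c' := Connection A U.
have tc' : tframed c' by move=> i; apply: (ts_free sys).
have fc' : flat c' by apply/(flat_tsystem tc').
have in_s i : iota i \notin s by rewrite sP negbK codom_f.
have resc' : pullback (restr iota) c' = c.
  apply: eq_connection => [i|] /=; last by rewrite eqU res_inc.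
  rewrite (sum_restr_var iota_inj (fun j => map_mx (uext (restr iota)) (A j))).
  by have [-> _] := eqA _ (in_s i); rewrite A0E res_inc.
pose F' := FBundle fc'.
have mor : @Fmorphism R d (d + k) F F' (restr iota) P.
  by split; [exact: hres | rewrite /= resc'; exact: hP].
pose X := @Unfolding R d F (d + k) iota iota_inj F' P mor isoP.
suff cyc : cyclic_vector (unf_tgt X) (induced_vector X v).
  by exists X; split=> //; exists (induced_vector X v).
have -> : induced_vector X v = v by rewrite /induced_vector /= P1 mul1mx.
have muE (xi : 'cV[R]_(d + k)) :
    mu_v F' v xi = C *m dsubmx xi + mu_v F v (usubmx xi).
  rewrite !mu_vE big_split_ord [LHS]addrC; congr (_ + _).
    apply/matrixP => i j; rewrite summxE mxE; apply: eq_bigr => l _.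
    rewrite /fiber_t /= (As (rshift d l)); last by rewrite sP rsh_out.
    by rewrite DE !mxE ord1 mulrC.
  apply: eq_bigr => i _; rewrite mxE cT /fiber_t /=.
  by have [_ ->] := eqA _ (in_s i); rewrite A0E cst_uext.
apply: inj_surj_bij => [xi xi'|w].
  rewrite !muE => eq_mu.
  have [a [_ aP]] := cokerC (C *m dsubmx xi + mu_v F v (usubmx xi)).
  have eqd : dsubmx xi = dsubmx xi'.
    rewrite -(aP (dsubmx xi)); last by exists (usubmx xi).
    by apply: aP; exists (usubmx xi').
  move: eq_mu; rewrite eqd => /addrI/ic equ.
  by rewrite -[xi]vsubmxK -[xi']vsubmxK eqd equ.
have [a [[xi defw] _]] := cokerC w; exists (col_mx xi a).
by rewrite muE col_mxKu col_mxKd -defw.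
Qed.
End Existence.

(** * Uniqueness of maximal unfoldings *)

Section Rigidity.
Variables (R : idomainType) (QR : {rmorphism rat -> R}) (d e n : nat).
Variables (iota : 'I_d -> 'I_e) (iota_inj : injective iota) (v : 'cV[R]_n).
Local Notation series := (mseries R e.+1).
Local Notation Y := (ypred iota).

Variables (A A' : 'I_e -> 'M[series]_n) (U U' : 'M[series]_n).
Hypotheses (sys : tsystem xpredT A U) (sys' : tsystem xpredT A' U').
Hypothesis eq_v : forall i, A i *m cstmx _ v = A' i *m cstmx _ v.
Hypothesis eq_A0 : forall i, map_mx (pr0 Y) (A (iota i)) = map_mx (pr0 Y) (A' (iota i)).
Hypothesis eq_U0 : map_mx (pr0 Y) U = map_mx (pr0 Y) U'.
Hypothesis gen : forall l, exists r (x : mexpr R d), r != 0 /\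
  mev id (fun i => cst (A (iota i))) (cst U) x *m v = r *: delta_mx l 0.

Lemma cmx_difference (S : comNzRingType) (X X' Z Z' : 'M[S]_n) :
  cmx X Z = 0 -> cmx X' Z' = 0 -> cmx (X - X') Z = - cmx X' (Z - Z').
Proof.
move=> XZ XZ'; have -> : cmx (X - X') Z = cmx X Z - cmx X' Z' - cmx X' (Z - Z').
  by mxring.
by rewrite XZ XZ' subrr sub0r.
Qed.

Let ord_new k : (forall i, ordmx Y k (A (iota i) - A' (iota i))) ->
  ordmx Y k (U - U') -> forall j, ordmx Y k (A j - A' j).
Proof.
move=> AA UU j; set D := A j - A' j.
have Dv : D *m cstmx _ v = 0 by rewrite mulmxBl eq_v subrr.
have DA i : ordmx Y k (cmx D (A (iota i))).
  rewrite (cmx_difference (ts_comm sys (i := j) (j := iota i) isT isT)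
    (ts_comm sys' (i := j) (j := iota i) isT isT)).
  exact/ordmxN/ordmx_cmxr.
have DU : ordmx Y k (cmx D (p0u U)).
  rewrite (cmx_difference (ts_comm0 sys (i := j) isT) (ts_comm0 sys' (i := j) isT)).
  by apply/ordmxN/ordmx_cmxr; rewrite -p0mxB; apply: ordmx_p0.
pose r l := projT1 (cid (gen l)); pose x l := projT1 (cid (projT2 (cid (gen l)))).
have rx l : r l != 0 /\
    mev id (fun i => cst (A (iota i))) (cst U) (x l) *m v = r l *: delta_mx l 0.
  exact: projT2 (cid (projT2 (cid (gen l)))).
pose w l := mev (in_alg series) (fun i => A (iota i)) (p0u U) (x l) *m cstmx _ v.
apply: (@ordmx_nondegenerate _ _ _ _ _ _ w r) => l.
- by have [] := rx l.
- have [_ <-] := rx l; rewrite map_mxM cst_cstmx (mev_map _ (@ms_const R e.+1)) /=.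
  rewrite cst_p0mx; congr (_ *m v); apply: eq_mev => // q.
  by rewrite ms_constZ rmorph1 mulr1.
rewrite /w mulmxA; set W := mev _ _ _ _.
have -> : D *m W *m cstmx _ v = W *m (D *m cstmx _ v) + cmx D W *m cstmx _ v.
  by mxring.
by rewrite Dv mulmx0 add0r; apply/ordmxMl/ordmx_cmx_mev.
Qed.

Let Y_t i : ~~ Y (tidx (iota i)).
Proof. by rewrite ypred_t negbK codom_f. Qed.

Let Y_0 : ~~ Y ord0.
Proof. by rewrite ypred0. Qed.

Let emx_Y p q (X : 'M[series]_(p, q)) k :
  (forall j, ordmx Y k (dt j X)) -> ordmx Y k.+1 (map_mx (eul Y) X).
Proof.
move=> DX; rewrite emxE; apply: ordmx_sum => i Yi.
apply: ordmx_var; first exact: Yi.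
by case: (unliftP ord0 i) Yi => [j ->|->]; [move=> _; apply: DX | rewrite ypred0].
Qed.

Let agree k : (forall i, ordmx Y k (A (iota i) - A' (iota i))) /\ ordmx Y k (U - U').
Proof.
elim: k => [|k [IHA IHU]]; first by split=> *; apply: ordmx00.
have new := ord_new IHA IHU; split=> [i|]; apply: (ordmx_eul_inv QR).
- by rewrite p0mxB eq_A0 subrr.
- apply: emx_Y => j; rewrite dmxB (ts_closed sys (i := j) (j := iota i) isT isT).
  rewrite (ts_closed sys' (i := j) (j := iota i) isT isT) -dmxB.
  by apply: ordmx_der; [exact: Y_t | exact: new].
- by rewrite p0mxB eq_U0 subrr.
apply: emx_Y => j; have DU := ts_u sys (i := j) isT; have DU' := ts_u sys' (i := j) isT.
have -> : dt j (U - U') = - (A j - A' j) - (cmx (A j) (su U) - cmx (A' j) (su U')).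
  rewrite dmxB; have -> : dt j U = dt j U + A j + cmx (A j) (su U)
    - A j - cmx (A j) (su U) by mxring.
  have -> : dt j U' = dt j U' + A' j + cmx (A' j) (su U')
    - A' j - cmx (A' j) (su U') by mxring.
  by rewrite DU DU'; mxring.
apply: ordmxB; first exact/ordmxN/new.
apply: ordmx_cmx; first exact: new.
by rewrite -smxB; apply: (ordmx_shift Y_0).
Qed.

(** The extension of the connection to new parameters is determined by the
    images of the cyclic vector: in the new directions the matrices commute
    with the generators, so they are determined by the value at this vector. *)
Lemma tsystem_unique : (forall i, A i = A' i) /\ U = U'.
Proof.
split=> [j|]; apply: (@ordmx_eq _ _ Y) => k; have [AA UU] := agree k; last exact: UU.
exact: ord_new.
Qed.
End Rigidity.

Section Potentials.
Variables (R : idomainType) (QR : {rmorphism rat -> R}) (n : nat) (v : 'cV[R]_n).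

(** A primitive of the images of the cyclic vector under the connection
    matrices; when the vector is cyclic it is a system of coordinates. *)
Definition potential e (c : connection R e n) (psi : 'I_n -> mseries R e) :=
  (forall l, ms_const (psi l) = 0) /\
  forall i l, tincl (ms_der i (psi l)) = (conn_t c i *m cstmx _ v) l 0.

Lemma flat_potential e (c : connection R e n) : flat c -> tframed c ->
  exists psi, potential c psi.
Proof.
move=> /flat_tsystem fc tc; have {fc} sys := fc tc.
have [b bE] : exists b : 'I_e -> 'I_n -> mseries R e,
    forall i l, tincl (b i l) = (conn_t c i *m cstmx _ v) l 0.
  exists (fun i l => ucoef 0 ((conn_t c i *m cstmx _ v) l 0)) => i l.
  rewrite tincl_ucoef0.
  have E : p0u (conn_t c i *m cstmx _ v) = conn_t c i *m cstmx _ v.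
    by rewrite map_mxM /= tc p0u_cstmx.
  by have := congr1 (fun X : 'cV_n => X l 0) E; rewrite [LHS]mxE.
have dv i : dt i (cstmx e.+1 v) = 0.
  apply/matrixP => p q; rewrite !mxE linearZ /= ms_der1.
  exact: scaler0.
have b_closed l i j : ms_der i (b j l) = ms_der j (b i l).
  apply: (@tincl_inj R e); rewrite -(tincl_der i (b j l)) -(tincl_der j (b i l)) (bE j l) (bE i l).
  have E : dt i (conn_t c j *m cstmx _ v) = dt j (conn_t c i *m cstmx _ v).
    rewrite [LHS]dmxM [RHS]dmxM !dv !mulmx0 !addr0.
    by rewrite (ts_closed sys (i := i) (j := j) isT isT).
  by have := congr1 (fun X : 'cV_n => X l 0) E; rewrite [LHS]mxE [RHS]mxE.
have pot l := potential_exists QR (b_closed l).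
exists (fun l => s2val (cid2 (pot l))); split=> [l|i l]; case: cid2 => //= psi _ ->.
exact: bE.
Qed.

Lemma eq_potential e (c : connection R e n) psi psi' :
  potential c psi -> potential c psi' -> psi =1 psi'.
Proof.
move=> [p0 pD] [p0' pD'] l; apply: (potential_unique QR); first by rewrite p0 p0'.
by move=> i; apply: (@tincl_inj R e); rewrite pD pD'.
Qed.

Lemma uext_cstmx d e (f : mseries R e -> mseries R d) p q (X : 'M[R]_(p, q)) :
  cont_alg_hom f -> map_mx (uext f) (cstmx _ X) = cstmx _ X.
Proof.
move=> hf; have hu := uext_hom hf; apply/matrixP => i j; rewrite !mxE.
by rewrite (homZ hu) (hom1 hu).
Qed.

Lemma potential_pullback d e (f : mseries R e -> mseries R d)
    (c : connection R e n) psi : cont_alg_hom f ->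
  potential c psi -> potential (pullback f c) (fun l => f (psi l)).
Proof.
move=> hf [p0 pD]; split=> [l|i l]; first by rewrite hom_const.
rewrite (hom_der _ _ hf) (hom_sum (tincl_hom R d)) /= mulmx_suml summxE.
apply: eq_bigr => j _; rewrite (homM (tincl_hom R d)) -(uext_tincl (ms_der j (psi l)) hf) (pD j l).
rewrite mulscalemx [RHS]mxE -(uext_cstmx v hf) -(hmxM (uext_hom hf)).
by rewrite [in RHS]mxE.
Qed.
End Potentials.

Section Uniqueness.
Variables (R : idomainType) (QR : {rmorphism rat -> R}).

(** The columns of the inverse are the preimages of the basis vectors. *)
Lemma bij_mx_iso p q (M : 'M[R]_(p, q)) :
  bijective (fun xi : 'cV_q => M *m xi) -> mx_iso M.
Proof.
move=> [g gK Kg]; pose N : 'M[R]_(q, p) := \matrix_(i, j) g (delta_mx j 0) i 0.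
have MN : M *m N = 1%:M.
  apply/matrixP => i j; have := congr1 (fun X : 'cV[R]_p => X i 0) (Kg (delta_mx j 0)).
  rewrite /= !mxE eqxx andbT => <-; apply: eq_bigr => k _.
  by rewrite mxE.
exists N => //; apply: mulmx_cV_inj => s; apply: (can_inj gK).
by rewrite /= !mulmxA MN mul1mx mulmx1.
Qed.

Variables (d : nat) (F : Fbundle R d) (v : 'cV[R]_(fb_rank F)).
Local Notation n := (fb_rank F).
Variables (PF : 'M[mseries R d.+1]_n) (cF : connection R d n).
Hypotheses (isoPF : mx_iso PF) (PF1 : cst PF = 1%:M).
Hypotheses (tcF : tframed cF) (hPF : horizontal F cF PF).

(** The description of an unfolding in the trivialization extending that of
    [F], with coordinates given by the potential. *)
Record normal_form (X : unfolding F) := NormalForm {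
  nf_map : 'M[mseries R (unf_dim X).+1]_(n, fb_rank (unf_tgt X));
  nf_conn : connection R (unf_dim X) n;
  nf_psi : 'I_n -> mseries R (unf_dim X);
  nf_iso : mx_iso nf_map;
  nf_flat : flat nf_conn;
  nf_tframed : tframed nf_conn;
  nf_horizontal : horizontal (unf_tgt X) nf_conn nf_map;
  nf_res : map_mx (uext (unf_restr X)) nf_map *m unf_map X = PF;
  nf_pullback : pullback (unf_restr X) nf_conn = cF;
  nf_potential : potential v nf_conn nf_psi;
  nf_jac : mx_iso (jac nf_psi)
}.

Lemma normal_form_exists (X : unfolding F) :
  cyclic_vector (unf_tgt X) (induced_vector X v) -> inhabited (normal_form X).
Proof.
move=> cyc; have [P [c [isoP [fc tc] hP resP resc]]] := unf_tframing QR X isoPF tcF hPF.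
have [psi pot] := flat_potential QR v fc tc.
suff jacP : mx_iso (jac psi) by exists; exact: (NormalForm isoP fc tc hP resP resc pot jacP).
have [fibT _] := cst_conj hP; have [_ pD] := pot.
have Pv : cst P *m induced_vector X v = v.
  rewrite /induced_vector mulmxA -(cst_uext P (unf_res_hom X)) -map_mxM resP PF1.
  exact: mul1mx.
have jacE : jac psi = cst P *m \matrix_(i, j) (fiber_t (unf_tgt X) j *m induced_vector X v) i 0.
  apply/matrixP => l j; transitivity ((cst P *m (fiber_t (unf_tgt X) j *m induced_vector X v)) l 0).
    rewrite mulmxA (fibT j) -mulmxA Pv mxE -const_tincl pD -[v in RHS](cst_cstmx (unf_dim X).+1).
    by rewrite -map_mxM [RHS]mxE.
  by rewrite !mxE; apply: eq_bigr => i _; rewrite !mxE.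
rewrite jacE; apply: mx_isoM; first exact: mx_iso_map.
apply: bij_mx_iso; have [g gK Kg] := cyc; exists g => xi.
  rewrite -[RHS]gK; congr g; rewrite mu_vE; apply/matrixP => i j.
  rewrite ord1 mxE summxE; apply: eq_bigr => k _.
  by rewrite [RHS]mxE mxE mulrC.
rewrite -[RHS]Kg mu_vE; apply/matrixP => i j.
rewrite ord1 mxE summxE; apply: eq_bigr => k _.
by rewrite [RHS]mxE mxE mulrC.
Qed.

Section TwoUnfoldings.
Variables (X Y : unfolding F) (NX : normal_form X) (NY : normal_form Y).

Lemma zmx_nf (Z : unfolding F) (NZ : normal_form Z) e :
  zmx (unf_dim Z) e (nf_map NZ) *m zmx d e (unf_map Z) = zmx d e PF.
Proof. by rewrite -(nf_res NZ) zmxM (zmx_hom _ _ (unf_res_hom Z)). Qed.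

(** A morphism of unfoldings is the identity in the trivializations, and its
    effect on parameters matches the potentials. *)
Lemma unf_morphism_nf f P : unf_morphism X Y f P ->
  (forall l, f (nf_psi NY l) = nf_psi NX l) /\
  map_mx (uext f) (nf_map NY) *m P = nf_map NX.
Proof.
move=> [[hf hP] isoP resf resP]; have [P1 PXK P1K] := nf_iso NX.
set PX := nf_map NX in PXK P1K *; set PY := nf_map NY.
pose G := map_mx (uext f) PY *m P *m P1.
have hG : horizontal (nf_conn NX) (pullback f (nf_conn NY)) G.
  apply: horizontal_comp (horizontal_inv PXK P1K (nf_horizontal NX)) _.
  apply: horizontal_comp hP _; apply: (horizontal_pullback hf).
  exact: nf_horizontal.
have tY := tframed_pullback hf (nf_tframed NY).
have isoz : mx_iso (zmx (unf_dim X) (unf_dim X) PX *m zmx d (unf_dim X) (unf_map X)).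
  by rewrite zmx_nf; apply: zmx_iso.
have G1 : G = 1%:M.
  apply: (tframing_unique QR (nf_tframed NX) tY hG); rewrite p0tE.
  have E1 : zmx _ (unf_dim X) P *m zmx _ (unf_dim X) (unf_map X)
      = zmx _ (unf_dim X) (unf_map Y).
    by rewrite -(zmx_hom _ P (unf_res_hom X)) -zmxM resP.
  have E2 : zmx _ (unf_dim X) G *m (zmx _ (unf_dim X) PX *m zmx _ (unf_dim X) (unf_map X))
      = zmx _ (unf_dim X) PX *m zmx _ (unf_dim X) (unf_map X).
    have GPX : G *m PX = map_mx (uext f) PY *m P by rewrite /G -mulmxA P1K mulmx1.
    by rewrite mulmxA -zmxM GPX zmxM (zmx_hom _ _ hf) -mulmxA E1 (zmx_nf NY) (zmx_nf NX).
  by have [W zW _] := isoz; rewrite -[LHS]mulmx1 -zW mulmxA E2.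
have eqc : nf_conn NX = pullback f (nf_conn NY).
  by apply: horizontal1_eq; rewrite -G1.
split; last by rewrite -[LHS]mulmx1 -P1K mulmxA -/G G1 mul1mx.
apply: (eq_potential QR (v := v) (c := nf_conn NX)); last exact: nf_potential.
by rewrite eqc; apply: potential_pullback (nf_potential NY).
Qed.

(** The parameters of the two unfoldings are matched by the potentials. After
    this change of parameters both connections extend that of [F] with the same
    images of the cyclic vector, so that they agree. *)
Lemma unf_morphism_exists (gc : GC' F v) : exists f P, unf_morphism X Y f P.
Proof.
have [pX0 pXD] := nf_potential NX.
have [f hf fpsi] := hom_psi_exists QR (nf_potential NY).1 (nf_jac NY) pX0.
have hX := unf_res_hom X; have hY := unf_res_hom Y.
have resf a : unf_restr X (f a) = unf_restr Y a.
  move: a; apply: (hom_psi_unique QR (nf_potential NY).1 (nf_jac NY)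
    (cont_hom_comp hX hf) hY) => l.
  rewrite /= fpsi; apply: (eq_potential QR (v := v) (c := cF)
    (psi := fun l => unf_restr X (nf_psi NX l))
    (psi' := fun l => unf_restr Y (nf_psi NY l))).
    by rewrite -(nf_pullback NX); apply: potential_pullback (nf_potential NX).
  by rewrite -(nf_pullback NY); apply: potential_pullback (nf_potential NY).
have [fibT fibU] := cst_conj hPF; rewrite PF1 in fibT fibU.
have resc : pullback (unf_restr X) (pullback f (nf_conn NY)) = cF.
  rewrite pullback_comp // -(nf_pullback NY); exact: eq_pullback.
have eq_res (c1 c2 : connection R (unf_dim X) n) :
    pullback (unf_restr X) c1 = pullback (unf_restr X) c2 ->
    (forall i, map_mx (uext (unf_restr X)) (conn_t c1 (unf_incl X i))
             = map_mx (uext (unf_restr X)) (conn_t c2 (unf_incl X i))) /\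
    map_mx (uext (unf_restr X)) (conn_u c1) = map_mx (uext (unf_restr X)) (conn_u c2).
  move=> eqc; split=> [i|]; last exact: (congr1 (@conn_u _ _ _) eqc).
  have := congr1 (fun c => conn_t c i) eqc; rewrite /= /unf_restr.
  by rewrite !(sum_restr_var (@unf_incl_inj _ _ _ X) (fun j => map_mx _ _)).
have resX : pullback (unf_restr X) (nf_conn NX) = cF := nf_pullback NX.
have [eqT eqU] := eq_res _ _ (etrans resX (esym resc)).
have pr0_eq p q (M M' : 'M[mseries R (unf_dim X).+1]_(p, q)) :
    map_mx (uext (unf_restr X)) M = map_mx (uext (unf_restr X)) M' ->
    map_mx (pr0 (ypred (@unf_incl _ _ _ X))) M = map_mx (pr0 (ypred (@unf_incl _ _ _ X))) M'.
  move=> /matrixP eqM; apply/matrixP => i j; have := eqM i j; rewrite !mxE.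
  by apply: pr0_ypred; apply: unf_incl_inj.
have eqc : nf_conn NX = pullback f (nf_conn NY).
  have sysX := (flat_tsystem (nf_tframed NX)).1 (nf_flat NX).
  have tY := tframed_pullback hf (nf_tframed NY).
  have sysY := (flat_tsystem tY).1 (flat_pullback hf (nf_flat NY)).
  have [||||eqA eqUU] := tsystem_unique QR (iota := @unf_incl _ _ _ X) (v := v) sysX sysY.
  - move=> i; apply/matrixP => l j; rewrite ord1 -pXD.
    have [_ pYD] := potential_pullback hf (nf_potential NY).
    by rewrite -pYD fpsi.
  - by move=> i; apply: pr0_eq.
  - exact: pr0_eq.
  - move=> l; have [r [x [r0 rx]]] := GC'_expr gc l; exists r, x; split=> //.
    rewrite -rx; have UE : cst (conn_u (nf_conn NX)) = fiber_K F.
      rewrite -(cst_uext _ hX); have -> : map_mx (uext (unf_restr X)) (conn_u (nf_conn NX))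
        = conn_u cF by rewrite -resX.
      by move: fibU; rewrite mul1mx mulmx1 => <-.
    rewrite UE; congr (_ *m v); apply: eq_mev => // i.
    rewrite -(cst_uext _ hX) -(sum_restr_var (@unf_incl_inj _ _ _ X)
      (fun j => map_mx (uext (unf_restr X)) (conn_t (nf_conn NX) j))).
    have := congr1 (fun c => conn_t c i) resX; rewrite /= => ->.
    by have := fibT i; rewrite mul1mx mulmx1 => <-.
  exact: eq_connection.
have [Q PYK QK] := nf_iso NY.
have hu := uext_hom hf; pose P := map_mx (uext f) Q *m nf_map NX.
have fQK : map_mx (uext f) Q *m map_mx (uext f) (nf_map NY) = 1%:M.
  by rewrite -(hmxM hu) QK (hmx1 hu).
have fKQ : map_mx (uext f) (nf_map NY) *m map_mx (uext f) Q = 1%:M.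
  by rewrite -(hmxM hu) PYK (hmx1 hu).
exists f, P; split.
- split; first exact: hf.
  apply: horizontal_comp (nf_horizontal NX) _; rewrite eqc.
  apply: (horizontal_inv fKQ fQK); apply: (horizontal_pullback hf).
  exact: nf_horizontal.
- apply: mx_isoM; last exact: nf_iso.
  by exists (map_mx (uext f) (nf_map NY)).
- exact: resf.
have hresX := uext_hom hX; have hresY := uext_hom hY.
rewrite /P (hmxM hresX) -mulmxA (nf_res NX) -(nf_res NY) hmx_comp.
rewrite (eq_hmx (h := unf_restr Y)) // mulmxA -(hmxM hresY) QK (hmx1 hresY).
exact: mul1mx.
Qed.
End TwoUnfoldings.

Lemma unf_morphism_comp X Y (NX : normal_form X) (NY : normal_form Y) f P g Q :
  unf_morphism X Y f P -> unf_morphism Y X g Q ->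
  cancel g f /\ map_mx (uext f) Q *m P = 1%:M.
Proof.
move=> mf mg; have [[hf _] _ _ _] := mf; have [[hg _] _ _ _] := mg.
have [fpsi fP] := unf_morphism_nf NX NY mf; have [gpsi gQ] := unf_morphism_nf NY NX mg.
have gK : cancel g f.
  apply: (hom_psi_unique QR (nf_potential NX).1 (nf_jac NX)
    (cont_hom_comp hf hg) (cont_hom_id R _)) => l.
  by rewrite /= gpsi fpsi.
split=> //; have hu := uext_hom hf; have [PX1 PXK PX1K] := nf_iso NX.
have fgQ : nf_map NX *m map_mx (uext f) Q = map_mx (uext f) (nf_map NY).
  rewrite -gQ (hmxM hu) hmx_comp (eq_hmx (h := id)) //; congr (_ *m _).
  by apply/matrixP => i j; rewrite mxE uext_id.
by rewrite -[LHS]mul1mx -PX1K -(mulmxA PX1) (mulmxA (nf_map NX)) fgQ fP.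
Qed.

Lemma max_unfolding_unique X Y : GC' F v ->
  cyclic_vector (unf_tgt X) (induced_vector X v) ->
  cyclic_vector (unf_tgt Y) (induced_vector Y v) ->
  exists f P, unf_isomorphism X Y f P /\
    forall f' P', unf_isomorphism X Y f' P' -> f' =1 f /\ P' = P.
Proof.
move=> gc /normal_form_exists[NX] /normal_form_exists[NY].
have [f [P mf]] := unf_morphism_exists NX NY gc.
have [g [Q mg]] := unf_morphism_exists NY NX gc.
have [gK fQ] := unf_morphism_comp NX NY mf mg.
have [fK gP] := unf_morphism_comp NY NX mg mf.
exists f, P; split; first by split=> //; exists g, Q.
move=> f' P' [mf' _]; have [[hf _] _ _ _] := mf; have [[hf' _] _ _ _] := mf'.
have [fpsi fP] := unf_morphism_nf NX NY mf.
have [fpsi' fP'] := unf_morphism_nf NX NY mf'.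
have eqf : f' =1 f.
  apply: (hom_psi_unique QR (nf_potential NY).1 (nf_jac NY) hf' hf) => l.
  by rewrite fpsi fpsi'.
split=> //; have [PY1 PYK PY1K] := hmx_iso (uext_hom hf) (nf_iso NY).
rewrite -[LHS]mul1mx -PY1K -mulmxA -(eq_hmx _ eqf) fP' -fP.
by rewrite mulmxA PY1K mul1mx.
Qed.
End Uniqueness.

Theorem theorem1p3 (R : idomainType) (QR : {rmorphism rat -> R}) (d : nat)
    (F : Fbundle R d) (v : 'cV[R]_(fb_rank F)) :
  [/\ (IC F v -> GC F v -> free_coker (mu_v F v) ->
       exists X : unfolding F, maximal (unf_tgt X) /\
         cyclic_vector (unf_tgt X) (induced_vector X v)),
      (GC' F v -> forall X Y : unfolding F,
       maximal (unf_tgt X) -> cyclic_vector (unf_tgt X) (induced_vector X v) ->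
       maximal (unf_tgt Y) -> cyclic_vector (unf_tgt Y) (induced_vector Y v) ->
       exists f P, unf_isomorphism X Y f P /\
         forall f' P', unf_isomorphism X Y f' P' ->
           f' =1 f /\ P' = P)
    & (forall X : unfolding F, maximal (unf_tgt X) ->
       forall r (P : 'M[mseries R d.+1]_(r, fb_rank F)), framing F P ->
       exists! P' : 'M[mseries R (unf_dim X).+1]_(r, fb_rank (unf_tgt X)),
         framing (unf_tgt X) P' /\ map_mx (uext (unf_restr X)) P' *m unf_map X = P)].
Proof.
split; first exact: max_unfolding.
- move=> gc X Y _ cycX _ cycY.
  have iso1 : mx_iso (1%:M : 'M[mseries R d.+1]_(fb_rank F)) by exists 1%:M; rewrite mulmx1.
  have [|P [c [isoP P0 _ tc hP]]] := tframing_exists QR (fb_flat F) iso1.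
    exact: map_mx1.
  have P1 : cst P = 1%:M by rewrite -p0t_cst P0 map_mx1.
  exact: (max_unfolding_unique QR isoP P1 tc hP gc cycX cycY).
by move=> X _ r P; apply: unf_framing.
Qed.
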